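(* Let $\vec\psi$ satisfy (H1), let $G_n\to_{lwc}\mu$, and let $\mu$ satisfy (H2). (a) Fix $B$ and $\beta_0<\beta_1$. Suppose $h\in\mathcal H^\star$ on $[\beta_0,\beta_1]\times\{B\}$, $h$ satisfies (H3$^\beta$) on $[\beta_0,\beta_1]$, and for every $\beta\in[\beta_0,\beta_1]$, $\limsup_n a^{\mathrm e}_n(\beta,B)\le a^{\mathrm e}(\beta,B,h)$. Then $$\limsup_{n\to\infty}[\phi_n(\beta_1,B)-\phi_n(\beta_0,B)]\le\Phi_\mu(\beta_1,B,h)-\Phi_\mu(\beta_0,B,h).$$ (b) Fix $\beta$ and $B_0<B_1$. Suppose $h\in\mathcal H^\star$ on $\{\beta\}\times[B_0,B_1]$, $h$ satisfies (H3$^B$) on $[B_0,B_1]$, and for every $B\in[B_0,B_1]$, $\limsup_n a^{\mathrm{vx}}_n(\beta,B)\le a^{\mathrm{vx}}(\beta,B,h)$. Then $$\limsup_{n\to\infty}[\phi_n(\beta,B_1)-\phi_n(\beta,B_0)]\le\Phi_\mu(\beta,B_1,h)-\Phi_\mu(\beta,B_0,h).$$ The same conclusions hold with all inequalities reversed and $\limsup$ replaced by $\liminf$ (i.e. if $\liminf_n a_n\ge a(\cdot,h)$ then $\liminf$ of the increments $\ge$ the Bethe increments).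
   Context: Graphs are undirected and locally finite; $\partial v$ neighbours, $D_v=|\partial v|$, $B_t(v)$ ball of radius $t$. $\mathcal T_*$: rooted trees $(T,o)$ up to isomorphism with the local metric; $T_t=B_t(o)$; $T_0$ the one-vertex tree. A measure $\mu$ on rooted graphs is unimodular if $\mathbb E_\mu[\sum_x f(G,o,x)]=\mathbb E_\mu[\sum_x f(G,x,o)]$ for all nonnegative Borel $f$ on doubly-rooted graphs. ''$G_n\to_{lwc}\mu$'': random finite graphs $G_n=(V_n=[n],E_n)$, $I_n$ uniform on $V_n$, $\mathbb E_n$ expectation over $G_n,I_n$; $(G_n)$ uniformly sparse ($\lim_L\limsup_n\mathbb E_n[D_{I_n}\mathbf 1\{D_{I_n}\ge L\}]=0$); $B_t(I_n)\to T_t$ in law for each $t$ where $T\sim\mu$ on $\mathcal T_*$ (unimodular); $\mu(D_o=0)<1$. Specification: finite $\mathscr X$; symmetric $\psi^\beta:\mathscr X^2\to[0,\infty)$ ($\beta\in\mathbb R$), $\bar\psi^B:\mathscr X\to[0,\infty)$ ($B\in\mathbb R$); $\xi=\log\psi$, $\bar\xi=\log\bar\psi$ with $\log0=-\infty$. Factor model on finite $G=(V,E)$: $\nu_G(\vec\sigma)=Z_G(\beta,B)^{-1}\prod_{(ij)\in E}\psi^\beta(\sigma_i,\sigma_j)\prod_i\bar\psi^B(\sigma_i)$; $\langle\cdot\rangle_n^{\beta,B}$ expectation under $\nu_{G_n}$ given $G_n$; $\phi_n(\beta,B)=\frac1n\mathbb E_n\log Z_{G_n}(\beta,B)$. (H1):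 $\bar\psi^B(\sigma)>0$ for all $\sigma$; some $\sigma^{\mathrm{perm}}\in\mathscr X$ has $\min_\sigma\psi^\beta(\sigma,\sigma^{\mathrm{perm}})>0$; $\bar\xi^B(\sigma)$ is $C^1$ in $B$; each $\xi^\beta(\sigma,\sigma')$ is either $\equiv-\infty$ in $\beta$ or finite and $C^1$ in $\beta$ (set $\partial_\beta\xi\equiv0$ in the former case). (H2): $\mathbb E_\mu[D_o]<\infty$, and if $\psi$ is not everywhere positive then $\mathbb E_\mu[e^{cD_o}]<\infty$ for all $c\in\mathbb R$. Messages: $\mathcal T_\to$ = trees rooted at a directed edge $x\to y$; $\mu^\uparrow$ = law of $(T,J\to o)$, $T\sim\mu$ conditioned on $D_o\ge1$, $J$ uniform on $\partial o$. A message $h$ is a measurable $(T,x\to y,\beta,B)\mapsto h^{\beta,B}_{x\to y}\in\Delta_{\mathscr X}$ modulo $\mu^\uparrow$-null sets. BP map: $(\mathrm{BP}^{\beta,B}h)_{x\to y}(\sigma)\propto\bar\psi^B(\sigma)\prod_{v\in\partial x\setminus y}\sum_{\sigma_v}\psi^\beta(\sigma,\sigma_v)h_{v\to x}(\sigma_v)$. ''$h\in\mathcal H^\star$'' on a set of parameters means $h^{\beta,B}=\mathrm{BP}^{\beta,B}h^{\beta,B}$ $\mu^\uparrow$-a.s. for each $(\beta,B)$ in it. Bethe functional: $\Phi_T(\beta,B,h)=\log\{\sum_\sigma\bar\psi(\sigma)\prod_{j\in\partial o}\sum_{\sigma_j}\psi(\sigma,\sigma_j)h_{j\to o}(\sigma_j)\}-\frac12\sum_{j\in\partial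 o}\log\{\sum_{\sigma,\sigma_j}\psi(\sigma,\sigma_j)h_{j\to o}(\sigma_j)h_{o\to j}(\sigma)\}$ (all at $(\beta,B)$), $\Phi_\mu=\mathbb E_\mu\Phi_T$. Tree measures: for such a fixed point $h$ and $T\in\mathcal T_*$, $\nu^h_T$ is the unique probability measure on $\mathscr X^{V(T)}$ whose marginal on every finite connected subtree $U\ni o$ is proportional to $\sum_{\vec\sigma_{\partial U}}\prod_{(ij)\in E(U^+)}\psi(\sigma_i,\sigma_j)\prod_{i\in U}\bar\psi(\sigma_i)\prod_{v\in\partial U}h_{v\to p(v)}(\sigma_v)$, where $\partial U$ are vertices outside $U$ adjacent to $U$, $U^+$ the subgraph induced by $U\cup\partial U$, and $p(v)$ the neighbour of $v$ in $U$; $\langle\cdot\rangle^{h,\beta,B}_T$ is its expectation. Derivative functionals: $a^{\mathrm e}_n(\beta,B)=\frac12\mathbb E_n[\sum_{j\in\partial I_n}\langle\partial_\beta\xi(\sigma_{I_n},\sigma_j)\rangle_n^{\beta,B}]$, $a^{\mathrm e}(\beta,B,h)=\frac12\mathbb E_\mu[\sum_{j\in\partial o}\langle\partial_\beta\xi(\sigma_o,\sigma_j)\rangle^{h,\beta,B}_T]$, $a^{\mathrm{vx}}_n(\beta,B)=\mathbb E_n[\langle\partial_B\bar\xi(\sigma_{I_n})\rangle^{\beta,B}_n]$, $a^{\mathrm{vx}}(\beta,B,h)=\mathbb E_\mu[\langle\partial_B\bar\xi(\sigma_o)\rangle^{h,\beta,B}_T]$. (H3$^\beta$) on $[\beta_0,\beta_1]$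 (with $B$ fixed): $\mu^\uparrow$-a.s., for every $\sigma$, $\beta\mapsto h^{\beta,B}_{x\to y}(\sigma)$ is continuous on $[\beta_0,\beta_1]$ with total variation bounded by a deterministic constant depending only on $\beta_0,\beta_1$. (H3$^B$) on $[B_0,B_1]$ is the analogous condition in $B$ with $\beta$ fixed. *)

(* Defs.v *)
From HB Require Import structures.
From mathcomp Require Import all_boot all_order all_algebra.
From mathcomp Require Import all_classical all_reals all_analysis.
From mathcomp Require Import finmap measurable_realfun.

Set Implicit Arguments.
Unset Strict Implicit.
Unset Printing Implicit Defensive.

Import Order.TTheory GRing.Theory Num.Theory.
Import numFieldNormedType.Exports.

Local Open Scope classical_set_scope.
Local Open Scope ring_scope.

(* A rooted graph is an adjacency relation g on nat, rooted at vertex 0;    *)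
(* only the connected component of 0 matters.  The measurable structure is  *)
(* the product sigma-algebra generated by the coordinates g i j.            *)

Definition rawgraph := nat -> nat -> bool.

Definition gcyl : set (set rawgraph) :=
  [set [set g : rawgraph | g p.1 p.2] | p in [set: nat * nat]].

Notation graphT := (g_sigma_algebraType gcyl).

Inductive reach (g : graphT) (x : nat) : nat -> Prop :=
| reach_refl : reach g x x
| reach_step y z : reach g x y -> g y z -> reach g x z.

Definition Vset (g : graphT) : set nat := [set x | reach g 0 x].

Definition nbr (g : graphT) (x : nat) : set nat := [set y | g x y].
Definition nbrs (g : graphT) (x : nat) : {fset nat} := fset_set (nbr g x).
Definition deg (g : graphT) (x : nat) : nat := #|` nbrs g x|.

Definition is_lf_tree (g : graphT) : Prop :=
  [/\ (forall x y, Vset g x -> g x y = g y x),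
      (forall x, Vset g x -> ~~ g x x),
      (forall x, Vset g x -> finite_set (nbr g x)) &
      (forall x (s : seq nat), Vset g x -> uniq (x :: s) -> (2 <= size s)%N ->
          path (fun a b => g a b) x s -> ~~ g (last x s) x)].

Definition sw (y x : nat) : nat :=
  if x == 0%N then y else if x == y then 0%N else x.
Definition reroot (g : graphT) (y : nat) : graphT :=
  fun i j => g (sw y i) (sw y j).

Definition riso (g1 g2 : graphT) (phi : nat -> nat) : Prop :=
  [/\ phi 0%N = 0%N, {in Vset g1 &, injective phi}, phi @` Vset g1 = Vset g2 &
      forall x y, Vset g1 x -> Vset g1 y -> g2 (phi x) (phi y) = g1 x y].

(* functions of doubly-rooted graphs (g, 0, x) that are isomorphism invariant;
   a pair (g, x) with x a neighbour of 0 encodes a tree rooted at the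
   directed edge x -> 0 *)
Definition dr_invariant (T : Type) (f : graphT * nat -> T) : Prop :=
  forall g1 g2 phi x, riso g1 g2 phi -> Vset g1 x -> f (g1, x) = f (g2, phi x).

Section Limit.
Variable R : realType.
Local Open Scope ereal_scope.

(* unimodularity (restricted to trees: mu is a law on T_* ) *)
Definition unimodular (mu : probability graphT R) : Prop :=
  forall f : graphT * nat -> \bar R,
    (forall p, 0 <= f p) -> measurable_fun setT f -> dr_invariant f ->
    \int[mu]_g (\esum_(x in Vset g) f (g, x))
    = \int[mu]_g (\esum_(x in Vset g) f (reroot g x, x)).

(* "mu^up-almost surely": T ~ mu conditioned on D_o >= 1, J uniform on the
   neighbours of o; a property of (T, J -> o) holds mu^up-a.s. iff mu-a.s.
   it holds for every neighbour J of the root *)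
Definition upae (mu : probability graphT R) (Pr : graphT -> nat -> Prop) :=
  {ae mu, forall g, forall j, (g : graphT) 0%N j -> Pr g j}.
End Limit.

(* A graph is given by a set of ordered pairs E, with adjacency the simple  *)
(* undirected graph adjf E.  A random graph G_n is a law P n on such sets.  *)

Definition fgr (n : nat) := {set 'I_n * 'I_n}.

Definition adjf n (E : fgr n) (i j : 'I_n) : bool :=
  (i != j) && (((i, j) \in E) || ((j, i) \in E)).

Definition degf n (E : fgr n) (i : 'I_n) : nat := #|[set j | adjf E i j]|.

Fixpoint fball n (E : fgr n) (v : 'I_n) (t : nat) : {set 'I_n} :=
  if t is t'.+1 then
    fball E v t' :|: [set y | [exists x in fball E v t', adjf E x y]]
  else [set v].

Fixpoint gball (g : graphT) (t : nat) : set nat :=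
  if t is t'.+1 then gball g t' `|` [set y | exists2 x, gball g t' x & g x y]
  else [set 0%N].

Definition fiso n (E : fgr n) (v : 'I_n) (t k : nat) (H : fgr k.+1) :=
  exists f : 'I_k.+1 -> 'I_n,
    [/\ f ord0 = v, injective f,
        (forall w, w \in fball E v t <-> exists a, f a = w) &
        forall a b, adjf H a b = adjf E (f a) (f b)].

Definition giso (g : graphT) (t k : nat) (H : fgr k.+1) :=
  exists f : 'I_k.+1 -> nat,
    [/\ f ord0 = 0%N, injective f,
        (forall w, gball g t w <-> exists a, f a = w) &
        forall a b, adjf H a b = g (f a) (f b)].

Section Model.
Variables (R : realType) (X : finType).
Variables (psi : R -> X -> X -> R) (psib : R -> X -> R).

(* (H1) together with the symmetry of psi *)
Definition H1 : Prop :=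
  [/\ (forall b s t, 0 <= psi b s t /\ psi b s t = psi b t s),
      (forall B s, 0 < psib B s),
      (exists sp : X, forall b s, 0 < psi b s sp),
      (forall s, (forall B, derivable (fun B' => ln (psib B' s)) B 1) /\
                 continuous (derive1 (fun B' => ln (psib B' s)))) &
      (forall s t, (forall b, psi b s t = 0) \/
         ((forall b, 0 < psi b s t) /\
          (forall b, derivable (fun b' => ln (psi b' s t)) b 1) /\
          continuous (derive1 (fun b' => ln (psi b' s t)))))].

(* d/dbeta xi, set to 0 when xi = -oo identically *)
Definition dxi (b : R) (s t : X) : R :=
  if pselect (forall b', psi b' s t = 0) then 0
  else derive1 (fun b' => ln (psi b' s t)) b.
Definition dxib (B : R) (s : X) : R := derive1 (fun B' => ln (psib B' s)) B.

Definition wt n (E : fgr n) (b B : R) (s : {ffun 'I_n -> X}) : R :=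
  (\prod_(i : 'I_n) \prod_(j : 'I_n | (i < j)%N && adjf E i j) psi b (s i) (s j))
  * \prod_(i : 'I_n) psib B (s i).

Definition Zf n (E : fgr n) (b B : R) : R := \sum_(s : {ffun 'I_n -> X}) wt E b B s.

Definition gavg n (E : fgr n) (b B : R) (f : {ffun 'I_n -> X} -> R) : R :=
  (\sum_(s : {ffun 'I_n -> X}) f s * wt E b B s) / Zf E b B.

Definition En (P : forall n, fgr n -> R) (n : nat) (F : fgr n -> 'I_n -> R) : R :=
  \sum_(E : fgr n) P n E * (n%:R^-1 * \sum_(i : 'I_n) F E i).

Definition phin (P : forall n, fgr n -> R) (n : nat) (b B : R) : R :=
  n%:R^-1 * \sum_(E : fgr n) P n E * ln (Zf E b B).

Definition aen (P : forall n, fgr n -> R) (n : nat) (b B : R) : R :=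
  2^-1 * @En P n (fun E i => \sum_(j : 'I_n | adjf E i j)
                            gavg E b B (fun s => dxi b (s i) (s j))).

Definition avxn (P : forall n, fgr n -> R) (n : nat) (b B : R) : R :=
  @En P n (fun E i => gavg E b B (fun s => dxib B (s i))).

Definition lwc (P : forall n, fgr n -> R) (mu : probability graphT R) : Prop :=
  [/\ (forall n E, 0 <= P n E) /\ (forall n, \sum_(E : fgr n) P n E = 1),
      ((fun L : nat => limn_esup (fun n =>
          (@En P n (fun E i => ((degf E i) * (L <= degf E i))%:R))%:E)) @ \oo
         --> 0%E),
      {ae mu, forall g, is_lf_tree g} /\ unimodular mu,
      (forall t k (H : fgr k.+1),
        (fun n => (@En P n (fun E v => (`[< fiso E v t H >] : bool)%:R))%:E) @ \oo
          --> mu [set g | giso g t H]) &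
      (mu [set g | deg g 0 = 0%N] < 1)%E].

Definition H2 (mu : probability graphT R) : Prop :=
  (\int[mu]_g ((deg g 0)%:R)%:E < +oo)%E /\
  (~ (forall b s t, 0 < psi b s t) ->
     forall c : R, (\int[mu]_g (expR (c * (deg g 0)%:R))%:E < +oo)%E).

(* h (g, x) b B : the message on the directed edge x -> 0 *)
Definition msgT := graphT * nat -> R -> R -> X -> R.

(* h^{b,B}_{x -> y} in the rooted graph g *)
Definition msg (h : msgT) (g : graphT) (x y : nat) (b B : R) (s : X) : R :=
  h (reroot g y, sw y x) b B s.

Definition is_msg (h : msgT) : Prop :=
  [/\ (forall p b B s, 0 <= h p b B s),
      (forall p b B, \sum_(s : X) h p b B s = 1),
      (forall s, measurable_fun setT
          (fun q : (graphT * nat) * (R * R) => h q.1 q.2.1 q.2.2 s)) &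
      (forall b B s, dr_invariant (fun p => h p b B s))].

Definition BPun (h : msgT) g x y b B s : R :=
  psib B s * \prod_(v <- nbrs g x | v != y)
               (\sum_(t : X) psi b s t * msg h g v x b B t).

Definition BP (h : msgT) g x y b B s : R :=
  BPun h g x y b B s / \sum_(s' : X) BPun h g x y b B s'.

Definition isFP (mu : probability graphT R) (h : msgT) (b B : R) : Prop :=
  upae mu (fun g j => forall s, h (g, j) b B s = BP h g j 0 b B s).

Definition PhiT (h : msgT) (g : graphT) (b B : R) : R :=
  ln (\sum_(s : X) psib B s * \prod_(j <- nbrs g 0)
         (\sum_(t : X) psi b s t * h (g, j) b B t))
  - 2^-1 * \sum_(j <- nbrs g 0)
       ln (\sum_(s : X) \sum_(t : X) psi b s t * h (g, j) b B t * msg h g 0 j b B s).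

Definition Phimu (mu : probability graphT R) (h : msgT) (b B : R) : \bar R :=
  \int[mu]_g (PhiT h g b B)%:E.

(* marginal of nu^h_T on U = {o} (unnormalised) *)
Definition w1 (h : msgT) g b B (so : X) : R :=
  psib B so * \prod_(v <- nbrs g 0) (\sum_(t : X) psi b so t * h (g, v) b B t).

(* marginal of nu^h_T on U = {o, j}, j a neighbour of o (unnormalised) *)
Definition w2 (h : msgT) g j b B (so sj : X) : R :=
  psi b so sj * psib B so * psib B sj
  * \prod_(v <- nbrs g 0 | v != j) (\sum_(t : X) psi b so t * h (g, v) b B t)
  * \prod_(w <- nbrs g j | w != 0%N) (\sum_(t : X) psi b sj t * msg h g w j b B t).

Definition tavg1 h g b B (f : X -> R) : R :=
  (\sum_(so : X) f so * w1 h g b B so) / \sum_(so : X) w1 h g b B so.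

Definition tavg2 h g j b B (f : X -> X -> R) : R :=
  (\sum_(so : X) \sum_(sj : X) f so sj * w2 h g j b B so sj)
  / \sum_(so : X) \sum_(sj : X) w2 h g j b B so sj.

Definition ae_lim (mu : probability graphT R) (h : msgT) (b B : R) : \bar R :=
  (2^-1)%:E * \int[mu]_g (\sum_(j <- nbrs g 0) tavg2 h g j b B (dxi b))%:E.

Definition avx_lim (mu : probability graphT R) (h : msgT) (b B : R) : \bar R :=
  \int[mu]_g (tavg1 h g b B (dxib B))%:E.

Definition H3b (mu : probability graphT R) (h : msgT) (B b0 b1 : R) : Prop :=
  exists C : R, upae mu (fun g j => forall s,
    {within `[b0, b1], continuous (fun b => h (g, j) b B s)} /\
    (total_variation b0 b1 (fun b => h (g, j) b B s) <= C%:E)%E).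

Definition H3B (mu : probability graphT R) (h : msgT) (b B0 B1 : R) : Prop :=
  exists C : R, upae mu (fun g j => forall s,
    {within `[B0, B1], continuous (fun B => h (g, j) b B s)} /\
    (total_variation B0 B1 (fun B => h (g, j) b B s) <= C%:E)%E).

End Model.

(* Main.v *)
(* Along an interval of parameters phi_n has derivative a_n, and uniform
   sparsity bounds a_n uniformly in n, so by the reverse Fatou lemma the limsup
   of the increment is at most the integral of a(., h). It remains to see that
   this integral is the increment of Phi_mu, although h is merely continuous and
   of bounded variation in the parameter. Expand Phi_T to first order along
   uniform partitions: the explicit parameter contributes mesh * A with
   E A = a(., h), while by the fixed-point equation the increments of the
   messages contribute 1/2 sum_j (G(j -> o) - G(o -> j)), which has mean zero by
   unimodularity. The remainder tends to 0 pointwise and is dominated, since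
   Phi_T telescopes and the messages have bounded variation. Parts (a) and (b)
   are the same statement about a one-parameter family of models. *)
Require Import Defs.
From HB Require Import structures.
From mathcomp Require Import all_boot all_order all_algebra.
From mathcomp Require Import all_classical all_reals all_analysis.
From mathcomp Require Import finmap measurable_realfun.
From mathcomp Require Import ring lra.

Set Implicit Arguments.
Unset Strict Implicit.
Unset Printing Implicit Defensive.

Import Order.TTheory GRing.Theory Num.Theory.
Import numFieldNormedType.Exports.
Local Open Scope classical_set_scope.
Local Open Scope ring_scope.

(** What shapes the argument is that the fixed-point equation holds outside a null set depending on
    the parameter, so on a given tree it can be used at countably many parameters only. The nodes of
    all uniform partitions form such a set, and continuity of the limiting derivative [alpha] is
    likewise tested along sequences. The antisymmetric form of the message terms comes from a count.
    The vertex term [ln Zo] sees the increment of each incoming message with full weight, while half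
    of [ln Ze] takes away half of the increments in both directions of the edge. The same count
    leaves one half of each explicit edge derivative, the factor in [ae_lim]. Domination depends on
    the zeros of [psi]. If [psi] is positive, [Ze] is bounded below by a constant. Otherwise only
    the permissive spin gives a lower bound on [Ze], through the fixed-point equation, and this
    bound decays exponentially in the degree of the root; the exponential moments in (H2) pay for
    it. The two parameters are merged into one variable [th]; making [psib] or [psi] constant in its
    parameter afterwards removes one of the two derivatives. *)

Lemma le_of_eq (R : numDomainType) (x y : R) : x = y -> x <= y.
Proof. by move->. Qed.

(** * Null sequences in epsilon form *)

Section NullSequences.
Variable R : realType.
Implicit Types x y : nat -> R.

Definition nul x := forall e : R, 0 < e ->
  exists M, forall N, (M <= N)%N -> `|x N| <= e.

Lemma nul_le x y : (forall N, `|x N| <= `|y N|) -> nul y -> nul x.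
Proof.
by move=> xy ny e e0; have [M HM] := ny e e0; exists M => N /HM; exact: le_trans.
Qed.

Lemma nul0 : nul (fun=> 0).
Proof. by move=> e e0; exists 0%N => N _; rewrite normr0 ltW. Qed.

Lemma nulD x y : nul x -> nul y -> nul (fun N => x N + y N).
Proof.
move=> nx ny e e0.
have [M1 H1] := nx (e / 2) (divr_gt0 e0 (ltr0Sn _ 1)).
have [M2 H2] := ny (e / 2) (divr_gt0 e0 (ltr0Sn _ 1)).
exists (maxn M1 M2) => N; rewrite geq_max => /andP[/H1 h1 /H2 h2].
by rewrite (le_trans (ler_normD _ _))// [leRHS](splitr e) lerD.
Qed.

Lemma nulZ (C : R) x : nul x -> nul (fun N => C * x N).
Proof.
move=> nx e e0; have C1 : 0 < `|C| + 1 by rewrite ltr_wpDl.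
have [M HM] := nx (e / (`|C| + 1)) (divr_gt0 e0 C1).
exists M => N /HM h; rewrite normrM.
rewrite (@le_trans _ _ ((`|C| + 1) * `|x N|))//.
  by rewrite ler_wpM2r// lerDl.
by rewrite mulrC -ler_pdivlMr.
Qed.

Lemma nul_cvg x : nul x -> x @ \oo --> (0 : R).
Proof.
move=> nx; apply/cvgrPdist_le => e e0; have [M HM] := nx e e0.
by exists M => // N /= MN; rewrite sub0r normrN; exact: HM.
Qed.

End NullSequences.

(** * First-order expansions along a path *)

Section Path.
Variables (R : realType) (t0 t1 : R).
Hypothesis t01 : t0 < t1.
Implicit Types (u v : R -> R) (L : nat -> nat -> R).

(** There are [N.+1] cells, so [N = 0] is already a genuine partition. Cells carry the indices
    [k <= N] and nodes the indices [k <= N.+1]. *)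
Definition pt (N k : nat) : R := t0 + (t1 - t0) * (k%:R / N.+1%:R).
Definition mesh (N : nat) : R := (t1 - t0) / N.+1%:R.
Definition inc u (N k : nat) : R := u (pt N k.+1) - u (pt N k).

Lemma mesh_ge0 N : 0 <= mesh N.
Proof. by rewrite /mesh divr_ge0// subr_ge0 ltW. Qed.

Lemma ptS N k : pt N k.+1 - pt N k = mesh N.
Proof. by rewrite /pt /mesh -natr1; field; rewrite lt0r_neq0. Qed.

Lemma pt0 N : pt N 0 = t0.
Proof. by rewrite /pt mul0r mulr0 addr0. Qed.

Lemma pt_last N : pt N N.+1 = t1.
Proof. by rewrite /pt divff ?lt0r_neq0// mulr1 addrC subrK. Qed.

Lemma pt_mem N k : (k <= N.+1)%N -> t0 <= pt N k <= t1.
Proof.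
move=> kN; have d0 : 0 <= t1 - t0 by rewrite subr_ge0 ltW.
rewrite /pt lerDl mulr_ge0//= -lerBrDl ler_piMr//.
by rewrite ler_pdivrMr// mul1r ler_nat.
Qed.

Lemma sum_mesh N : \sum_(k < N.+1) mesh N = t1 - t0.
Proof. by rewrite sumr_const card_ord /mesh -[LHS]mulr_natr divfK// lt0r_neq0. Qed.

Lemma sum_inc u N : \sum_(k < N.+1) inc u N k = u t1 - u t0.
Proof.
rewrite -(big_mkord xpredT (inc u N)) /inc telescope_sumr//.
by rewrite pt0 pt_last.
Qed.

Definition small u := forall e : R, 0 < e ->
  exists M, forall N, (M <= N)%N -> forall k, (k <= N)%N -> `|inc u N k| <= e.

Definition bvar u := exists C : R, forall N, \sum_(k < N.+1) `|inc u N k| <= C.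

(** The errors are summed over the cells because the increments telescope over a partition. The
    linear part [L] need not come from a derivative: it may contain increments of the messages
    themselves. *)
Definition lin u L := nul (fun N => \sum_(k < N.+1) `|inc u N k - L N k|).

Definition path u L := [/\ small u, bvar u & lin u L].

(** The value at a node is [u t0] plus a partial sum of increments. *)
Lemma bvar_bounded u : bvar u ->
  exists2 M : R, 0 <= M & forall N k, (k <= N.+1)%N -> `|u (pt N k)| <= M.
Proof.
move=> [C HC]; exists (`|u t0| + C).
  by rewrite addr_ge0// (le_trans _ (HC 0%N))// sumr_ge0.
move=> N k kN.
have -> : u (pt N k) = u t0 + \sum_(0 <= i < k) inc u N i.
  by rewrite telescope_sumr// pt0 addrC subrK.
rewrite (le_trans (ler_normD _ _))// lerD2l (le_trans (ler_norm_sum _ _ _))//.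
rewrite (le_trans _ (HC N))//.
rewrite -(big_mkord xpredT (fun k => `|inc u N k|)).
by rewrite [leRHS](big_cat_nat (n := k))//= lerDl sumr_ge0.
Qed.

Lemma lin_ext u L (L' : nat -> nat -> R) : (forall N k, (k <= N)%N -> L N k = L' N k) ->
  lin u L -> lin u L'.
Proof.
move=> Lv; apply: nul_le => N; apply: le_of_eq; congr `|_|.
by apply: eq_bigr => k _; rewrite Lv// -ltnS.
Qed.

Lemma linD u v L (L' : nat -> nat -> R) : lin u L -> lin v L' ->
  lin (fun x => u x + v x) (fun N k => L N k + L' N k).
Proof.
move=> lu lv; apply: nul_le (nulD lu lv) => N.
rewrite !ger0_norm ?addr_ge0 ?sumr_ge0// -big_split/=.
apply: ler_sum => k _; rewrite (le_trans _ (ler_normD _ _))// /inc.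
by apply: le_of_eq; congr `|_|; ring.
Qed.

Lemma linZ (c : R) u L : lin u L -> lin (fun x => c * u x) (fun N k => c * L N k).
Proof.
move=> lu; apply: nul_le (nulZ `|c| lu) => N.
rewrite [leLHS]ger0_norm ?sumr_ge0// [leRHS]ger0_norm ?mulr_ge0 ?sumr_ge0//.
rewrite mulr_sumr; apply: ler_sum => k _; rewrite -normrM /inc.
by apply: le_of_eq; congr `|_|; ring.
Qed.

Lemma lin0 : lin (fun=> 0) (fun _ _ => 0).
Proof.
apply: nul_le (@nul0 R) => N; rewrite big1 ?normr0// => k _.
by rewrite /inc !subrr normr0.
Qed.

Lemma lin_sum (I : Type) (r : seq I) (u : I -> R -> R) (L : I -> nat -> nat -> R) :
  (forall i, lin (u i) (L i)) ->
  lin (fun x => \sum_(i <- r) u i x) (fun N k => \sum_(i <- r) L i N k).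
Proof.
move=> lu; elim: r => [|i r IH].
  rewrite (_ : (fun x => _) = fun=> 0); last by apply/funext => x; rewrite big_nil.
  by apply: lin_ext lin0 => N k _; rewrite big_nil.
rewrite (_ : (fun x => _) = fun x => u i x + \sum_(j <- r) u j x); last first.
  by apply/funext => x; rewrite big_cons.
by apply: lin_ext (linD (lu i) IH) => N k _; rewrite big_cons.
Qed.

Lemma path_ext u L (L' : nat -> nat -> R) : (forall N k, (k <= N)%N -> L N k = L' N k) ->
  path u L -> path u L'.
Proof. by move=> LL' [su bu lu]; split => //; exact: lin_ext lu. Qed.

Lemma path_cst (c : R) : path (fun=> c) (fun _ _ => 0).
Proof.
split.
- by move=> e e0; exists 0%N => *; rewrite /inc subrr normr0 ltW.
- by exists 0 => N; rewrite big1// => k _; rewrite /inc subrr normr0.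
- apply: nul_le (@nul0 R) => N; rewrite big1 ?normr0// => k _.
  by rewrite /inc !subrr normr0.
Qed.

Lemma pathD u v L (L' : nat -> nat -> R) : path u L -> path v L' ->
  path (fun x => u x + v x) (fun N k => L N k + L' N k).
Proof.
move=> [su [C bu] lu] [sv [C' bv] lv]; split; last exact: linD.
- move=> e e0; have [M1 H1] := su _ (divr_gt0 e0 (ltr0Sn _ 1)).
  have [M2 H2] := sv _ (divr_gt0 e0 (ltr0Sn _ 1)).
  exists (maxn M1 M2) => N; rewrite geq_max => /andP[/H1 h1 /H2 h2] k kN.
  rewrite (_ : inc _ _ _ = inc u N k + inc v N k); last by rewrite /inc; ring.
  by rewrite (le_trans (ler_normD _ _))// [leRHS](splitr e) lerD ?h1 ?h2.
- exists (C + C') => N; apply: le_trans (lerD (bu N) (bv N)).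
  rewrite -big_split/=; apply: ler_sum => k _.
  by rewrite (le_trans _ (ler_normD _ _))// /inc; apply: le_of_eq; congr `|_|; ring.
Qed.

(** The error is [u] times the error of [v], plus [v] times the error of [u], plus [inc u * inc v].
    The last product sums to something negligible because one factor is uniformly small and the
    other has bounded variation, which is why [path] carries both properties along with [lin]. *)
Lemma pathM u v L (L' : nat -> nat -> R) : path u L -> path v L' ->
  path (fun x => u x * v x)
       (fun N k => u (pt N k) * L' N k + v (pt N k) * L N k).
Proof.
move=> [su bu lu] [sv bv lv].
have [Mu Mu0 Hu] := bvar_bounded bu; have [Mv Mv0 Hv] := bvar_bounded bv.
have key N k : inc (fun x => u x * v x) N k =
    u (pt N k.+1) * inc v N k + v (pt N k) * inc u N k by rewrite /inc; ring.
have bnd N k : (k <= N)%N ->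
    `|inc (fun x => u x * v x) N k| <= Mu * `|inc v N k| + Mv * `|inc u N k|.
  move=> kN; rewrite key (le_trans (ler_normD _ _))// !normrM lerD//.
    by rewrite ler_wpM2r// Hu.
  by rewrite ler_wpM2r// Hv// ltnW.
split.
- move=> e e0.
  have Mu1 : 0 < Mu + 1 by rewrite ltr_wpDl.
  have Mv1 : 0 < Mv + 1 by rewrite ltr_wpDl.
  have [M1 H1] := sv _ (divr_gt0 (divr_gt0 e0 (ltr0Sn _ 1)) Mu1).
  have [M2 H2] := su _ (divr_gt0 (divr_gt0 e0 (ltr0Sn _ 1)) Mv1).
  exists (maxn M1 M2) => N; rewrite geq_max => /andP[/H1 h1 /H2 h2] k kN.
  rewrite (le_trans (bnd _ _ kN))// [leRHS](splitr e) lerD//.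
    rewrite (@le_trans _ _ ((Mu + 1) * `|inc v N k|))//.
      by rewrite ler_wpM2r// lerDl.
    by rewrite mulrC -ler_pdivlMr// h1.
  rewrite (@le_trans _ _ ((Mv + 1) * `|inc u N k|))//.
    by rewrite ler_wpM2r// lerDl.
  by rewrite mulrC -ler_pdivlMr// h2.
- have [Cu HCu] := bu; have [Cv HCv] := bv.
  exists (Mu * Cv + Mv * Cu) => N.
  rewrite (@le_trans _ _ (\sum_(k < N.+1)
      (Mu * `|inc v N k| + Mv * `|inc u N k|)))//.
    by apply: ler_sum => k _; rewrite bnd// -ltnS.
  by rewrite big_split/= -!mulr_sumr; apply: lerD; apply: ler_wpM2l => //; [exact: HCv|exact: HCu].
- have [Cv HCv] := bv.
  have Cv0 : 0 <= Cv by rewrite (le_trans _ (HCv 0%N))// sumr_ge0.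
  have nuv : nul (fun N => \sum_(k < N.+1) `|inc u N k * inc v N k|).
    move=> e e0; have C1 : 0 < Cv + 1 by rewrite ltr_wpDl.
    have [M HM] := su _ (divr_gt0 e0 C1); exists M => N /HM h.
    rewrite ger0_norm ?sumr_ge0//.
    rewrite (@le_trans _ _ (\sum_(k < N.+1) (e / (Cv + 1)) * `|inc v N k|))//.
      apply: ler_sum => k _; rewrite normrM ler_wpM2r//.
      by rewrite h// -ltnS.
    rewrite -mulr_sumr (@le_trans _ _ (e / (Cv + 1) * (Cv + 1)))//.
      by rewrite ler_wpM2l ?divr_ge0 ?(ltW e0) ?(ltW C1)// (le_trans (HCv N))// lerDl.
    by rewrite divfK// gt_eqF.
  apply: nul_le (nulD (nulD (nulZ Mu lv) (nulZ Mv lu)) nuv) => N.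
  rewrite !ger0_norm ?addr_ge0 ?mulr_ge0 ?sumr_ge0//.
  rewrite !mulr_sumr -!big_split/=; apply: ler_sum => k _.
  have kN : (k <= N)%N by rewrite -ltnS.
  have -> : inc (fun x => u x * v x) N k
      - (u (pt N k) * L' N k + v (pt N k) * L N k) =
     u (pt N k) * (inc v N k - L' N k) + v (pt N k) * (inc u N k - L N k)
     + inc u N k * inc v N k by rewrite /inc; ring.
  rewrite (le_trans (ler_normD _ _))// lerD2r (le_trans (ler_normD _ _))//.
  by rewrite !normrM lerD// ler_wpM2r// ?Hu ?Hv// ltnW.
Qed.

Lemma path_sum (I : Type) (r : seq I) (u : I -> R -> R)
    (L : I -> nat -> nat -> R) : (forall i, path (u i) (L i)) ->
  path (fun x => \sum_(i <- r) u i x) (fun N k => \sum_(i <- r) L i N k).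
Proof.
move=> lu; elim: r => [|i r IH].
  rewrite (_ : (fun x => _) = fun=> 0); last by apply/funext => x; rewrite big_nil.
  by apply: path_ext (path_cst 0) => N k _; rewrite big_nil.
rewrite (_ : (fun x => _) = fun x => u i x + \sum_(j <- r) u j x); last first.
  by apply/funext => x; rewrite big_cons.
by apply: path_ext (pathD (lu i) IH) => N k _; rewrite big_cons.
Qed.

(** Leibniz rule with the remaining factors taken at the left node. Since [r] has no repetition, the
    condition [j != i] removes exactly one factor. *)
Lemma path_prod (I : eqType) (r : seq I) (u : I -> R -> R)
    (L : I -> nat -> nat -> R) : uniq r ->
  (forall i, i \in r -> path (u i) (L i)) ->
  path (fun x => \prod_(i <- r) u i x)
       (fun N k => \sum_(i <- r) L i N k * \prod_(j <- r | j != i) u j (pt N k)).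
Proof.
elim: r => [_ _|i r IH /= /andP[ir ur] lu].
  rewrite (_ : (fun x => _) = fun=> 1); last by apply/funext => x; rewrite big_nil.
  by apply: path_ext (path_cst 1) => N k _; rewrite big_nil.
rewrite (_ : (fun x => _) = fun x => u i x * \prod_(j <- r) u j x); last first.
  by apply/funext => x; rewrite big_cons.
have pr := IH ur (fun j jr => lu j (mem_behead (s := i :: r) jr)).
apply: path_ext (pathM (lu i (mem_head i r)) pr) => N k _.
rewrite big_cons big_cons eqxx /= addrC mulr_sumr; congr (_ + _).
  rewrite mulrC; congr (_ * _); rewrite [LHS]big_seq [RHS]big_seq_cond.
  by apply: eq_bigl => j; case: (boolP (j \in r)) => //= jr;
    apply/esym; apply: contraNneq ir => <-.
rewrite [LHS]big_seq [RHS]big_seq; apply: eq_bigr => j jr.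
have ij : i != j by apply: contraNneq ir => ->.
by rewrite big_cons ij mulrCA.
Qed.

(* [x - ln (1 + x)] lies between [0] and [x ^+ 2 / (1 + x)]. *)
Lemma lin_ln (c : R) u L : 0 < c ->
  (forall N k, (k <= N.+1)%N -> c <= u (pt N k)) -> path u L ->
  lin (fun x => ln (u x)) (fun N k => L N k / u (pt N k)).
Proof.
move=> c0 cu [su bu lu].
(* The quadratic variation along the partitions vanishes, again as uniform smallness times bounded
   variation. *)
have nuu : nul (fun N => \sum_(k < N.+1) `|inc u N k * inc u N k|).
  have [C HC] := bu; have C0 : 0 <= C by rewrite (le_trans _ (HC 0%N))// sumr_ge0.
  move=> e e0; have C1 : 0 < C + 1 by rewrite ltr_wpDl.
  have [M HM] := su _ (divr_gt0 e0 C1); exists M => N /HM h.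
  rewrite ger0_norm ?sumr_ge0//.
  rewrite (@le_trans _ _ (\sum_(k < N.+1) (e / (C + 1)) * `|inc u N k|))//.
    by apply: ler_sum => k _; rewrite normrM ler_wpM2r// h// -ltnS.
  rewrite -mulr_sumr (@le_trans _ _ (e / (C + 1) * (C + 1)))//.
    by rewrite ler_wpM2l ?divr_ge0 ?(ltW e0) ?(ltW C1)// (le_trans (HC N))// lerDl.
  by rewrite divfK// gt_eqF.
apply: nul_le (nulD (nulZ c^-1 lu) (nulZ (c^-1 ^+ 2) nuu)) => N.
have ci0 : 0 <= c^-1 by rewrite invr_ge0 ltW.
rewrite !ger0_norm ?addr_ge0 ?mulr_ge0 ?sumr_ge0//.
rewrite !mulr_sumr -!big_split/=; apply: ler_sum => k _.
have kN : (k <= N)%N by rewrite -ltnS.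
have a1 := cu N k (leqW kN); have b1 := cu N k.+1 kN.
rewrite /inc /= in a1 b1 *.
set a := u (pt N k) in a1 *; set b := u (pt N k.+1) in b1 *.
have a0 : 0 < a := lt_le_trans c0 a1; have b0 : 0 < b := lt_le_trans c0 b1.
have -> : ln b - ln a - L N k / a
    = (ln b - ln a - (b - a) / a) + (b - a - L N k) / a by field; rewrite gt_eqF.
rewrite addrC (le_trans (ler_normD _ _))// lerD//; last first.
  rewrite normrM mulrC ler_wpM2r// gtr0_norm ?invr_gt0//.
  by rewrite lef_pV2 ?posrE.
have up : ln b - ln a <= (b - a) / a.
  rewrite -ln_div ?posrE// (_ : (b - a) / a = b / a - 1); last by field; rewrite gt_eqF.
  have := @le_ln1Dx R (b / a - 1).
  by rewrite [1 + _]addrC subrK; apply; rewrite ltrBrDr addNr divr_gt0.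
have dn : (b - a) / b <= ln b - ln a.
  rewrite -[leRHS]opprB lerNr -ln_div ?posrE//.
  rewrite (_ : - ((b - a) / b) = a / b - 1); last by field; rewrite gt_eqF.
  have := @le_ln1Dx R (a / b - 1).
  by rewrite [1 + _]addrC subrK; apply; rewrite ltrBrDr addNr divr_gt0.
rewrite ler0_norm ?subr_le0// opprB.
rewrite (@le_trans _ _ ((b - a) / a - (b - a) / b))// ?lerD2l ?lerN2//.
rewrite (_ : _ - _ = (b - a) ^+ 2 * (a^-1 * b^-1)); last first.
  by field; rewrite !gt_eqF.
rewrite -expr2 ger0_norm ?sqr_ge0// mulrC ler_wpM2r ?sqr_ge0// expr2.
by rewrite ler_pM ?invr_ge0 ?lef_pV2 ?posrE// ltW.
Qed.

End Path.

(** Heine's theorem from the near-covering form of compactness: around each point one neighbourhood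
    and one threshold work together, and compactness makes the threshold common to the whole
    segment. *)
Lemma within_unif_continuous (R : realType) (a b : R) (f : R -> R) :
  {within `[a, b], continuous f} -> forall e : R, 0 < e ->
  exists2 d : R, 0 < d & forall x y, a <= x <= b -> a <= y <= b ->
    `|x - y| <= d -> `|f x - f y| <= e.
Proof.
move=> /subspace_continuousP cf e e0.
have [Kc _] := @compact_near_coveringP R `[a, b].
have := Kc (@segment_compact _ a b) R (0^'+)
  (fun d x => forall y, a <= y <= b -> `|x - y| <= d -> a <= x <= b ->
      `|f x - f y| <= e) _.
have cov x : `[a, b]%classic x -> \forall x' \near x & d \near 0^'+,
   (fun d x => forall y, a <= y <= b -> `|x - y| <= d -> a <= x <= b ->
      `|f x - f y| <= e) d x'.
  move=> abx; have := cf _ abx => /cvgrPdist_lt /(_ (e / 2)).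
  rewrite divr_gt0// => /(_ isT); rewrite /within/= => -[r /= r0 Hr].
  (* The radius is halved so that both [x'] and [y] stay within [r] of the centre [x]. *)
  exists (ball x (r / 2), [set d : R | d < r / 2]) => /=.
    split; first by apply: nbhsx_ballx; rewrite divr_gt0.
    by apply: nbhs_right_lt; rewrite divr_gt0.
  move=> [x' d] /= [xx' dr] y aby x'y abx'.
  have h1 : `|f x - f x'| < e / 2.
    apply: Hr; rewrite /ball /=; last by rewrite in_itv.
    by move: xx'; rewrite /ball /=; lra.
  have h2 : `|f x - f y| < e / 2.
    apply: Hr; rewrite /ball /=; last by rewrite in_itv.
    move: xx'; rewrite /ball /= => xx'.
    rewrite (_ : x - y = (x - x') + (x' - y)); last by ring.
    by rewrite (le_lt_trans (ler_normD _ _))//; lra.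
  rewrite (_ : f x' - f y = (f x - f y) - (f x - f x')); last by ring.
  by rewrite (le_trans (ler_normB _ _))//; lra.
move=> /(_ _ cov) => H.
have [d [Hd d0]] := @filter_ex _ _ (at_right_proper_filter (0 : R)) _
  (filterI H (nbhs_right_gt (0 : R))).
by exists d => // x y abx aby xy; apply: Hd.
Qed.

Lemma continuous_bounded_itv (R : realType) (a b : R) (f : R -> R) : a <= b ->
  {within `[a, b], continuous f} -> exists2 K : R, 0 <= K &
  forall x, a <= x <= b -> `|f x| <= K.
Proof.
move=> ab cf.
have cnf : {within `[a, b], continuous (fun x => `|f x|)}.
  by move=> x; apply: cvg_norm; exact: cf.
have [c _ Hc] := EVT_max ab cnf; exists `|f c| => //.
Qed.

(** * Sources of paths: continuous functions, functions of bounded variation, C1 functions *)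

Section PathFunctions.
Variables (R : realType) (t0 t1 : R).
Hypothesis t01 : t0 < t1.
Notation pt := (pt t0 t1).
Notation mesh := (mesh t0 t1).
Notation inc := (inc t0 t1).

Lemma mesh_small (e : R) : 0 < e -> exists M, forall N, (M <= N)%N -> mesh N <= e.
Proof.
move=> e0; have d0 : 0 <= (t1 - t0) / e by rewrite divr_ge0 ?ltW ?subr_gt0.
exists (Num.Def.archi_bound ((t1 - t0) / e)) => N MN; rewrite /mesh.
rewrite ler_pdivrMr// mulrC -ler_pdivrMr//.
by rewrite (le_trans (ltW (archi_boundP d0)))// ler_nat (leq_trans MN).
Qed.

Lemma small_continuous (u : R -> R) : {within `[t0, t1], continuous u} ->
  small t0 t1 u.
Proof.
move=> cu e e0; have [d d0 Hd] := within_unif_continuous cu e0.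
have [M HM] := mesh_small d0; exists M => N MN k kN; apply: Hd.
- exact: pt_mem.
- by apply: pt_mem => //; rewrite leqW.
- by rewrite ptS ger0_norm ?HM// mesh_ge0.
Qed.

Lemma pt_lt N : {homo pt N : k k' / (k < k')%N >-> k < k'}.
Proof.
move=> k k' kk'; rewrite /pt ltrD2l ltr_pM2l ?subr_gt0//.
by rewrite ltr_pM2r ?invr_gt0// ltr_nat.
Qed.

Lemma sum_inc_total_variation (u : R -> R) (C : R) :
  (total_variation t0 t1 u <= C%:E)%E ->
  forall N, \sum_(k < N.+1) `|inc u N k| <= C.
Proof.
move=> tvC N; rewrite -lee_fin; apply: le_trans tvC.
(* [itv_partition] lists the nodes after the left endpoint, so the list starts at index 1 and ends
   with [t1]. *)
pose s := [seq pt N k.+1 | k <- iota 0 N.+1].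
have sz : size s = N.+1 by rewrite size_map size_iota.
have ns k : (k <= N.+1)%N -> nth t1 (t0 :: s) k = pt N k.
  case: k => [|k] kN; first by rewrite pt0.
  by rewrite /= (nth_map 0%N) ?size_iota// nth_iota.
clearbody s; have tp : itv_partition t0 t1 s.
  split; last by rewrite (last_nth t1) sz ns// pt_last.
  rewrite (_ : path.path _ _ _ = sorted <%R (t0 :: s))//.
  apply/(sortedP t1) => i; rewrite /= sz ltnS => iN.
  by rewrite -[nth t1 s i]/(nth t1 (t0 :: s) i.+1) !ns ?pt_lt// leqW.
apply: ereal_sup_ubound; exists (variation t0 t1 u s); last first.
  rewrite /variation sz big_mkord; congr EFin; apply: eq_bigr => k _.
  have kN : (k <= N)%N by rewrite -ltnS.
  by rewrite /inc -(ns k.+1)// -(ns k)// leqW.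
exact: variations_variation.
Qed.

(** This is how a message enters the expansion: without a derivative at hand it is its own linear
    part, with zero error. *)
Lemma path_itself (u : R -> R) : small t0 t1 u -> bvar t0 t1 u ->
  path t0 t1 u (inc u).
Proof.
move=> su bu; split => //; apply: nul_le (@nul0 R) => N.
by rewrite big1 ?normr0// => k _; rewrite subrr normr0.
Qed.

(** By the mean value theorem an increment is [du c * mesh N] for some [c] in the cell. Uniform
    continuity of [du] moves [c] to the left node at a cost of [e / (t1 - t0)] per unit of length,
    hence [e] in total. *)
Lemma path_C1 (u du : R -> R) :
  (forall x, t0 <= x <= t1 -> is_derive x 1 u (du x)) ->
  {within `[t0, t1], continuous du} ->
  path t0 t1 u (fun N k => du (pt N k) * mesh N).
Proof.
move=> udu cdu.
have [K K0 HK] := continuous_bounded_itv (ltW t01) cdu.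
have mv N k : (k <= N)%N -> exists2 c, pt N k <= c <= pt N k.+1 &
    inc u N k = du c * mesh N.
  move=> kN; rewrite /inc -(ptS t0 t1 N k).
  have sub x : x \in `[pt N k, pt N k.+1] -> t0 <= x <= t1.
    rewrite in_itv/= => /andP[h1 h2].
    have /andP[g1 _] := pt_mem t01 (leqW kN).
    have /andP[_ g2] := pt_mem t01 (kN : (k.+1 <= N.+1)%N).
    by rewrite (le_trans g1)// (le_trans h2).
  have [|||c] := @MVT_segment R u du (pt N k) (pt N k.+1) _ _ _.
  - by rewrite ltW// pt_lt.
  - by move=> x xk; apply: udu; apply: sub; apply: subset_itv_oo_cc xk.
  - apply: derivable_within_continuous => x xk.
    by have [] := udu x (sub _ xk).
  - by rewrite in_itv/= => ck ->; exists c.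
have inK N k : (k <= N)%N -> `|inc u N k| <= K * mesh N.
  move=> kN; have [c /andP[c1 c2] ->] := mv N k kN.
  have /andP[g1 _] := pt_mem t01 (leqW kN).
  have /andP[_ g2] := pt_mem t01 (kN : (k.+1 <= N.+1)%N).
  rewrite normrM [X in _ * X]ger0_norm ?mesh_ge0// ler_wpM2r ?mesh_ge0//.
  by rewrite HK// (le_trans g1)// (le_trans c2).
split.
- move=> e e0; have K1 : 0 < K + 1 by rewrite ltr_wpDl.
  have [M HM] := mesh_small (divr_gt0 e0 K1); exists M => N /HM h k /inK kN.
  rewrite (le_trans kN)// (@le_trans _ _ ((K + 1) * mesh N))//.
    by rewrite ler_wpM2r ?mesh_ge0// lerDl.
  by rewrite mulrC -ler_pdivlMr.
- exists (K * (t1 - t0)) => N; rewrite -(sum_mesh t0 t1 N) mulr_sumr.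
  by apply: ler_sum => k _; apply: inK; rewrite -ltnS.
- move=> e e0; have d0 : 0 < t1 - t0 by rewrite subr_gt0.
  have [d dgt0 Hd] := within_unif_continuous cdu (divr_gt0 e0 d0).
  have [M HM] := mesh_small dgt0; exists M => N /HM h.
  rewrite ger0_norm ?sumr_ge0//.
  rewrite (@le_trans _ _ (\sum_(k < N.+1) (e / (t1 - t0)) * mesh N))//.
    apply: ler_sum => k _; have kN : (k <= N)%N by rewrite -ltnS.
    have [c /andP[c1 c2] ->] := mv N k kN.
    rewrite -mulrBl normrM [X in _ * X]ger0_norm ?mesh_ge0//.
    rewrite ler_wpM2r ?mesh_ge0//.
    have /andP[g1 g3] := pt_mem t01 (leqW kN).
    have /andP[_ g2] := pt_mem t01 (kN : (k.+1 <= N.+1)%N).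
    apply: Hd; rewrite ?g1 ?g3 ?(le_trans g1) ?(le_trans c2)//.
    by rewrite ger0_norm ?subr_ge0// (le_trans _ h)// -(ptS t0 t1 N k) lerB.
  by rewrite -mulr_sumr sum_mesh divfK// gt_eqF.
Qed.

End PathFunctions.

(** * Upper limits of increments and of derivatives *)

Lemma le_limn_esup_near (R : realType) (u v : nat -> \bar R) n0 :
  (forall n, (n0 <= n)%N -> (u n <= v n)%E) -> (limn_esup u <= limn_esup v)%E.
Proof.
move=> uv; rewrite /limn_esup /limf_esup.
apply: le_ereal_inf_tmp => _ [V [m _ Vm] <-].
apply: (@le_trans _ _ (ereal_sup [set u x | x in [set n | (maxn m n0 <= n)%N]])).
  apply: ereal_inf_lbound; exists [set n | (maxn m n0 <= n)%N] => //.
  by exists (maxn m n0).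
apply: ge_ereal_sup => /= _ [n /= nM <-]; move: nM; rewrite geq_max => /andP[mn n0n].
apply: (le_trans (uv _ n0n)); apply: ereal_sup_ubound.
by exists n => //; exact: Vm.
Qed.

Section LimsupDerivative.
Variables (R : realType) (a b : R).
Hypothesis ab : a < b.
Local Notation leb := (@lebesgue_measure R).

Lemma integral_derive (f df : R -> R) :
  (forall x, a <= x <= b -> is_derive x 1 f (df x)) ->
  {within `[a, b], continuous df} ->
  (\int[leb]_(x in `[a, b]) (df x)%:E = (f b - f a)%:E)%E.
Proof.
move=> fdf cdf; rewrite (continuous_FTC2 ab cdf (F := f)) ?EFinB//.
  have drv x : a <= x <= b -> derivable f x 1 by move=> /fdf[].
  have cf x : a <= x <= b -> f y @[y --> x] --> f x.
    by move=> /drv/derivable1_diffP/differentiable_continuous; apply.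
  split.
  - by move=> x; rewrite in_itv/= => /andP[ax xb]; apply: drv; rewrite !ltW.
  - by apply: cvg_at_right_filter; apply: cf; rewrite lexx ltW.
  - by apply: cvg_at_left_filter; apply: cf; rewrite lexx ltW.
move=> x; rewrite in_itv/= => /andP[ax xb].
by rewrite derive1E; apply: (@derive_val _ _ _ _ _ _ _ (fdf x _)); rewrite !ltW.
Qed.

(** Fatou's lemma for the nonnegative functions [C - df n], whose integrals are [C * (b - a)] minus
    the increments; cancelling the constant turns lower limits back into upper limits. *)
Lemma limn_esup_increment_bounded (f df : nat -> R -> R) (alpha : R -> R) (C : R) :
  (forall n x, a <= x <= b -> is_derive x 1 (f n) (df n x)) ->
  (forall n, {within `[a, b], continuous (df n)}) ->
  (forall n x, a <= x <= b -> `|df n x| <= C) ->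
  {within `[a, b], continuous alpha} ->
  (forall x, a <= x <= b -> `|alpha x| <= C) ->
  (forall x, a <= x <= b -> (limn_esup (fun n => (df n x)%:E) <= (alpha x)%:E)%E) ->
  (limn_esup (fun n => (f n b - f n a)%:E)
     <= \int[leb]_(x in `[a, b]) (alpha x)%:E)%E.
Proof.
move=> fdf cdf dfC calpha alphaC dfalpha.
have mI : measurable (`[a, b]%classic : set R) by exact: measurable_itv.
have mcont (u : R -> R) : {within `[a, b], continuous u} ->
    measurable_fun (`[a, b]%classic : set R) u.
  by move=> cu; exact: subspace_continuous_measurable_fun.
have icont (u : R -> R) : {within `[a, b], continuous u} ->
    leb.-integrable (`[a, b]%classic : set R) (EFin \o u).
  by move=> cu; apply: continuous_compact_integrable => //; exact: segment_compact.
have C0 : 0 <= C by rewrite (le_trans _ (dfC 0%N a _))// lexx ltW.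
have ccst : {within `[a, b], continuous (fun=> C : R)}.
  by apply: continuous_subspaceT => x; exact: cvg_cst.
pose g n (x : R) := ((C - df n x)%:E : \bar R).
have g0 n x : `[a, b]%classic x -> (0 <= g n x)%E.
  move=> /=; rewrite in_itv/= => /dfC-/(_ n).
  by rewrite ler_norml /g lee_fin subr_ge0 => /andP[].
have mg n : measurable_fun (`[a, b]%classic : set R) (g n).
  apply/measurable_EFinP; apply: measurable_funB => //; exact: mcont.
have Ig n : (\int[leb]_(x in `[a, b]) g n x
    = (C * (b - a))%:E - (f n b - f n a)%:E)%E.
  under eq_integral do rewrite /g EFinB.
  rewrite (@integralB_EFin _ _ _ leb `[a, b]%classic (fun=> C) (df n)) ?icont//.
  rewrite integral_derive//; congr (_ - _)%E.
  by rewrite integral_cst//= lebesgue_measure_itv/= lte_fin ab.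
have := @fatou _ _ _ leb `[a, b]%classic mI g mg g0.
have linf x : a <= x <= b -> ((C - alpha x)%:E <= limn_einf (g^~ x))%E.
  move=> /dfalpha h; rewrite /g.
  under eq_fun do rewrite EFinB.
  rewrite limn_einf_shift// EFinB leeD2l//.
  by rewrite -[X in (_ <= limn_einf X)%E]/(-%E \o (fun n => (df n x)%:E)) limn_einfN leeN2.
have calphaC : {within `[a, b], continuous (fun x => C - alpha x)}.
  by move=> x; apply: cvgB; [exact: ccst|exact: calpha].
have le1 : (\int[leb]_(x in `[a, b]) (C - alpha x)%:E
     <= \int[leb]_(x in `[a, b]) limn_einf (g^~ x))%E.
  apply: ge0_le_integral => //.
  - move=> x /=; rewrite in_itv/= => /alphaC.
    by rewrite ler_norml lee_fin subr_ge0 => /andP[].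
  - by apply/measurable_EFinP; exact: mcont.
  - rewrite /limn_einf; apply: measurableT_comp; first exact: oppe_measurable.
    apply: (@measurable_fun_limn_esup _ _ _ _ (fun n x => (- g n x)%E)) => n.
    by apply: measurableT_comp; [exact: oppe_measurable|exact: mg].
move=> le2; have := le_trans le1 le2.
under [X in (_ <= limn_einf X)%E -> _]eq_fun do rewrite Ig.
under eq_integral do rewrite EFinB.
rewrite (@integralB_EFin _ _ _ leb `[a, b]%classic (fun=> C) alpha) ?icont//.
rewrite integral_cst//= lebesgue_measure_itv/= lte_fin ab -EFinB -EFinM.
rewrite limn_einf_shift// leeD2lE//.
rewrite -[X in (_ <= limn_einf X)%E]/(-%E \o (fun n => (f n b - f n a)%:E)).
by rewrite limn_einfN leeN2.
Qed.

(** Uniform sparsity controls the derivatives only from some index [n0] on. The earlier functions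
    are replaced by zero, which leaves the upper limits as they are. *)
Lemma limn_esup_increment (f df : nat -> R -> R) (alpha : R -> R) (C : R) n0 :
  (forall n x, a <= x <= b -> is_derive x 1 (f n) (df n x)) ->
  (forall n, {within `[a, b], continuous (df n)}) ->
  (forall n x, (n0 <= n)%N -> a <= x <= b -> `|df n x| <= C) ->
  {within `[a, b], continuous alpha} ->
  (forall x, a <= x <= b -> (limn_esup (fun n => (df n x)%:E) <= (alpha x)%:E)%E) ->
  (limn_esup (fun n => (f n b - f n a)%:E)
     <= \int[leb]_(x in `[a, b]) (alpha x)%:E)%E.
Proof.
move=> fdf cdf dfC calpha dfalpha.
have [K K0 HK] := continuous_bounded_itv (ltW ab) calpha.
have C0 : 0 <= C by rewrite (le_trans _ (dfC n0 a _ _))// lexx ltW.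
pose F n := if (n0 <= n)%N then f n else (fun=> 0 : R).
pose dF n := if (n0 <= n)%N then df n else (fun=> 0 : R).
apply: (@le_trans _ _ (limn_esup (fun n => (F n b - F n a)%:E))).
  by apply: (@le_limn_esup_near _ _ _ n0) => n nn0; rewrite /F nn0.
(* A single constant has to dominate both the derivatives ([C]) and the limit [alpha] ([K]). *)
apply: (@limn_esup_increment_bounded F dF alpha (C + K)) => //.
- move=> n x abx; rewrite /F /dF; case: ifP => _; first exact: fdf.
  exact: is_derive_cst.
- move=> n; rewrite /dF; case: ifP => _ //.
  by apply: continuous_subspaceT => x; exact: cvg_cst.
- move=> n x abx; rewrite /dF; case: ifP => nn0.
    by rewrite (le_trans (dfC _ _ nn0 abx))// lerDl.
  by rewrite normr0 addr_ge0.
- by move=> x abx; rewrite (le_trans (HK _ abx))// lerDr.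
- move=> x abx; apply: le_trans (dfalpha x abx).
  by apply: (@le_limn_esup_near _ _ _ n0) => n nn0; rewrite /dF nn0.
Qed.

(** Precomposition with the projection onto the segment, which is 1-Lipschitz, extends [u] to the
    line. *)
Lemma within_continuous_extension (u : R -> R) : {within `[a, b], continuous u} ->
  exists2 v : R -> R, continuous v & forall x, a <= x <= b -> v x = u x.
Proof.
move=> cu; pose c x : R := if x < a then a else if b < x then b else x.
have cab x : a <= c x <= b.
  rewrite /c; case: ifPn => [_|]; first by rewrite lexx ltW.
  rewrite -leNgt => ax; case: ifPn => [_|]; first by rewrite lexx ltW.
  by rewrite -leNgt ax.
have clip x y : `|c x - c y| <= `|x - y|.
  have h1 := ler_norm (x - y); have h2 := ler_norm (y - x).
  rewrite distrC in h2; rewrite ler_norml /c; move: ab h1 h2.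
  move: (`|x - y|) => r ? ? ?.
  by do !(case: ifPn; rewrite -?leNgt => ?); apply/andP; split; lra.
exists (u \o c) => [x|x /andP[ax xb]]; last by rewrite /= /c !ltNge ax xb.
apply/cvgrPdist_le => e e0; have [d d0 Hd] := within_unif_continuous cu e0.
near=> y; apply: Hd => //; apply: le_trans (clip x y) _.
near: y; exact: cvgr_dist_le.
Unshelve. all: by end_near. Qed.

(** For a primitive [F], the expansion of [path_C1] says exactly that the Riemann sums of its
    derivative approach the telescoped sum [F b - F a]. *)
Lemma riemann_sum (u : R -> R) : {within `[a, b], continuous u} ->
  (fun N => \sum_(k < N.+1) u (pt a b N k) * mesh a b N) @ \oo -->
    fine (\int[leb]_(x in `[a, b]) (u x)%:E).
Proof.
move=> /within_continuous_extension[v cv vu].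
(* Starting the primitive at [a - 1] makes [a] itself an interior point, so that the two-sided
   derivative exists on all of the segment; this is what the continuous extension [v] is for. *)
pose F (x : R) := (\int[leb]_(t in `[(a - 1)%R, x]) v t)%R.
have Fv x : a <= x <= b -> is_derive x 1 F (v x).
  move=> /andP[ax xb].
  have [||||] := @continuous_FTC1_closed R v (a - 1) x (b + 1) _ _ _ _.
  - by rewrite (le_lt_trans xb)// ltrDl.
  - apply: continuous_compact_integrable; first exact: segment_compact.
    exact: continuous_subspaceT.
  - by rewrite (lt_le_trans _ ax)// gtrBl.
  - exact: cv.
  - by move=> dF Fx; apply: DeriveDef; [exact: dF|rewrite -derive1E; exact: Fx].
have cvw : {within `[a, b], continuous v} by exact: continuous_subspaceT.
have -> : (\int[leb]_(x in `[a, b]) (u x)%:E = (F b - F a)%:E)%E.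
  rewrite -(integral_derive Fv cvw); apply: eq_integral => x /set_mem/=.
  by rewrite in_itv/= => /vu ->.
have [_ _ lF] := path_C1 ab Fv cvw.
rewrite /=; apply/cvgrPdist_le => e e0; have [M HM] := lF e e0.
exists M => // N /= /HM; rewrite ger0_norm ?sumr_ge0//; apply: le_trans.
rewrite -(sum_inc a b F N) -sumrB (le_trans (ler_norm_sum _ _ _))//.
apply: ler_sum => k _; rewrite vu//; apply: pt_mem => //.
by rewrite ltnW// ltnS ltnW.
Qed.

End LimsupDerivative.

(** * Free energy of the finite models *)

(** When the total weight vanishes the quotient is [0] by the convention on inverses; otherwise it
    is a genuine weighted mean. *)
Lemma norm_weighted_avg_le (R : realType) (I : finType) (w f : I -> R) (K : R) :
  0 <= K -> (forall i, 0 <= w i) -> (forall i, `|f i| <= K) ->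
  `|(\sum_i f i * w i) / \sum_i w i| <= K.
Proof.
move=> K0 w0 fK; have s0 : 0 <= \sum_i w i by exact: sumr_ge0.
have [s1|s1] := eqVneq (\sum_i w i) 0; first by rewrite s1 invr0 mulr0 normr0.
have sp : 0 < \sum_i w i by rewrite lt_neqAle eq_sym s1.
rewrite normrM normfV (ger0_norm s0) ler_pdivrMr//.
rewrite (le_trans (ler_norm_sum _ _ _))// mulr_sumr.
by apply: ler_sum => i _; rewrite normrM (ger0_norm (w0 i)) ler_wpM2r.
Qed.

(** Writing each derivative as [F i x * d i] lets the logarithmic derivatives add up without
    dividing, so identically zero factors, with [d i = 0], are covered too. *)
Lemma is_derive_prod_log (R : realType) (I : Type) (r : seq I) (p : pred I)
    (F : I -> R -> R) (d : I -> R) (x : R) :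
  (forall i, p i -> is_derive x 1 (F i) (F i x * d i)) ->
  is_derive x 1 (fun y => \prod_(i <- r | p i) F i y)
    ((\prod_(i <- r | p i) F i x) * \sum_(i <- r | p i) d i).
Proof.
move=> dF; elim: r => [|i r IH].
  rewrite !big_nil mulr0 (_ : (fun y => _) = cst 1); first exact: is_derive_cst.
  by apply/funext => y; rewrite big_nil.
rewrite !big_cons; case: ifPn => pi; last first.
  rewrite (_ : (fun y => _) = fun y => \prod_(i <- r | p i) F i y)//.
  by apply/funext => y; rewrite big_cons (negbTE pi).
rewrite (_ : (fun y => _) = (F i) \* (fun y => \prod_(j <- r | p j) F j y)); last first.
  by apply/funext => y; rewrite big_cons pi.
have D := is_deriveM (dF i pi) IH.
apply: (is_derive_eq D); rewrite /GRing.scale/=; ring.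
Qed.

Lemma is_derive_bigsum (R : realType) (I : Type) (r : seq I) (p : pred I)
    (F : I -> R -> R) (d : I -> R) (x : R) :
  (forall i, p i -> is_derive x 1 (F i) (d i)) ->
  is_derive x 1 (fun y => \sum_(i <- r | p i) F i y) (\sum_(i <- r | p i) d i).
Proof.
move=> dF; elim: r => [|i r IH].
  rewrite !big_nil (_ : (fun y => _) = cst 0); first exact: is_derive_cst.
  by apply/funext => y; rewrite big_nil.
rewrite !big_cons; case: ifPn => pi; last first.
  rewrite (_ : (fun y => _) = fun y => \sum_(i <- r | p i) F i y)//.
  by apply/funext => y; rewrite big_cons (negbTE pi).
rewrite (_ : (fun y => _) = (F i) \+ (fun y => \sum_(j <- r | p j) F j y)); last first.
  by apply/funext => y; rewrite big_cons pi.
exact: is_deriveD (dF i pi) IH.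
Qed.

Lemma continuous_bigsum (R : realType) (I : Type) (r : seq I) (p : pred I)
    (F : I -> R -> R) : (forall i, continuous (F i)) ->
  continuous (fun y => \sum_(i <- r | p i) F i y).
Proof.
move=> cF; elim: r => [|i r IH] x.
  rewrite (_ : (fun y => _) = cst 0); first exact: cvg_cst.
  by apply/funext => y; rewrite big_nil.
rewrite (_ : (fun y => _) = fun y => (if p i then F i y else 0) +
    \sum_(j <- r | p j) F j y); last first.
  by apply/funext => y; rewrite big_cons; case: ifP => //; rewrite add0r.
apply: cvgD; last exact: IH.
by case: ifP => _; [exact: cF|exact: cvg_cst].
Qed.

Section Specification.
Variables (R : realType) (X : finType).
Variables (psi : R -> X -> X -> R) (psib : R -> X -> R).
Hypothesis h1 : H1 psi psib.

Lemma psi_ge0 b s t : 0 <= psi b s t.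
Proof. by have [h _ _ _ _] := h1; have [] := h b s t. Qed.

Lemma psi_sym b s t : psi b s t = psi b t s.
Proof. by have [h _ _ _ _] := h1; have [] := h b s t. Qed.

Lemma psib_gt0 B s : 0 < psib B s.
Proof. by have [_ h _ _ _] := h1. Qed.

Lemma dxi_sym b s t : dxi psi b s t = dxi psi b t s.
Proof.
rewrite /dxi (_ : (fun b' => ln (psi b' s t)) = fun b' => ln (psi b' t s)); last first.
  by apply/funext => b'; rewrite psi_sym.
case: pselect => hs; case: pselect => // ht; exfalso.
  by apply: ht => b'; rewrite psi_sym.
by apply: hs => b'; rewrite psi_sym.
Qed.

Lemma psi_dichotomy s t : (forall b, psi b s t = 0) \/ (forall b, 0 < psi b s t).
Proof. by have [_ _ _ _ /(_ s t)[|[]]] := h1; [left|right]. Qed.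

Lemma dxi_continuous s t : continuous (fun b => dxi psi b s t).
Proof.
have [_ _ _ _ /(_ s t)[z|[p [_ c]]]] := h1; rewrite /dxi; case: pselect => //.
- by move=> ? x; exact: cvg_cst.
- by move=> z; have := p 0; rewrite z ltxx.
Qed.

Lemma dxib_continuous s : continuous (fun B => dxib psib B s).
Proof. by have [_ _ _ /(_ s)[]] := h1. Qed.

(** (H1) speaks of [ln u]; the function itself is recovered as the exponential of its logarithm. *)
Lemma is_derive_of_ln (u : R -> R) (x : R) : (forall y, 0 < u y) ->
  derivable (fun y => ln (u y)) x 1 ->
  is_derive x 1 u (u x * derive1 (fun y => ln (u y)) x).
Proof.
move=> u0 du; have -> : u = expR \o (fun y => ln (u y)).
  by apply/funext => y /=; rewrite lnK// posrE.
rewrite /= (_ : (fun y => ln _) = (fun y => ln (u y))); last first.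
  by apply/funext => y /=; rewrite expRK.
have D : is_derive x 1 (fun y => ln (u y)) (derive1 (fun y => ln (u y)) x).
  by apply: DeriveDef => //; rewrite derive1E.
exact: is_derive1_comp.
Qed.

Lemma is_derive_psi s t (b : R) :
  is_derive b 1 (fun b : R => psi b s t) (psi b s t * dxi psi b s t).
Proof.
have [_ _ _ _ /(_ s t)[z|[p [d _]]]] := h1; rewrite /dxi; case: pselect => // z'.
- rewrite mulr0 (_ : (fun b => _) = cst 0); first exact: is_derive_cst.
  by apply/funext => y; rewrite z.
- by have := p 0; rewrite z' ltxx.
- exact: (@is_derive_of_ln (fun b => psi b s t)).
Qed.

Lemma is_derive_psib s (B : R) :
  is_derive B 1 (fun B : R => psib B s) (psib B s * dxib psib B s).
Proof.
have [_ p _ /(_ s)[d _] _] := h1.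
exact: (@is_derive_of_ln (fun B => psib B s)).
Qed.

Lemma psi_continuous s t : continuous (fun b => psi b s t).
Proof.
by move=> b; have [d _] := is_derive_psi s t b;
  exact/differentiable_continuous/derivable1_diffP.
Qed.

Lemma psib_continuous s : continuous (fun B => psib B s).
Proof.
by move=> B; have [d _] := is_derive_psib s B;
  exact/differentiable_continuous/derivable1_diffP.
Qed.

Section FiniteGraph.
Variables (n : nat) (E : fgr n).
Implicit Type s : {ffun 'I_n -> X}.

Lemma wt_ge0 b B s : 0 <= wt psi psib E b B s.
Proof.
rewrite /wt mulr_ge0// ?prodr_ge0// => i _; last exact/ltW/psib_gt0.
by rewrite prodr_ge0// => j _; exact: psi_ge0.
Qed.

(** The configuration constantly equal to the permissive spin has positive weight on every graph. *)
Lemma Zf_gt0 b B : 0 < Zf psi psib E b B.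
Proof.
have [_ _ [sp psp] _ _] := h1.
rewrite /Zf (bigD1 [ffun=> sp])//= ltr_pwDl//; last first.
  by rewrite sumr_ge0// => s _; exact: wt_ge0.
rewrite /wt mulr_gt0// ?prodr_gt0// => i _; last exact: psib_gt0.
by rewrite prodr_gt0// => j _; rewrite !ffunE.
Qed.

(** Logarithmic derivative of the weight along the diagonal where both parameters equal [th]. Each
    edge occurs once here, as in [wt]. *)
Definition energy_deriv (th : R) s : R :=
  \sum_(i : 'I_n) \sum_(j : 'I_n | (i < j)%N && adjf E i j) dxi psi th (s i) (s j)
  + \sum_(i : 'I_n) dxib psib th (s i).

Lemma is_derive_wt (th : R) s :
  is_derive th 1 (fun th => wt psi psib E th th s)
    (wt psi psib E th th s * energy_deriv th s).
Proof.
rewrite /wt.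
have D1 : is_derive th 1 (fun th => \prod_(i : 'I_n)
    \prod_(j : 'I_n | (i < j)%N && adjf E i j) psi th (s i) (s j)) _ :=
  is_derive_prod_log _ (fun i _ => is_derive_prod_log _ (fun j _ => is_derive_psi (s i) (s j) th)).
have D2 : is_derive th 1 (fun th => \prod_(i : 'I_n) psib th (s i)) _ :=
  is_derive_prod_log _ (fun i _ => is_derive_psib (s i) th).
apply: (is_derive_eq (is_deriveM D1 D2)).
by rewrite /energy_deriv /GRing.scale/=; ring.
Qed.

Lemma is_derive_lnZf (th : R) : is_derive th 1 (fun th => ln (Zf psi psib E th th))
  (gavg psi psib E th th (energy_deriv th)).
Proof.
have D : is_derive th 1 (fun th => Zf psi psib E th th) _ :=
  is_derive_bigsum _ (fun s _ => is_derive_wt th s).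
have Dl := is_derive1_ln (Zf_gt0 th th).
have := @is_derive1_comp _ (@ln R) (fun th => Zf psi psib E th th) th _ _ Dl D.
move=> /is_derive_eq; apply; rewrite /gavg mulrC; congr (_ * _).
by apply: eq_bigr => s _; rewrite mulrC.
Qed.

Lemma gavg_sum (I : Type) (r : seq I) (p : pred I) b B
    (f : I -> {ffun 'I_n -> X} -> R) :
  gavg psi psib E b B (fun s => \sum_(i <- r | p i) f i s)
    = \sum_(i <- r | p i) gavg psi psib E b B (f i).
Proof.
rewrite /gavg -mulr_suml exchange_big/=; congr (_ / _).
by apply: eq_bigr => s _; rewrite mulr_suml.
Qed.

Lemma gavgD b B (f g : {ffun 'I_n -> X} -> R) :
  gavg psi psib E b B (fun s => f s + g s)
    = gavg psi psib E b B f + gavg psi psib E b B g.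
Proof.
rewrite /gavg -mulrDl -big_split/=; congr (_ / _).
by apply: eq_bigr => s _; rewrite mulrDl.
Qed.

Lemma gavg_le b B (f : {ffun 'I_n -> X} -> R) (K : R) : 0 <= K ->
  (forall s, `|f s| <= K) -> `|gavg psi psib E b B f| <= K.
Proof. by move=> K0 fK; apply: norm_weighted_avg_le => // s; exact: wt_ge0. Qed.

Lemma adjf_sym i j : adjf E i j = adjf E j i.
Proof. by rewrite /adjf eq_sym orbC. Qed.

(** Summing over vertices and their neighbours visits every edge in both orientations; this is the
    origin of the factor [2^-1] in [aen]. *)
Lemma sum_adj_sym (g : 'I_n -> 'I_n -> R) : (forall i j, g i j = g j i) ->
  \sum_i \sum_(j | adjf E i j) g i j
    = 2 * \sum_(i : 'I_n) \sum_(j : 'I_n | (i < j)%N && adjf E i j) g i j.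
Proof.
move=> gs; rewrite mulr2n mulrDl mul1r.
transitivity (\sum_(i : 'I_n) (\sum_(j : 'I_n | (i < j)%N && adjf E i j) g i j
    + \sum_(j : 'I_n | (j < i)%N && adjf E i j) g i j)).
  apply: eq_bigr => i _; rewrite (bigID (fun j : 'I_n => (i < j)%N))/=.
  congr (_ + _); apply: eq_bigl => j; first by rewrite andbC.
  rewrite andbC; case: (boolP (adjf E i j)) => [/andP[ij _]|]; rewrite ?andbF// !andbT.
  by rewrite -leqNgt ltn_neqAle (_ : (j : nat) != i) // eq_sym.
rewrite big_split/=; congr (_ + _).
rewrite (exchange_big_dep xpredT)//=; apply: eq_bigr => i _.
rewrite [LHS]big_mkcond [RHS]big_mkcond; apply: eq_bigr => j _.
by rewrite adjf_sym gs.
Qed.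

End FiniteGraph.

Section RandomGraph.
Variables (P : forall n, fgr n -> R) (n : nat).

Definition phin_deriv (th : R) := aen psi psib P n th th + avxn psi psib P n th th.

Lemma is_derive_phin (th : R) :
  is_derive th 1 (fun th => phin psi psib P n th th) (phin_deriv th).
Proof.
have D : is_derive th 1 (fun th => \sum_(E : fgr n) (n%:R^-1 * @P n E) *: ln (Zf psi psib E th th)) _
  := is_derive_bigsum _ (fun E _ => is_deriveZ (n%:R^-1 * @P n E) (is_derive_lnZf E th)).
rewrite (_ : (fun th => _) = (fun th => \sum_(E : fgr n)
    (n%:R^-1 * @P n E) *: ln (Zf psi psib E th th))); last first.
  apply/funext => y; rewrite /phin mulr_sumr; apply: eq_bigr => E _.
  by rewrite /GRing.scale/= mulrA.
apply: (is_derive_eq D).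
rewrite /phin_deriv /aen /avxn /En mulr_sumr -big_split/=; apply: eq_bigr => E _.
rewrite /energy_deriv gavgD !gavg_sum (sum_adj_sym E); last first.
  by move=> i j; congr (gavg _ _ _ _ _ _); apply/funext => s; rewrite dxi_sym.
under [X in X + _]eq_bigr do rewrite gavg_sum.
rewrite /GRing.scale/=; set x := \sum_i \sum_(j | _) _; set y := \sum_i _.
by move: (n%:R^-1) => c; field.
Qed.

Lemma gavg_continuous (E : fgr n) (f : R -> {ffun 'I_n -> X} -> R) :
  (forall s, continuous (f^~ s)) ->
  continuous (fun th : R => gavg psi psib E th th (f th)).
Proof.
move=> cf th.
have cwt s : continuous (fun th => wt psi psib E th th s).
  by move=> y; have [d _] := is_derive_wt E y s;
  exact/differentiable_continuous/derivable1_diffP.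
apply: cvgM.
  by apply: continuous_bigsum => s y; apply: cvgM; [exact: cf|exact: cwt].
apply: cvgV; first by rewrite gt_eqF// Zf_gt0.
exact: continuous_bigsum.
Qed.

Lemma phin_deriv_continuous : continuous phin_deriv.
Proof.
have cEn (F : R -> fgr n -> 'I_n -> R) : (forall E i, continuous (fun th => F th E i)) ->
    continuous (fun th => @En R P n (F th)).
  move=> cF; apply: continuous_bigsum => E y; apply: cvgM; first exact: cvg_cst.
  apply: cvgM; first exact: cvg_cst.
  by apply: (@continuous_bigsum R _ _ _ (fun i th => F th E i)) => i; exact: cF.
move=> th; apply: cvgD.
  apply: cvgM; first exact: cvg_cst.
  apply: (cEn (fun th E i => \sum_(j : 'I_n | adjf E i j)
     gavg psi psib E th th (fun s => dxi psi th (s i) (s j)))) => E i.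
  apply: continuous_bigsum => j; apply: (gavg_continuous (f := fun th s => dxi psi th (s i) (s j))) => s.
  exact: dxi_continuous.
apply: (cEn (fun th E i => gavg psi psib E th th (fun s => dxib psib th (s i)))) => E i.
apply: (gavg_continuous (f := fun th s => dxib psib th (s i))) => s.
exact: dxib_continuous.
Qed.

Lemma phin_deriv_le th (K : R) : 0 <= K ->
  (forall E, 0 <= @P n E) -> \sum_(E : fgr n) @P n E = 1 ->
  (forall s t, `|dxi psi th s t| <= K) -> (forall s, `|dxib psib th s| <= K) ->
  `|phin_deriv th| <= K * (1 + @En R P n (fun E i => (degf E i)%:R)).
Proof.
move=> K0 P0 P1 dK dbK.
have Ele (F G : fgr n -> 'I_n -> R) : (forall E i, `|F E i| <= G E i) ->
    `|@En R P n F| <= @En R P n G.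
  move=> FG; rewrite (le_trans (ler_norm_sum _ _ _))//; apply: ler_sum => E _.
  rewrite normrM ger0_norm// ler_wpM2l// normrM ger0_norm ?invr_ge0// ler_wpM2l ?invr_ge0//.
  by rewrite (le_trans (ler_norm_sum _ _ _))//; apply: ler_sum.
rewrite mulrDr mulr1 addrC (le_trans (ler_normD _ _))// lerD//.
  rewrite /aen normrM ger0_norm//.
  rewrite (@le_trans _ _ (2^-1 * (K * @En R P n (fun E i => (degf E i)%:R))))//.
    rewrite ler_wpM2l// (_ : K * _ = @En R P n (fun E i => K * (degf E i)%:R)).
      apply: Ele => E i; rewrite (le_trans (ler_norm_sum _ _ _))//.
      rewrite (@le_trans _ _ (\sum_(j | adjf E i j) K))//.
        by apply: ler_sum => j _; apply: gavg_le.
      rewrite /degf -sum1_card natr_sum mulr_sumr; apply: le_of_eq.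
      apply: eq_big => [j|j _]; last by rewrite mulr1.
      by apply/idP/idP => [h|/set_mem//]; exact/mem_set.
    rewrite /En mulr_sumr; apply: eq_bigr => E _.
    by rewrite mulrCA; congr (_ * _); rewrite mulrCA mulr_sumr.
  rewrite ler_piMl// ?invf_le1 ?ler1n// mulr_ge0// /En sumr_ge0// => E _.
  by rewrite mulr_ge0// mulr_ge0 ?invr_ge0// sumr_ge0.
rewrite (@le_trans _ _ (@En R P n (fun _ _ => K)))//.
  by apply: Ele => E i; apply: gavg_le.
rewrite /En -mulr_suml P1 mul1r sumr_const card_ord -[X in _^-1 * X]mulr_natr.
(* The mean of the constant [K] is [K], except on the empty vertex set, where it is [0]. *)
case: n => [|m]; first by rewrite !mulr0.
by rewrite mulrCA mulVf ?mulr1// pnatr_eq0.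
Qed.

End RandomGraph.

(** A degree is at most [L] plus itself restricted to values at least [L]. Uniform sparsity provides
    an [L] for which the mean of the second part is eventually below 1. *)
Lemma mean_degree_bounded (P : forall n, fgr n -> R) (mu : probability graphT R) :
  lwc P mu -> exists C : R, exists n0, forall n, (n0 <= n)%N ->
    @En R P n (fun E i => (degf E i)%:R) <= C.
Proof.
move=> [[P0 P1] sparse _ _ _].
have [L HL] : exists L : nat, (limn_esup (fun n =>
          (@En R P n (fun E i => ((degf E i) * (L <= degf E i))%:R))%:E) < 1)%E.
  have : nbhs (0 : \bar R) [set x | (x < 1)%E] by apply: open_nbhs_nbhs; split;
    [exact: open_ereal_lt_ereal|exact: lte01].
  by move=> /sparse[L _ HL]; exists L; exact: (HL L (leqnn L)).
move: HL; rewrite /limn_esup /limf_esup => /ereal_inf_lt[_ [V [n0 _ Vn] <-] sV].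
exists (L%:R + 1); exists n0 => n nn0.
have /ltW : ((@En R P n (fun E i => ((degf E i) * (L <= degf E i))%:R))%:E < 1)%E.
  by apply: le_lt_trans sV; apply: ereal_sup_ubound; exists n => //; exact: Vn.
rewrite lee_fin => h; apply: le_trans (lerD (lexx _) h).
have -> : L%:R + @En R P n (fun E i => (degf E i * (L <= degf E i))%:R)
   = \sum_(E : fgr n) P n E * (L%:R + n%:R^-1 * \sum_(i < n) (degf E i * (L <= degf E i))%:R).
  rewrite /En; under [RHS]eq_bigr do rewrite mulrDr.
  by rewrite big_split/= -mulr_suml P1 mul1r.
apply: ler_sum => E _; rewrite ler_wpM2l//.
rewrite (@le_trans _ _ (n%:R^-1 * \sum_(i < n) (L%:R + (degf E i * (L <= degf E i))%:R)))//.
  rewrite ler_wpM2l ?invr_ge0//; apply: ler_sum => i _.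
  rewrite -natrD ler_nat; case: (leqP L) => [_|/ltnW]; first by rewrite /= muln1 leq_addl.
  by rewrite /= muln0 addn0.
rewrite big_split/= mulrDr lerD2r sumr_const card_ord -[X in _^-1 * X]mulr_natr.
case: n {nn0 h E} => [|m]; first by rewrite mulr0 mulr0 ler0n.
by rewrite mulrCA mulVf ?mulr1// pnatr_eq0.
Qed.

End Specification.

(** * Rerooting and unimodularity *)

Lemma sw_root y : sw y y = 0%N.
Proof. by rewrite /sw eqxx; case: eqP. Qed.

Lemma sw0 y : sw y 0 = y.
Proof. by []. Qed.

Lemma swK y : involutive (sw y).
Proof.
move=> x; rewrite /sw; have [->|x0] := eqVneq x 0%N; first by rewrite eqxx; case: eqP.
by have [->//|xy] := eqVneq x y; rewrite (negbTE x0) (negbTE xy).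
Qed.

Lemma sw_id x : sw 0 x = x.
Proof. by rewrite /sw; case: eqVneq. Qed.

Lemma sw_eq0 y x : (sw y x == 0%N) = (x == y).
Proof. by rewrite -(inj_eq (inv_inj (swK y))) swK sw0. Qed.

Lemma rerootK g y : reroot (reroot g y) y = g.
Proof. by apply/funext => i; apply/funext => j; rewrite /reroot !swK. Qed.

Lemma reroot0 g : reroot g 0 = g.
Proof. by apply/funext => i; apply/funext => j; rewrite /reroot !sw_id. Qed.

(** Both orientations are demanded so that the condition is stable under exchanging the two roots,
    even in a raw graph that is not symmetric. *)
Definition edge (g : graphT) (x : nat) := g 0%N x && g x 0%N.

Lemma edge_reroot g x : edge (reroot g x) x = edge g x.
Proof. by rewrite /edge /reroot sw0 sw_root andbC. Qed.

Lemma Vset_step g x y : Vset g x -> g x y -> Vset g y.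
Proof. exact: reach_step. Qed.

Lemma Vset_root g : Vset g 0%N.
Proof. exact: reach_refl. Qed.

Lemma Vset_reroot g x z : Vset (reroot g x) z <-> reach g x (sw x z).
Proof.
split; first by elim=> [|y y' _ IH]; rewrite /reroot ?sw0; [exact: reach_refl|exact: reach_step].
move=> r; rewrite -(swK x z); elim: r => [|y y' _ IH gyy'].
  by rewrite sw_root; exact: reach_refl.
by apply: reach_step IH _; rewrite /reroot !swK.
Qed.

Lemma Vset_trans g x z : Vset g x -> reach g x z -> Vset g z.
Proof. by move=> gx; elim=> // y y' _ IH; exact: reach_step. Qed.

Lemma riso_nbr g1 g2 phi x : riso g1 g2 phi -> Vset g1 x ->
  nbr g2 (phi x) = phi @` nbr g1 x.
Proof.
move=> [p0 pinj pim pe] gx; apply/seteqP; split => [y /= g2y|_ [z /= g1z <-]].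
  have : Vset g2 y.
    apply: Vset_step g2y; rewrite -pim; by exists x.
  by rewrite -pim => -[z gz zy]; exists z => //; rewrite /nbr/= -pe ?zy.
by rewrite /nbr/= pe//; exact: Vset_step g1z.
Qed.

Lemma fset_set_infinite (T : choiceType) (A : set T) :
  ~ finite_set A -> fset_set A = fset0.
Proof. by move=> nA; rewrite /fset_set; case: pselect. Qed.

Lemma mem_nbrs g x j : (j \in nbrs g x) = `[< finite_set (nbr g x) >] && g x j.
Proof.
rewrite /nbrs; case: (pselect (finite_set (nbr g x))) => fin.
  rewrite in_fset_set// asboolT//=; apply/idP/idP => [/set_mem//|h]; exact/mem_set.
by rewrite fset_set_infinite// asboolF.
Qed.

Lemma mem_leq_bigmax (r : seq nat) m : m \in r -> (m <= \max_(i <- r) i)%N.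
Proof. by move=> mr; exact: (@leq_bigmax_seq _ r xpredT id m mr isT). Qed.

(** For infinite [A] the injective image is infinite as well and both index sets are empty by
    convention, so the two sides agree in that case too. *)
Lemma big_fset_set_inj (T : Type) (idx : T) (op : Monoid.com_law idx)
    (A : set nat) (f : nat -> nat) (p : pred nat) (F : nat -> T) :
  {in A &, injective f} ->
  \big[op/idx]_(v <- fset_set (f @` A) | p v) F v
    = \big[op/idx]_(v <- fset_set A | p (f v)) F (f v).
Proof.
move=> inj; case: (pselect (finite_set A)) => fin; last first.
  rewrite !fset_set_infinite// ?big_nil//.
  by move=> finp; apply: fin; rewrite -(eq_finite_set (inj_card_eq inj)).
have -> : fset_set (f @` A) = (f @` fset_set A)%fset by exact: fset_set_image.
rewrite big_mkcond big_imfset/=; last first.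
  by move=> u v; rewrite !in_fset_set//; exact: inj.
by rewrite -big_mkcond.
Qed.

Lemma riso_big_nbrs (T : Type) (idx : T) (op : Monoid.com_law idx) g1 g2 phi x y
    (F : nat -> T) : riso g1 g2 phi -> Vset g1 x -> Vset g1 y ->
  \big[op/idx]_(v <- nbrs g2 (phi x) | v != phi y) F v
    = \big[op/idx]_(v <- nbrs g1 x | v != y) F (phi v).
Proof.
move=> iso gx gy; rewrite /nbrs (riso_nbr iso gx).
have [_ pinj _ _] := iso.
have sub v : nbr g1 x v -> Vset g1 v by exact: Vset_step.
rewrite big_fset_set_inj; last first.
  by move=> u v /set_mem/sub ? /set_mem/sub ?; apply: pinj; exact/mem_set.
rewrite big_seq_cond [RHS]big_seq_cond; apply: eq_bigl => v.
case: (boolP (v \in _)) => //=; rewrite -/(nbrs g1 x) mem_nbrs => /andP[_ /sub gv].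
apply/idP/idP; apply: contra => /eqP; first by move->.
by move=> /pinj ->//; exact/mem_set.
Qed.

(** The isomorphism is [phi] conjugated by the transpositions that define the two rerootings. *)
Lemma riso_reroot g1 g2 phi x : riso g1 g2 phi -> Vset g1 x ->
  riso (reroot g1 x) (reroot g2 (phi x)) (fun z => sw (phi x) (phi (sw x z))).
Proof.
move=> [p0 pinj pim pe] gx.
have V1 z : Vset (reroot g1 x) z -> Vset g1 (sw x z).
  by move=> /Vset_reroot; exact: Vset_trans.
have im : phi @` (reach g1 x) = reach g2 (phi x).
  apply/seteqP; split=> [_ [z r <-]|y].
    elim: r => [|u v xu IH uv]; first exact: reach_refl.
    apply: reach_step IH _; have gu := Vset_trans gx xu.
    by rewrite pe//; exact: Vset_step uv.
  elim=> [|u v _ [z xz <-] zv]; first by exists x => //; exact: reach_refl.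
  have gz := Vset_trans gx xz.
  have : Vset g2 v by apply: Vset_step zv; rewrite -pim; exists z.
  rewrite -pim => -[w gw wv]; exists w => //.
  by apply: reach_step xz _; rewrite -pe ?wv.
split.
- by rewrite sw0 sw_root.
- move=> u v /set_mem/V1 gu /set_mem/V1 gv /(inv_inj (swK _)) /pinj e.
  by apply: (inv_inj (swK x)); apply: e; exact/mem_set.
- apply/seteqP; split=> [_ [z /Vset_reroot r <-]|y /Vset_reroot].
    by apply/Vset_reroot; rewrite swK -im; exists (sw x z).
  rewrite -im => -[z r zy]; exists (sw x z); last by rewrite swK zy swK.
  by apply/Vset_reroot; rewrite swK.
- by move=> u v /V1 gu /V1 gv; rewrite /reroot !swK pe.
Qed.

(* Raw graphs need not be symmetric, so invariance is only required on mutual edges. *)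
Definition edge_invariant (T : Type) (F : graphT * nat -> T) :=
  forall g1 g2 phi x, riso g1 g2 phi -> edge g1 x -> F (g1, x) = F (g2, phi x).

Lemma edge_riso g1 g2 phi x : riso g1 g2 phi -> Vset g1 x ->
  edge g2 (phi x) = edge g1 x.
Proof.
move=> [p0 _ _ pe] gx; rewrite /edge -[in LHS]p0 !pe//; exact: Vset_root.
Qed.

Lemma edge_Vset g x : edge g x -> Vset g x.
Proof. by move=> /andP[gx _]; exact: Vset_step (Vset_root g) gx. Qed.

(** * Measurability of sums and products over a random set of neighbours *)

Section Measurability.
Variable R : realType.

Lemma measurable_adj i j : measurable [set g : graphT | g i j].
Proof. by apply: sub_sigma_algebra; exists (i, j). Qed.

Lemma measurable_adjb i j : measurable_fun [set: graphT] (fun g : graphT => g i j).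
Proof.
apply: (measurable_fun_bool true); rewrite setTI; exact: measurable_adj.
Qed.

Lemma measurable_reroot y : measurable_fun [set: graphT] (fun g : graphT => reroot g y : graphT).
Proof.
apply: (@measurability _ _ graphT graphT setT _ gcyl) => // _ [_ [[i j] _ <-] <-]; rewrite setTI.
exact: measurable_adj.
Qed.

Lemma measurable_nat_pair d (T : measurableType d) (f : graphT * nat -> T) :
  (forall j, measurable_fun setT (fun g : graphT => f (g, j))) ->
  measurable_fun setT f.
Proof.
move=> mf _ Y mY; rewrite setTI.
rewrite (_ : f @^-1` Y = \bigcup_j (((fun g => f (g, j)) @^-1` Y) `*` [set j])).
  apply: bigcupT_measurable => j; apply: measurableX => //.
  by rewrite -[X in measurable X]setTI; exact: mf.
apply/seteqP; split=> [[g j] Yf|[g j] [i _ [/= Yf ->]]//].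
by exists j.
Qed.

Lemma measurable_slice d (T : measurableType d) (f : graphT * nat -> T) j :
  measurable_fun setT f -> measurable_fun setT (fun g : graphT => f (g, j)).
Proof.
move=> mf; apply: (measurableT_comp mf (g := fun g : graphT => (g, j))).
exact: measurable_fun_pair.
Qed.

Lemma measurable_finite_nbr x : measurable [set g : graphT | finite_set (nbr g x)].
Proof.
rewrite (_ : [set g | _] = \bigcup_n \bigcap_m
    [set g : graphT | (n <= m)%N -> ~~ g x m]); last first.
  apply/seteqP; split=> g /=.
    move=> fin; exists (\max_(i <- fset_set (nbr g x)) i).+1 => // m _ /= nm.
    apply/negP => gxm; have : m \in fset_set (nbr g x) by rewrite in_fset_set//; exact/mem_set.
    by move=> /mem_leq_bigmax; rewrite leqNgt nm.
  move=> [n _ H]; apply: (@sub_finite_set _ _ `I_n) => [m /= gxm|]; last exact: finite_II.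
  by rewrite ltnNge; apply: contraTN gxm => nm; exact: H.
apply: bigcupT_measurable => n; apply: bigcapT_measurable => m.
have [nm|nm] := leqP n m; last first.
  by rewrite (_ : [set g | _] = setT)//; apply/seteqP; split.
rewrite (_ : [set g | _] = ~` [set g : graphT | g x m]).
  by apply: measurableC; exact: measurable_adj.
by apply/seteqP; split=> g /= => [/(_ isT)/negP|/negP].
Qed.

Lemma measurable_mem_nbrs x j :
  measurable_fun [set: graphT] (fun g : graphT => j \in nbrs g x).
Proof.
apply: (measurable_fun_bool true); rewrite setTI.
rewrite (_ : _ @^-1` _ = [set g : graphT | finite_set (nbr g x)] `&` [set g : graphT | g x j]).
  by apply: measurableI; [exact: measurable_finite_nbr|exact: measurable_adj].
apply/seteqP; split=> g /=; rewrite mem_nbrs.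
  by move=> /andP[/asboolP].
by move=> [/asboolP -> ->].
Qed.

(** The index set [nbrs g x] varies with [g]. Cutting it off at [N] and moving membership into the
    summand gives a fixed index set, and the cut-off is exact for large [N]; measurability then
    passes to the pointwise limit. *)
Lemma big_nbrs_near (T : Type) (idx : T) (op : Monoid.com_law idx) g x
    (p : pred nat) (F : nat -> T) : exists M, forall N, (M <= N)%N ->
  \big[op/idx]_(j <- nbrs g x | p j) F j
    = \big[op/idx]_(j <- iota 0 N) (if p j && (j \in nbrs g x) then F j else idx).
Proof.
exists (\max_(i <- nbrs g x) i).+1 => N MN; rewrite -big_mkcond/=.
rewrite [LHS]big_seq_cond -[LHS]big_filter -[RHS]big_filter.
apply: perm_big; apply: uniq_perm; rewrite ?filter_uniq ?iota_uniq ?fset_uniq// => j.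
rewrite !mem_filter mem_iota add0n leq0n/=.
case: (boolP (j \in nbrs g x)) => jn; rewrite ?andbF//= andbT.
by rewrite (leq_trans _ MN) ?andbT// ltnS; exact: mem_leq_bigmax.
Qed.

Let cvg_near_eq (u : nat -> R) l : (exists M, forall N, (M <= N)%N -> l = u N) ->
  u @ \oo --> l.
Proof.
move=> [M HM]; apply/cvgrPdist_le => e e0; exists M => // N /= /HM <-.
by rewrite subrr normr0 ltW.
Qed.

Lemma measurable_sum_nbrs x (p : pred nat) (F : nat -> graphT -> R) :
  (forall j, measurable_fun setT (F j)) ->
  measurable_fun [set: graphT] (fun g : graphT => \sum_(j <- nbrs g x | p j) F j g).
Proof.
move=> mF; apply: (measurable_fun_cvg (h := fun N (g : graphT) =>
  \sum_(j <- iota 0 N) (if p j && (j \in nbrs g x) then F j g else 0))).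
  move=> N; apply: measurable_sum => j; case: (p j) => /=; last exact: measurable_cst.
  by apply: measurable_fun_ifT => //; exact: measurable_mem_nbrs.
by move=> g _; apply: cvg_near_eq; exact: big_nbrs_near.
Qed.

Lemma measurable_prod_nbrs x (p : pred nat) (F : nat -> graphT -> R) :
  (forall j, measurable_fun setT (F j)) ->
  measurable_fun [set: graphT] (fun g : graphT => \prod_(j <- nbrs g x | p j) F j g).
Proof.
move=> mF; apply: (measurable_fun_cvg (h := fun N (g : graphT) =>
  \prod_(j <- iota 0 N) (if p j && (j \in nbrs g x) then F j g else 1))).
  move=> N; apply: measurable_prod => j _; case: (p j) => /=; last exact: measurable_cst.
  by apply: measurable_fun_ifT => //; exact: measurable_mem_nbrs.
by move=> g _; apply: cvg_near_eq; exact: big_nbrs_near.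
Qed.

Lemma measurable_deg (u : nat -> R) x : measurable_fun [set: graphT] (fun g : graphT => u (deg g x)).
Proof.
have md : measurable_fun [set: graphT] (fun g : graphT => (deg g x)%:R : R).
  rewrite (_ : (fun g => _) = fun g : graphT => \sum_(j <- nbrs g x | xpredT j) (1 : R)).
    by apply: measurable_sum_nbrs.
  by apply/funext => g; rewrite big_const_seq count_predT iter_addr addr0 /deg.
move=> _ Y mY; rewrite setTI.
rewrite (_ : _ @^-1` Y = \bigcup_(n in [set n | Y (u n)])
    (fun g : graphT => (deg g x)%:R : R) @^-1` [set n%:R]).
  apply: bigcup_measurable => n _; rewrite -[X in measurable X]setTI.
  by apply: md => //; exact: measurable_set1.
apply/seteqP; split=> [g /= Yg|g [n /= Yn /eqP]]; first by exists (deg g x).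
by rewrite eqr_nat => /eqP ->.
Qed.

Lemma measurable_nneseries (f : nat -> graphT -> \bar R) :
  (forall k g, (0 <= f k g)%E) -> (forall k, measurable_fun setT (f k)) ->
  measurable_fun setT (fun g => (\sum_(0 <= k <oo) f k g)%E).
Proof.
move=> f0 mf.
by apply: (ge0_emeasurable_sum (h := f) (P := xpredT)).
Qed.

End Measurability.

(** * Mass transport along the edges at the root *)

Section Unimodular.
Variables (R : realType) (mu : probability graphT R).
Hypothesis umu : unimodular mu.
Hypothesis lfmu : {ae mu, forall g, is_lf_tree g}.
Local Open Scope ereal_scope.

(** Extension by zero off the edges upgrades [edge_invariant] to the invariance on all pairs that
    [unimodular] asks for. *)
Definition on_edge (F : graphT * nat -> \bar R) p := if edge p.1 p.2 then F p else 0.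

Lemma measurable_on_edge F : measurable_fun setT F -> measurable_fun setT (on_edge F).
Proof.
move=> mF; apply: measurable_nat_pair => j; rewrite /on_edge/=.
apply: measurable_fun_ifT; last by [].
  apply: measurable_and; exact: measurable_adjb.
exact: measurable_slice.
Qed.

Lemma on_edge_ge0 F : (forall p, 0 <= F p) -> forall p, 0 <= on_edge F p.
Proof. by move=> F0 p; rewrite /on_edge; case: ifP. Qed.

Lemma on_edge_invariant F : edge_invariant F -> dr_invariant (on_edge F).
Proof.
move=> iF g1 g2 phi x iso gx; rewrite /on_edge/= (edge_riso iso gx).
by case: ifPn => // e; exact: iF.
Qed.

Lemma on_edge_reroot F g x :
  on_edge F (reroot g x, x) = if edge g x then F (reroot g x, x) else 0.
Proof. by rewrite /on_edge/= edge_reroot. Qed.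

Lemma esum_Vset (a : nat -> \bar R) g : (forall x, 0 <= a x) ->
  (forall x, ~~ edge g x -> a x = 0) ->
  \esum_(x in Vset g) a x = \sum_(0 <= x <oo) a x.
Proof.
move=> a0 az; rewrite nneseries_esumT// esum_mkcond; apply: eq_esum => x _.
case: ifPn => // /negP xV; rewrite az//; apply/negP => e; apply: xV.
by apply/mem_set; exact: edge_Vset.
Qed.

Lemma unimodular_edge (F : graphT * nat -> \bar R) : (forall p, 0 <= F p) ->
  measurable_fun setT F -> edge_invariant F ->
  \int[mu]_g (\sum_(0 <= x <oo) on_edge F (g, x))
    = \int[mu]_g (\sum_(0 <= x <oo) on_edge F (reroot g x, x)).
Proof.
move=> F0 mF iF.
have := umu (on_edge_ge0 F0) (measurable_on_edge mF) (on_edge_invariant iF).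
under eq_integral => g _.
  rewrite esum_Vset; last 2 first.
  - by move=> x; exact: on_edge_ge0.
  - by move=> x; rewrite /on_edge/= => /negbTE ->.
  over.
move=> ->; apply: eq_integral => g _.
rewrite esum_Vset// => x; first exact: on_edge_ge0.
by rewrite on_edge_reroot => /negbTE ->.
Qed.

Lemma lf_tree_edge g x : is_lf_tree g -> edge g x = g 0%N x.
Proof.
move=> [sym _ _ _]; rewrite /edge -(sym 0%N x) ?andbb//; exact: Vset_root.
Qed.

Lemma lf_tree_mem_nbrs g x j : is_lf_tree g -> Vset g x -> (j \in nbrs g x) = g x j.
Proof. by move=> [_ _ fin _] gx; rewrite mem_nbrs asboolT//; exact: fin. Qed.

Lemma lf_tree_sum_edge g (a : nat -> \bar R) : is_lf_tree g -> (forall x, 0 <= a x) ->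
  \sum_(0 <= x <oo) (if edge g x then a x else 0) = \sum_(x <- nbrs g 0) a x.
Proof.
move=> tg a0; have [_ _ fin _] := tg.
rewrite nneseries_esumT; last by move=> n; case: ifP.
rewrite -fsbig_finite; last exact: (fin _ (Vset_root g)).
rewrite -esum_fset//; last exact: (fin _ (Vset_root g)).
rewrite [RHS]esum_mkcond; apply: eq_esum => x _.
rewrite lf_tree_edge//; congr (if _ then _ else _).
by apply/idP/idP => [h|/set_mem//]; exact/mem_set.
Qed.

(** Mass transport applied to the indicator of failure: the expected number of root edges violating
    [Pr] is zero, hence so is the expected number whose reversal violates it. A nonnegative series
    with zero integral vanishes almost surely, and then so does each of its terms. *)
Lemma upae_reroot (Pr : graphT -> nat -> Prop) :
  (forall j, measurable [set g | Pr g j]) ->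
  (forall g1 g2 phi x, riso g1 g2 phi -> edge g1 x -> Pr g1 x <-> Pr g2 (phi x)) ->
  upae mu Pr -> upae mu (fun g x => Pr (reroot g x) x).
Proof.
move=> mP iP aP.
pose F (p : graphT * nat) : \bar R := (\1_(~` [set g | Pr g p.2]) p.1)%:E.
have F0 p : 0 <= F p by rewrite lee_fin.
have mF : measurable_fun setT F.
  apply: measurable_nat_pair => j; apply/measurable_EFinP.
  change (measurable_fun setT (\1_(~` [set g | Pr g j]) : graphT -> R)).
  by apply: measurable_indic; apply: measurableC; exact: mP.
have iF : edge_invariant F.
  move=> g1 g2 phi x iso e; rewrite /F /= !indicE; congr ((_ : bool)%:R%:E).
  by apply/idP/idP => /set_mem/= h; apply/mem_set => /= Pg; apply: h;
    apply/(iP _ _ _ _ iso e).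
have := unimodular_edge F0 mF iF.
rewrite [LHS](_ : _ = 0); last first.
  transitivity (\int[mu]_g (cst 0 g : \bar R)); last by rewrite integral0.
  apply: ge0_ae_eq_integral => //.
  - apply: measurable_nneseries => [k g|k]; first exact: on_edge_ge0.
    by apply: measurable_slice; exact: measurable_on_edge.
  - by move=> g _; apply: nneseries_ge0 => k _ _; exact: on_edge_ge0.
  apply: filterS aP => g Hg _; apply: eseries0 => k _ _.
  rewrite /on_edge/=; case: ifPn => // /andP[/Hg Pg _].
  by rewrite /F/= indicE memNset//= => /(_ Pg).
have mrr k : measurable_fun setT (fun g => on_edge F (reroot g k, k)).
  apply: (measurableT_comp (measurable_slice k (measurable_on_edge mF))).
  exact: measurable_reroot.
move=> /esym int0.
have ser0 g : 0 <= \sum_(0 <= x <oo) on_edge F (reroot g x, x).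
  by apply: nneseries_ge0 => k _ _; exact: on_edge_ge0.
have mser : measurable_fun setT (fun g => \sum_(0 <= x <oo) on_edge F (reroot g x, x)).
  by apply: measurable_nneseries => // k g; exact: on_edge_ge0.
have : \int[mu]_g `|\sum_(0 <= x <oo) on_edge F (reroot g x, x)| = 0.
  by rewrite -[RHS]int0; apply: eq_integral => g _; rewrite gee0_abs.
move=> /(ae_eq_integral_abs _ measurableT mser) ae0.
apply: filterS2 ae0 lfmu => g /(_ I) /= s0 tg x gx.
have e : edge g x by rewrite lf_tree_edge.
have : on_edge F (reroot g x, x) <= 0.
  rewrite -s0; apply: (@le_trans _ _ (\sum_(0 <= i < x.+1) on_edge F (reroot g i, i))).
    rewrite big_nat_recr//= leeDr// sume_ge0// => i _; exact: on_edge_ge0.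
  by apply: nneseries_lim_ge => *; exact: (on_edge_ge0 F0).
rewrite on_edge_reroot e /F/= indicE lee_fin.
apply: contraPP => nP; rewrite mem_set//=; apply/negP.
by rewrite -ltNge ltr01.
Qed.

Local Open Scope ring_scope.

Lemma unimodular_sum_ge0 (G : graphT * nat -> R) : (forall p, 0 <= G p) ->
  (forall j, measurable_fun setT (fun g : graphT => G (g, j))) -> edge_invariant G ->
  (\int[mu]_g (\sum_(x <- nbrs g 0) G (g, x))%:E
    = \int[mu]_g (\sum_(x <- nbrs g 0) G (reroot g x, x))%:E)%E.
Proof.
move=> G0 mG iG; pose F := (EFin \o G).
have F0 p : (0 <= F p)%E by rewrite lee_fin.
have mF : measurable_fun setT F.
  by apply: measurable_nat_pair => j; apply/measurable_EFinP; exact: mG.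
have iF : edge_invariant F by move=> *; congr EFin; exact: iG.
have mrr k : measurable_fun setT (fun g : graphT => G (reroot g k, k)).
  exact: (measurableT_comp (mG k) (measurable_reroot k)).
transitivity (\int[mu]_g (\sum_(0 <= x <oo) on_edge F (g, x)))%E.
  apply: ge0_ae_eq_integral => //.
  - by apply/measurable_EFinP; apply: (measurable_sum_nbrs 0%N xpredT (F := fun x g => G (g, x))).
  - apply: measurable_nneseries => [k g|k]; first exact: on_edge_ge0.
    by apply: measurable_slice; exact: measurable_on_edge.
  - by move=> g _; rewrite lee_fin sumr_ge0.
  - by move=> g _; apply: nneseries_ge0 => k _ _; exact: on_edge_ge0.
  apply: filterS lfmu => g tg _.
  by rewrite -sumEFin -lf_tree_sum_edge//= => x; rewrite lee_fin.
rewrite unimodular_edge//; apply: ge0_ae_eq_integral => //.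
- apply: measurable_nneseries => [k g|k]; first exact: on_edge_ge0.
  apply: (measurableT_comp (measurable_slice k (measurable_on_edge mF))).
  exact: measurable_reroot.
- by apply/measurable_EFinP; apply: (measurable_sum_nbrs 0%N xpredT (F := fun x g => G (reroot g x, x))).
- by move=> g _; apply: nneseries_ge0 => k _ _; exact: on_edge_ge0.
- by move=> g _; rewrite lee_fin sumr_ge0.
apply: filterS lfmu => g tg _.
rewrite -sumEFin -lf_tree_sum_edge//=; last by move=> x; rewrite lee_fin.
by apply: eq_eseriesr => x _; rewrite on_edge_reroot.
Qed.

(** Mass transport is available for nonnegative functions, here [|G|] and [|G| + G]. Subtracting the
    first identity from the second is legitimate because the integral of the sum of [|G|] is
    finite. *)
Lemma unimodular_sum (G : graphT * nat -> R) :
  (forall j, measurable_fun setT (fun g : graphT => G (g, j))) -> edge_invariant G ->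
  mu.-integrable setT (fun g => (\sum_(x <- nbrs g 0) `|G (g, x)|)%:E) ->
  mu.-integrable setT (fun g => (\sum_(x <- nbrs g 0) G (g, x))%:E) ->
  mu.-integrable setT (fun g => (\sum_(x <- nbrs g 0) G (reroot g x, x))%:E) ->
  (\int[mu]_g (\sum_(x <- nbrs g 0) (G (g, x) - G (reroot g x, x)))%:E = 0)%E.
Proof.
move=> mG iG ia i1 i2.
have mrr k : measurable_fun setT (fun g : graphT => G (reroot g k, k)).
  exact: (measurableT_comp (mG k) (measurable_reroot k)).
have ia' : mu.-integrable setT (fun g => (\sum_(x <- nbrs g 0) `|G (reroot g x, x)|)%:E).
  apply/integrableP; split.
    apply/measurable_EFinP; apply: (measurable_sum_nbrs 0%N xpredT (F := fun x g => `|G (reroot g x, x)|)) => j.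
    exact: measurableT_comp.
  have /integrableP[_] := ia; congr (_ < _)%E.
  transitivity (\int[mu]_g (\sum_(x <- nbrs g 0) `|G (g, x)|)%:E)%E.
    by apply: eq_integral => g _; rewrite gee0_abs// lee_fin sumr_ge0.
  rewrite (@unimodular_sum_ge0 (fun p => `|G p|))//.
  - by apply: eq_integral => g _; rewrite gee0_abs// lee_fin sumr_ge0.
  - by move=> j; exact: measurableT_comp.
  - by move=> g1 g2 phi x iso e; rewrite (iG _ _ _ _ iso e).
have ea := @unimodular_sum_ge0 (fun p => `|G p|) (fun p => normr_ge0 _)
  (fun j => measurableT_comp (@normr_measurable R setT) (mG j))
  (fun g1 g2 phi x iso e => congr1 Num.norm (iG _ _ _ _ iso e)).
have ep : (\int[mu]_g (\sum_(x <- nbrs g 0) (`|G (g, x)| + G (g, x)))%:E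
  = \int[mu]_g (\sum_(x <- nbrs g 0) (`|G (reroot g x, x)| + G (reroot g x, x)))%:E)%E.
  apply: (@unimodular_sum_ge0 (fun p => `|G p| + G p)).
  - by move=> p; have := ler_norm (- G p); rewrite normrN; lra.
  - by move=> j; apply: measurable_funD => //; exact: measurableT_comp.
  - by move=> g1 g2 phi x iso e; rewrite (iG _ _ _ _ iso e).
have split_int (u v : graphT -> R) : mu.-integrable setT (EFin \o u) ->
   mu.-integrable setT (EFin \o v) -> (\int[mu]_g (u g + v g)%:E =
     \int[mu]_g (u g)%:E + \int[mu]_g (v g)%:E)%E.
  by move=> iu iv; under eq_integral do rewrite EFinD; rewrite integralD_EFin.
under eq_integral do rewrite sumrB EFinB.
rewrite integralB_EFin//.
have e1 : (\int[mu]_g (\sum_(x <- nbrs g 0) (`|G (g, x)| + G (g, x)))%:E =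
    \int[mu]_g (\sum_(x <- nbrs g 0) `|G (g, x)|)%:E
    + \int[mu]_g (\sum_(x <- nbrs g 0) G (g, x))%:E)%E.
  by rewrite -split_int//; apply: eq_integral => g _; rewrite big_split.
have e2 : (\int[mu]_g (\sum_(x <- nbrs g 0) (`|G (reroot g x, x)| + G (reroot g x, x)))%:E =
    \int[mu]_g (\sum_(x <- nbrs g 0) `|G (reroot g x, x)|)%:E
    + \int[mu]_g (\sum_(x <- nbrs g 0) G (reroot g x, x))%:E)%E.
  by rewrite -split_int//; apply: eq_integral => g _; rewrite big_split.
move: ep; rewrite e1 e2 -ea.
have fa : (\int[mu]_g (\sum_(x <- nbrs g 0) `|G (g, x)|)%:E)%E \is a fin_num.
  exact: integrable_fin_num.
move=> /(congr1 (fun z => z - \int[mu]_g (\sum_(x <- nbrs g 0) `|G (g, x)|)%:E)%E).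
rewrite ![(_ + (\int[mu]_g (\sum_(x <- nbrs g 0) G _)%:E))%E]addeC !addeK// => ->.
by rewrite subee//; exact: integrable_fin_num.
Qed.

End Unimodular.

(** * Bethe free energy along a path of fixed points *)

Section Star.
Variables (R : realType) (X : finType).
Variables (psi : R -> X -> X -> R) (psib : R -> X -> R).
Hypothesis h1 : H1 psi psib.
Variable h : msgT R X.
Hypothesis h_ge0 : forall p b s, 0 <= h p b b s.
Hypothesis h_sum : forall p b, \sum_(s : X) h p b b s = 1.
Implicit Types (g : graphT) (th : R).

(** The message in the opposite direction, from the root to [p.2]: after rerooting at [p.2], the
    label [p.2] is carried by the former root. *)
Definition hrev (p : graphT * nat) th s := h (reroot p.1 p.2, p.2) th th s.

Definition Ze (p : graphT * nat) th :=
  \sum_(s : X) \sum_(t : X) psi th s t * h p th th t * hrev p th s.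

Definition Zo g th := \sum_(s : X) w1 psi psib h g th th s.

(** The unnormalised cavity message from the root to [j], written with incoming messages only. *)
Definition cav g j th s := psib th s * \prod_(v <- nbrs g 0 | v != j)
  (\sum_(t : X) psi th s t * h (g, v) th th t).

Definition edge_avg (p : graphT * nat) th (f : X -> X -> R) :=
  (\sum_(s : X) \sum_(t : X) f s t * (psi th s t * h p th th t * hrev p th s)) / Ze p th.

Lemma cavE g j th s : BPun psi psib h g 0 j th th s = cav g j th s.
Proof.
rewrite /BPun /cav; congr (_ * _); apply: eq_bigr => v _; apply: eq_bigr => t _.
by rewrite /msg reroot0 sw_id.
Qed.

Lemma PhiTE g th : PhiT psi psib h g th th
  = ln (Zo g th) - 2^-1 * \sum_(j <- nbrs g 0) ln (Ze (g, j) th).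
Proof. by []. Qed.

(** The clause on [hrev] identifies the outgoing message with the normalised [cav], and this is what
    links the vertex term [Zo] to the edge terms [Ze]. *)
Definition good g th := is_lf_tree g /\ forall j, g 0%N j ->
  (forall s, h (g, j) th th s = BP psi psib h g j 0 th th s) /\
  (forall s, hrev (g, j) th s = BP psi psib h g 0 j th th s).

Lemma Ze_sym g j th : Ze (reroot g j, j) th = Ze (g, j) th.
Proof.
rewrite /Ze exchange_big/=; apply: eq_bigr => s _; apply: eq_bigr => t _.
by rewrite /hrev/= rerootK (psi_sym h1) mulrAC.
Qed.

Lemma hrev_sum p th : \sum_(s : X) hrev p th s = 1.
Proof. exact: h_sum. Qed.

(** A zero normaliser would, by the convention on division, make the message identically zero,
    whereas it sums to one. *)
Lemma BPun_neq0 g x y th (u : X -> R) :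
  (forall s, u s = BP psi psib h g x y th th s) -> \sum_s u s = 1 ->
  \sum_s BPun psi psib h g x y th th s != 0.
Proof.
move=> uE su; apply/eqP => z; have : (1 : R) = 0.
  rewrite -su (eq_bigr (fun=> 0)) ?big1// => s _.
  by rewrite uE /BP z invr0 mulr0.
by move/eqP; rewrite oner_eq0.
Qed.

Lemma good_cav g j th : good g th -> g 0%N j ->
  \sum_s cav g j th s != 0 /\
  (forall s, hrev (g, j) th s = cav g j th s / \sum_s cav g j th s).
Proof.
move=> [_ gd] /gd[_ fo]; split.
  have := BPun_neq0 fo (hrev_sum _ _).
  by rewrite (eq_bigr (cav g j th)) => // s _; rewrite cavE.
move=> s; rewrite fo /BP cavE; congr (_ / _).
by apply: eq_bigr => s' _; rewrite cavE.
Qed.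

Lemma w1_cav g j th s : is_lf_tree g -> g 0%N j ->
  w1 psi psib h g th th s = cav g j th s * \sum_(t : X) psi th s t * h (g, j) th th t.
Proof.
move=> tg gj; rewrite /w1 /cav (bigD1_seq j) ?fset_uniq//=; last first.
  by rewrite lf_tree_mem_nbrs//; exact: Vset_root.
by rewrite mulrCA -mulrA mulrC -mulrA; congr (_ * _); rewrite mulrC.
Qed.

Lemma Ze_hrev g j th : Ze (g, j) th = \sum_(s : X) hrev (g, j) th s
  * \sum_(t : X) psi th s t * h (g, j) th th t.
Proof.
apply: eq_bigr => s _; rewrite mulr_sumr; apply: eq_bigr => t _.
by rewrite mulrC.
Qed.

(* The law of the edge (o, j) under the tree measure, seen from the vertex o
   on the left and from the two messages of the edge on the right. *)
Lemma cav_avg g j th (x : X -> R) : good g th -> g 0%N j ->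
  (\sum_s cav g j th s * x s) / Zo g th
    = (\sum_s hrev (g, j) th s * x s) / Ze (g, j) th.
Proof.
move=> gd gj; have [C0 ho] := good_cav gd gj; have [tg _] := gd.
rewrite Ze_hrev /Zo.
under [X in _ / X = _]eq_bigr do rewrite (w1_cav _ _ tg gj).
set C := \sum_s cav g j th s in C0 ho *.
have -> : \sum_s hrev (g, j) th s * x s = C^-1 * \sum_s cav g j th s * x s.
  by rewrite mulr_sumr; apply: eq_bigr => s _; rewrite ho mulrAC mulrC.
have -> : \sum_s hrev (g, j) th s * (\sum_(t : X) psi th s t * h (g, j) th th t)
   = C^-1 * \sum_s cav g j th s * (\sum_(t : X) psi th s t * h (g, j) th th t).
  by rewrite mulr_sumr; apply: eq_bigr => s _; rewrite ho mulrAC mulrC.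
by rewrite -mulf_div divff ?mul1r// invr_eq0.
Qed.

(** By the fixed-point equation at both ends, [w2] is the product of the two cavity normalisers [C]
    and [C'] times the weight [psi * h * hrev] of the edge; the constants cancel in the quotient. *)
Lemma tavg2E g j th (f : X -> X -> R) : good g th -> g 0%N j ->
  tavg2 psi psib h g j th th f = edge_avg (g, j) th f.
Proof.
move=> gd gj; have [C0 ho] := good_cav gd gj; have [tg Hg] := gd.
have [fi _] := Hg j gj.
have C'0 := BPun_neq0 fi (h_sum _ _).
set C := \sum_s cav g j th s in C0 ho *.
set C' := \sum_s BPun _ _ _ _ _ _ _ _ s in C'0.
have w2E s t : w2 psi psib h g j th th s t =
    (C * C') * (psi th s t * h (g, j) th th t * hrev (g, j) th s).
  rewrite ho fi /BP -/C' /w2 /cav /BPun.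
  by field; rewrite C0 C'0.
rewrite /tavg2 /edge_avg /Ze.
under [X in X / _]eq_bigr do under eq_bigr do rewrite w2E mulrCA.
under [X in X / _]eq_bigr do rewrite -mulr_sumr.
under [X in _ / X]eq_bigr do under eq_bigr do rewrite w2E.
under [X in _ / X]eq_bigr do rewrite -mulr_sumr.
by rewrite -!mulr_sumr -mulf_div divff ?mul1r// mulf_neq0.
Qed.

(** The integrand whose expectation is [avx_lim + ae_lim], the derivative along the diagonal. *)
Definition Aloc g th := tavg1 psi psib h g th th (dxib psib th)
  + 2^-1 * \sum_(j <- nbrs g 0) tavg2 psi psib h g j th th (dxi psi th).

Section Expansion.
Variables (t0 t1 : R).
Hypothesis t01 : t0 < t1.
Notation pt := (pt t0 t1).
Notation mesh := (mesh t0 t1).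

(* First-order effect of the increment of the message at p on ln Ze. *)
Definition Gf N k (p : graphT * nat) :=
  (\sum_(s : X) \sum_(t : X) psi (pt N k) s t *
     (h p (pt N k.+1) (pt N k.+1) t - h p (pt N k) (pt N k) t) * hrev p (pt N k) s)
  / Ze p (pt N k).

Lemma path_psi s t : path t0 t1 (fun th => psi th s t)
  (fun N k => psi (pt N k) s t * dxi psi (pt N k) s t * mesh N).
Proof.
apply: (path_C1 t01 (du := fun th => psi th s t * dxi psi th s t)) => [x _|].
  exact: (is_derive_psi h1).
apply: continuous_subspaceT => x; apply: cvgM; first exact: (psi_continuous h1).
exact: (dxi_continuous h1).
Qed.

Lemma path_psib s : path t0 t1 (fun th => psib th s)
  (fun N k => psib (pt N k) s * dxib psib (pt N k) s * mesh N).
Proof.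
apply: (path_C1 t01 (du := fun th => psib th s * dxib psib th s)) => [x _|].
  exact: (is_derive_psib h1).
apply: continuous_subspaceT => x; apply: cvgM; first exact: (psib_continuous h1).
exact: (dxib_continuous h1).
Qed.

Definition regular (p : graphT * nat) := forall s,
  small t0 t1 (fun th => h p th th s) /\ bvar t0 t1 (fun th => h p th th s).

Lemma path_msg p s : regular p -> path t0 t1 (fun th => h p th th s)
  (fun N k => h p (pt N k.+1) (pt N k.+1) s - h p (pt N k) (pt N k) s).
Proof. by move=> /(_ s)[sm bv]; exact: path_itself. Qed.

Definition Lm g j N k s := \sum_(t : X) (psi (pt N k) s t *
     (h (g, j) (pt N k.+1) (pt N k.+1) t - h (g, j) (pt N k) (pt N k) t)
   + h (g, j) (pt N k) (pt N k) t
     * (psi (pt N k) s t * dxi psi (pt N k) s t * mesh N)).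

Lemma path_m g j s : regular (g, j) ->
  path t0 t1 (fun th => \sum_(t : X) psi th s t * h (g, j) th th t)
   (fun N k => Lm g j N k s).
Proof.
move=> rg; apply: path_sum => t.
exact: (pathM (path_psi s t) (path_msg t rg)).
Qed.

Lemma path_Ze g j : regular (g, j) -> regular (reroot g j, j) ->
  path t0 t1 (Ze (g, j)) (fun N k => \sum_(s : X) \sum_(t : X)
   (psi (pt N k) s t * h (g, j) (pt N k) (pt N k) t
      * (hrev (g, j) (pt N k.+1) s - hrev (g, j) (pt N k) s)
    + hrev (g, j) (pt N k) s * (psi (pt N k) s t *
     (h (g, j) (pt N k.+1) (pt N k.+1) t - h (g, j) (pt N k) (pt N k) t)
   + h (g, j) (pt N k) (pt N k) t
     * (psi (pt N k) s t * dxi psi (pt N k) s t * mesh N)))).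
Proof.
move=> r1 r2; apply: path_sum => s; apply: path_sum => t.
by apply: (pathM (pathM (path_psi s t) (path_msg t r1))); exact: path_msg.
Qed.

Lemma path_Zo g : (forall j, j \in nbrs g 0 -> regular (g, j)) ->
  path t0 t1 (Zo g) (fun N k => \sum_(s : X)
   (psib (pt N k) s * (\sum_(j <- nbrs g 0) Lm g j N k s *
       \prod_(v <- nbrs g 0 | v != j)
           (\sum_(t : X) psi (pt N k) s t * h (g, v) (pt N k) (pt N k) t))
    + (\prod_(v <- nbrs g 0) (\sum_(t : X) psi (pt N k) s t * h (g, v) (pt N k) (pt N k) t))
       * (psib (pt N k) s * dxib psib (pt N k) s * mesh N))).
Proof.
move=> rg; apply: path_sum => s.
apply: (pathM (path_psib s)).
apply: (path_prod (u := fun v th => \sum_(t : X) psi th s t * h (g, v) th th t)).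
  exact: fset_uniq.
by move=> j /rg; exact: path_m.
Qed.

Lemma edge_increment g j N k : 
  (\sum_s hrev (g, j) (pt N k) s * Lm g j N k s) / Ze (g, j) (pt N k)
   = Gf N k (g, j) + mesh N * edge_avg (g, j) (pt N k) (dxi psi (pt N k)).
Proof.
rewrite /Gf /edge_avg mulrA -mulrDl mulr_sumr -big_split/=; congr (_ / _).
apply: eq_bigr => s _; rewrite /Lm !mulr_sumr -big_split/=.
by apply: eq_bigr => t _; ring.
Qed.

(** For each neighbour [j], [ln Zo] contributes [Gf] of the incoming message plus [mesh] times the
    edge average, by [cav_avg]. From this [2^-1 * ln Ze] removes half of the edge average and half
    of [Gf] in both directions. What remains is half of the edge average, which goes into [Aloc],
    and half of the difference of the two [Gf]. *)
Lemma lin_PhiT g (c : R) : 0 < c -> is_lf_tree g ->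
  (forall N k, (k <= N.+1)%N -> good g (pt N k)) ->
  (forall N k, (k <= N.+1)%N -> c <= Zo g (pt N k)) ->
  (forall N k j, g 0%N j -> (k <= N.+1)%N -> c <= Ze (g, j) (pt N k)) ->
  (forall j, g 0%N j -> regular (g, j) /\ regular (reroot g j, j)) ->
  lin t0 t1 (fun th => PhiT psi psib h g th th)
   (fun N k => mesh N * Aloc g (pt N k) +
     2^-1 * \sum_(j <- nbrs g 0) (Gf N k (g, j) - Gf N k (reroot g j, j))).
Proof.
move=> c0 tg gd Zoc Zec rg.
have nb j : (j \in nbrs g 0) = g 0%N j by rewrite lf_tree_mem_nbrs//; exact: Vset_root.
have l1 := lin_ln c0 Zoc (path_Zo (fun j jn => (rg j (etrans (esym (nb j)) jn)).1)).
pose f j th := if j \in nbrs g 0 then ln (Ze (g, j) th) else 0.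
pose L j N k := if j \in nbrs g 0 then
   mesh N * edge_avg (g, j) (pt N k) (dxi psi (pt N k)) + Gf N k (g, j)
     + Gf N k (reroot g j, j) else 0.
have l2 j : lin t0 t1 (f j) (L j).
  have [jn|jn] := boolP (j \in nbrs g 0); last first.
    rewrite (_ : f j = fun=> 0); last by apply/funext => th; rewrite /f (negbTE jn).
    by apply: lin_ext (@lin0 R t0 t1) => N k _; rewrite /L (negbTE jn).
  rewrite (_ : f j = fun th => ln (Ze (g, j) th)); last first.
    by apply/funext => th; rewrite /f jn.
  have gj : g 0%N j by rewrite -nb.
  have [r1 r2] := rg j gj.
  have := lin_ln c0 (fun N k kN => Zec N k j gj kN) (path_Ze r1 r2).
  apply: lin_ext => N k kN; rewrite /L jn.
  rewrite [X in _ = X + _]addrC -edge_increment.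
  (* From the other end the edge has the same [Ze], and exchanging the two spin sums turns the
     increment of the outgoing message into [Gf] of the rerooted pair. *)
  rewrite /Gf Ze_sym [X in _ + X / _]exchange_big/= -mulrDl -big_split/=; congr (_ / _).
  apply: eq_bigr => s _; rewrite /Lm mulr_sumr -big_split/=; apply: eq_bigr => t _.
  by rewrite /hrev/= rerootK (psi_sym h1 _ t s); ring.
have l3 := linD l1 (linZ (- 2^-1) (lin_sum (nbrs g 0) l2)).
rewrite (_ : (fun th => PhiT _ _ _ _ _ _) = (fun x =>
    ln (Zo g x) + - 2^-1 * \sum_(i <- nbrs g 0) f i x)); last first.
  apply/funext => th; rewrite PhiTE mulNr; congr (_ - _ * _).
  by rewrite !big_seq; apply: eq_bigr => j jn; rewrite /f jn.
apply: lin_ext l3 => N k kN; have gdk := gd N k (leqW kN).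
set th := pt N k in gdk *.
have -> : (\sum_(s : X)
   (psib th s * (\sum_(j <- nbrs g 0) Lm g j N k s *
       \prod_(v <- nbrs g 0 | v != j) (\sum_(t : X) psi th s t * h (g, v) th th t))
    + (\prod_(v <- nbrs g 0) (\sum_(t : X) psi th s t * h (g, v) th th t))
       * (psib th s * dxib psib th s * mesh N))) / Zo g th
  = mesh N * tavg1 psi psib h g th th (dxib psib th)
    + \sum_(j <- nbrs g 0) (Gf N k (g, j) + mesh N * edge_avg (g, j) th (dxi psi th)).
  rewrite big_split/= mulrDl addrC; congr (_ + _).
    rewrite /tavg1 mulrA mulr_sumr; congr (_ / _); apply: eq_bigr => s _.
    by rewrite /w1; ring.
  under eq_bigr do rewrite mulr_sumr.
  rewrite exchange_big/= mulr_suml [LHS]big_seq [RHS]big_seq; apply: eq_bigr => j jn.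
  rewrite -edge_increment -(cav_avg _ gdk) -?nb//; congr (_ / _).
  by apply: eq_bigr => s _; rewrite /cav; ring.
have -> : Aloc g th = tavg1 psi psib h g th th (dxib psib th)
  + 2^-1 * \sum_(j <- nbrs g 0) edge_avg (g, j) th (dxi psi th).
  rewrite /Aloc; congr (_ + _ * _); rewrite !big_seq; apply: eq_bigr => j jn.
  by rewrite tavg2E -?nb.
have -> : \sum_(j <- nbrs g 0) L j N k = \sum_(j <- nbrs g 0)
  (mesh N * edge_avg (g, j) th (dxi psi th) + Gf N k (g, j) + Gf N k (reroot g j, j)).
  by rewrite !big_seq; apply: eq_bigr => j jn; rewrite /L jn.
rewrite !big_split/= sumrN -!mulr_sumr.
by field.
Qed.

End Expansion.
End Star.

(** * Bounds on the partition functions *)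

Lemma finite_family_bounded (R : realType) (I : finType) (a b : R) (u : I -> R -> R) :
  a <= b -> (forall i, continuous (u i)) ->
  exists2 K : R, 0 <= K & forall i x, a <= x <= b -> `|u i x| <= K.
Proof.
move=> ab cu.
have H i : exists K : R, 0 <= K /\ forall x, a <= x <= b -> `|u i x| <= K.
  have [K K0 HK] := continuous_bounded_itv ab (continuous_subspaceT (cu i)).
  by exists K.
have [K HK] := choice H; exists (\sum_i K i).
  by apply: sumr_ge0 => i _; have [] := HK i.
move=> i x xab; rewrite (bigD1 i)//= (le_trans ((HK i).2 x xab))// lerDl.
by apply: sumr_ge0 => j _; have [] := HK j.
Qed.

Section Bounds.
Variables (R : realType) (X : finType).
Variables (psi : R -> X -> X -> R) (psib : R -> X -> R).
Hypothesis h1 : H1 psi psib.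
Variable h : msgT R X.
Hypothesis h_ge0 : forall p b s, 0 <= h p b b s.
Hypothesis h_sum : forall p b, \sum_(s : X) h p b b s = 1.
Variables (t0 t1 : R).
Hypothesis t01 : t0 < t1.
Implicit Types (g : graphT) (th : R).

(** One constant bounds the weights above and, through [K^-1], below. The lower bound on [psi]
    concerns its nonzero entries, whose pattern does not move with the parameter by (H1). *)
Definition spec_bound (K : R) := 1 <= K /\ forall th, t0 <= th <= t1 ->
  [/\ forall s t, psi th s t <= K, forall s, psib th s <= K,
      forall s, K^-1 <= psib th s,
      forall s t, 0 < psi th s t -> K^-1 <= psi th s t &
      (forall s t, `|dxi psi th s t| <= K) /\ forall s, `|dxib psib th s| <= K].

Lemma spec_bound_exists : exists K, spec_bound K.
Proof.
have ab := ltW t01.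
have [K1 K10 H1] : exists2 K : R, 0 <= K & forall (p : X * X) x, t0 <= x <= t1 -> `|psi x p.1 p.2| <= K.
  by apply: finite_family_bounded => // p; exact: (psi_continuous h1).
have [K2 K20 H2] : exists2 K : R, 0 <= K & forall (p : X) x, t0 <= x <= t1 -> `|psib x p| <= K.
  by apply: finite_family_bounded => // p; exact: (psib_continuous h1).
have [K3 K30 H3] : exists2 K : R, 0 <= K & forall (p : X) x, t0 <= x <= t1 -> `|(psib x p)^-1| <= K.
  apply: finite_family_bounded => // s x; apply: cvgV; first by rewrite gt_eqF// (psib_gt0 h1).
  exact: (psib_continuous h1).
have [K4 K40 H4] : exists2 K : R, 0 <= K & forall (p : X * X) x, t0 <= x <= t1 -> `|(psi x p.1 p.2)^-1| <= K.
  (* An identically zero entry has inverse [0] by convention, so its inverse is continuous as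
     well. *)
  apply: finite_family_bounded => // -[s t]/= x; have [z|p] := psi_dichotomy h1 s t.
    rewrite (_ : (fun x => _) = fun=> 0); first exact: cvg_cst.
    by apply/funext => y; rewrite z invr0.
  by apply: cvgV; [rewrite gt_eqF|exact: (psi_continuous h1)].
have [K5 K50 H5] : exists2 K : R, 0 <= K & forall (p : X * X) x, t0 <= x <= t1 -> `|dxi psi x p.1 p.2| <= K.
  by apply: finite_family_bounded => // p; exact: (dxi_continuous h1).
have [K6 K60 H6] : exists2 K : R, 0 <= K & forall (p : X) x, t0 <= x <= t1 -> `|dxib psib x p| <= K.
  by apply: finite_family_bounded => // p; exact: (dxib_continuous h1).
pose K := 1 + K1 + K2 + K3 + K4 + K5 + K6; exists K; rewrite /spec_bound.
split; first by rewrite /K; lra.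
move=> th thI.
have K0 : 0 < K by rewrite /K; lra.
split.
- by move=> s t; have := ler_norm (psi th s t); have := H1 (s, t) _ thI; rewrite /K/=; lra.
- by move=> s; have := ler_norm (psib th s); have := H2 s _ thI; rewrite /K/=; lra.
- move=> s; have p := psib_gt0 h1 th s; rewrite -[leRHS]invrK lef_pV2 ?posrE ?invr_gt0//.
  by have := ler_norm (psib th s)^-1; have := H3 s _ thI; rewrite /K/=; lra.
- move=> s t p; rewrite -[leRHS]invrK lef_pV2 ?posrE ?invr_gt0//.
  by have := ler_norm (psi th s t)^-1; have := H4 (s, t) _ thI; rewrite /K/=; lra.
- split=> [s t|s]; first by have := H5 (s, t) _ thI; rewrite /K/=; lra.
  by have := H6 s _ thI; rewrite /K/=; lra.
Qed.

Variable K : R.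
Hypothesis HK : spec_bound K.

Definition all_pos := forall b s t, 0 < psi b s t.

(* The exponential growth is only needed when psi has zeros. *)
Definition edge_wt (n : nat) : R :=
  if pselect all_pos then K else #|X|%:R * K ^+ 3 * (K ^+ 2) ^+ n.

Let K1 : 1 <= K. Proof. by case: HK. Qed.
Let K0 : 0 < K. Proof. exact: lt_le_trans ltr01 K1. Qed.

Lemma X_ge1 : 1 <= #|X|%:R :> R.
Proof.
have [_ _ [sp _] _ _] := h1; rewrite ler1n.
by apply/card_gt0P; exists sp.
Qed.

Lemma edge_wt_ge1 n : 1 <= edge_wt n.
Proof.
rewrite /edge_wt; case: pselect => np //=.
by rewrite !mulr_ege1 ?exprn_ege1 ?X_ge1.
Qed.

Section AtParameter.
Variables (th : R) (g : graphT).
Hypothesis thI : t0 <= th <= t1.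
Hypothesis gd : good psi psib h g th.

Let psiK s t : psi th s t <= K. Proof. by case: HK => _ /(_ th thI)[]. Qed.
Let psibK s : psib th s <= K. Proof. by case: HK => _ /(_ th thI)[]. Qed.
Let psibV s : K^-1 <= psib th s. Proof. by case: HK => _ /(_ th thI)[]. Qed.
Let psiV s t : 0 < psi th s t -> K^-1 <= psi th s t.
Proof. by case: HK => _ /(_ th thI)[_ _ _ + _]; apply. Qed.

Let m j s := \sum_(t : X) psi th s t * h (g, j) th th t.

Lemma msg_sum_ge0 j s : 0 <= m j s.
Proof. by apply: sumr_ge0 => t _; rewrite mulr_ge0 ?(psi_ge0 h1). Qed.

Lemma msg_sum_le j s : m j s <= K.
Proof.
rewrite -[leRHS]mulr1 -(h_sum (g, j) th) mulr_sumr; apply: ler_sum => t _.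
by rewrite ler_wpM2r.
Qed.

Lemma msg_sum_ge j s : (forall t, 0 < psi th s t) -> K^-1 <= m j s.
Proof.
move=> pos; rewrite -[leLHS]mulr1 -(h_sum (g, j) th) mulr_sumr; apply: ler_sum => t _.
by rewrite ler_wpM2r// psiV.
Qed.

Lemma prod_msg_le (p : pred nat) s : \prod_(v <- nbrs g 0 | p v) m v s <= K ^+ deg g 0.
Proof.
rewrite /deg; elim: (nbrs g 0 : seq nat) => [|v r IH]; first by rewrite big_nil.
rewrite big_cons /= exprS; case: ifP => _.
  by rewrite ler_pM ?prodr_ge0 ?msg_sum_le// => *; exact: msg_sum_ge0.
by rewrite (le_trans IH)// ler_peMl// exprn_ge0// ltW.
Qed.

Lemma prod_msg_ge (p : pred nat) s : (forall t, 0 < psi th s t) ->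
  (K ^+ deg g 0)^-1 <= \prod_(v <- nbrs g 0 | p v) m v s.
Proof.
move=> pos; rewrite /deg; elim: (nbrs g 0 : seq nat) => [|v r IH]; first by rewrite big_nil invr1.
have K'1 : K^-1 <= 1 by rewrite invf_le1.
have K'0 : 0 <= K^-1 by rewrite invr_ge0 ltW.
rewrite big_cons /= exprS invfM; case: ifP => _.
  by rewrite ler_pM ?invr_ge0 ?exprn_ge0 ?(ltW K0)// msg_sum_ge.
by rewrite (le_trans _ IH)// ler_piMl// invr_ge0 exprn_ge0// ltW.
Qed.

Let perm : exists sp : X, forall s, 0 < psi th s sp.
Proof. by have [_ _ [sp H] _ _] := h1; exists sp. Qed.

Lemma Zo_ge : (K * K ^+ deg g 0)^-1 <= Zo psi psib h g th.
Proof.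
have [sp psp] := perm; have pos t : 0 < psi th sp t by rewrite (psi_sym h1).
rewrite /Zo (bigD1 sp)//= -[leLHS]addr0 lerD//; last first.
  apply: sumr_ge0 => s _; rewrite mulr_ge0 ?(ltW (psib_gt0 h1 _ _))// prodr_ge0// => j _.
  exact: msg_sum_ge0.
rewrite invfM ler_pM ?invr_ge0 ?exprn_ge0 ?(ltW K0)//.
exact: (prod_msg_ge xpredT pos).
Qed.

Lemma Zo_le : Zo psi psib h g th <= #|X|%:R * (K * K ^+ deg g 0).
Proof.
rewrite mulrC mulr_natr -sumr_const; apply: ler_sum => s _.
rewrite /w1 ler_pM ?(ltW (psib_gt0 h1 _ _)) ?prodr_ge0//.
- by move=> j _; exact: msg_sum_ge0.
- exact: (prod_msg_le xpredT s).
Qed.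

(** In the fixed-point equation the numerator at the permissive spin is at least [(K * K ^+ d)^-1]
    and the normaliser at most [#|X| * K * K ^+ d], with [d] the degree of the root. *)
Lemma hrev_perm_ge j sp : g 0%N j -> (forall s, 0 < psi th s sp) ->
  (#|X|%:R * K ^+ 2 * (K ^+ 2) ^+ deg g 0)^-1 <= hrev h (g, j) th sp.
Proof.
move=> gj psp; have pos t : 0 < psi th sp t by rewrite (psi_sym h1).
have [C0 ho] := good_cav h_sum gd gj; rewrite ho.
have cge0 s : 0 <= cav psi psib h g j th s.
  rewrite /cav mulr_ge0 ?(ltW (psib_gt0 h1 _ _))// prodr_ge0// => v _.
  exact: msg_sum_ge0.
have Cgt0 : 0 < \sum_s cav psi psib h g j th s by rewrite lt_neqAle eq_sym C0 sumr_ge0.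
rewrite ler_pdivlMr//.
have Cle : \sum_s cav psi psib h g j th s <= #|X|%:R * (K * K ^+ deg g 0).
  rewrite mulrC mulr_natr -sumr_const; apply: ler_sum => s _.
  rewrite /cav ler_pM ?(ltW (psib_gt0 h1 _ _)) ?prodr_ge0//.
  - by move=> v _; exact: msg_sum_ge0.
  - exact: (prod_msg_le (fun v => v != j) s).
have cge : (K * K ^+ deg g 0)^-1 <= cav psi psib h g j th sp.
  rewrite invfM ler_pM ?invr_ge0 ?exprn_ge0 ?(ltW K0)//.
  exact: (prod_msg_ge (fun v => v != j) pos).
apply: le_trans cge.
rewrite (@le_trans _ _ ((#|X|%:R * K ^+ 2 * (K ^+ 2) ^+ deg g 0)^-1 * (#|X|%:R * (K * K ^+ deg g 0))))//.
  by rewrite ler_wpM2l// invr_ge0 !mulr_ge0 ?exprn_ge0 ?(ltW K0).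
have Xn : #|X|%:R != 0 :> R by rewrite gt_eqF// (lt_le_trans ltr01 X_ge1).
have Kn : K != 0 by rewrite gt_eqF.
have Kd : K ^+ deg g 0 != 0 by rewrite expf_neq0.
rewrite exprAC; move: (K ^+ deg g 0) Kd => k k0; apply: le_of_eq.
by field; rewrite Xn Kn k0.
Qed.

Lemma hrev_ge0 p s : 0 <= hrev h p th s. Proof. exact: h_ge0. Qed.

(** If [psi] is positive, every message sum is at least [K^-1] and the outgoing message has mass
    one. Otherwise only the permissive spin of the root is kept: the bound of [hrev_perm_ge] times
    one more [K^-1] explains the factor [K ^+ 3] in [edge_wt]. *)
Lemma Ze_ge j : g 0%N j -> (edge_wt (deg g 0))^-1 <= Ze psi h (g, j) th.
Proof.
move=> gj; rewrite Ze_hrev /edge_wt; case: pselect => [pos|np] /=.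
  rewrite -[leLHS]mul1r -(hrev_sum h_sum (g, j) th) mulr_suml; apply: ler_sum => s _.
  by rewrite ler_wpM2l ?hrev_ge0// (@msg_sum_ge j s).
have [sp psp] := perm; have pos t : 0 < psi th sp t by rewrite (psi_sym h1).
rewrite (bigD1 sp)//= -[leLHS]addr0 lerD//; last first.
  by apply: sumr_ge0 => s _; rewrite mulr_ge0 ?hrev_ge0// (@msg_sum_ge0 j s).
rewrite (_ : _ * _ * _ = (#|X|%:R * K ^+ 2 * (K ^+ 2) ^+ deg g 0) * K); last by ring.
rewrite invfM ler_pM ?invr_ge0 ?mulr_ge0 ?exprn_ge0 ?exprn_ge0 ?(ltW K0)//.
- exact: hrev_perm_ge.
- exact: (@msg_sum_ge j sp).
Qed.

Lemma Ze_le j : Ze psi h (g, j) th <= K.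
Proof.
rewrite Ze_hrev -[leRHS]mul1r -(hrev_sum h_sum (g, j) th) mulr_suml; apply: ler_sum => s _.
by rewrite ler_wpM2l ?hrev_ge0// (@msg_sum_le j s).
Qed.

Lemma ln_le_self (x : R) : 1 <= x -> 0 <= ln x <= x.
Proof.
by move=> x1; rewrite ln_ge0//= ltW// ln_sublinear// (lt_le_trans ltr01).
Qed.

Lemma norm_ln_le (x y : R) : 1 <= y -> y^-1 <= x -> x <= y -> `|ln x| <= ln y.
Proof.
move=> y1 yx xy; have y0 : 0 < y := lt_le_trans ltr01 y1.
have x0 : 0 < x by rewrite (lt_le_trans _ yx)// invr_gt0.
by rewrite ler_norml -lnV ?posrE// !ler_ln ?posrE ?invr_gt0// yx xy.
Qed.

(** The logarithm is given away by [ln x <= x]: the weight [edge_wt] occurs in the bound on [Gf]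
    anyway. The extra factor [K] makes the same number dominate [Ze] from above. *)
Lemma ln_Ze_le j : g 0%N j -> `|ln (Ze psi h (g, j) th)| <= edge_wt (deg g 0) * K.
Proof.
move=> gj; have w1 := edge_wt_ge1 (deg g 0).
have wK : 1 <= edge_wt (deg g 0) * K by rewrite mulr_ege1.
apply: le_trans (norm_ln_le wK _ _) _.
- rewrite (le_trans _ (Ze_ge gj))// lef_pV2 ?posrE ?(lt_le_trans ltr01)//.
  by rewrite ler_peMr// (le_trans ler01).
- by rewrite (le_trans (Ze_le j))// ler_peMl// ltW.
- by have /andP[] := ln_le_self wK.
Qed.

(** The bounds on [Zo] are exponential in the degree, but the logarithm makes them linear, matching
    the first moment in (H2). *)
Lemma ln_Zo_le : `|ln (Zo psi psib h g th)| <= (#|X|%:R + K) * (1 + (deg g 0)%:R).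
Proof.
have Kd1 : 1 <= K * K ^+ deg g 0 by rewrite mulr_ege1// exprn_ege1.
have y1 : 1 <= #|X|%:R * (K * K ^+ deg g 0) by rewrite mulr_ege1 ?X_ge1.
apply: le_trans (norm_ln_le y1 _ Zo_le) _.
  rewrite (le_trans _ Zo_ge)// lef_pV2 ?posrE ?(lt_le_trans ltr01)//.
  by rewrite ler_peMl ?X_ge1// (le_trans ler01).
have X0 : 0 < #|X|%:R :> R := lt_le_trans ltr01 X_ge1.
rewrite !lnM ?posrE ?mulr_gt0 ?exprn_gt0// lnXn//.
have /andP[lX0 lX] := ln_le_self X_ge1; have /andP[lK0 lK] := ln_le_self K1.
have D0 : 0 <= (deg g 0)%:R :> R by [].
rewrite -[ln K *+ _]mulr_natr; nra.
Qed.

Lemma sum_nbrs_le (F : nat -> R) (c : R) : (forall j, g 0%N j -> F j <= c) ->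
  \sum_(j <- nbrs g 0) F j <= (deg g 0)%:R * c.
Proof.
move=> Fc; have [tg _] := gd.
rewrite (@le_trans _ _ (\sum_(j <- nbrs g 0) c))//.
  rewrite !big_seq; apply: ler_sum => j; rewrite lf_tree_mem_nbrs//; last exact: Vset_root.
  exact: Fc.
by rewrite big_const_seq count_predT iter_addr addr0 mulrC mulr_natr.
Qed.

(** One vertex term and [n] edge terms of size [edge_wt n]: all integrands are dominated by a
    multiple of this weight. *)
Definition dom_wt (n : nat) : R := (1 + n%:R) * edge_wt n.

Lemma dom_wt_ge n : 1 + n%:R <= dom_wt n.
Proof. by rewrite /dom_wt ler_peMr ?edge_wt_ge1// addr_ge0. Qed.

Lemma PhiT_le : `|PhiT psi psib h g th th| <= (#|X|%:R + K + K) * dom_wt (deg g 0).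
Proof.
rewrite PhiTE (le_trans (ler_normB _ _))// mulrDl lerD//.
  rewrite (le_trans ln_Zo_le)// ler_wpM2l ?dom_wt_ge// addr_ge0// ltW//.
rewrite normrM ger0_norm ?invr_ge0//.
rewrite (@le_trans _ _ (1 * ((deg g 0)%:R * (edge_wt (deg g 0) * K))))//.
  rewrite ler_pM ?invr_ge0// ?invf_le1 ?ler1n//.
  rewrite (le_trans (ler_norm_sum _ _ _))//; apply: sum_nbrs_le => j; exact: ln_Ze_le.
have := edge_wt_ge1 (deg g 0); rewrite /dom_wt; move: (edge_wt _) => w w1; rewrite mul1r.
have w0 : 0 <= w * K by rewrite mulr_ge0 ?(ltW K0)// (le_trans ler01).
rewrite (_ : K * _ = w * K + (deg g 0)%:R * (w * K)); last by ring.
by rewrite lerDr.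
Qed.

Lemma norm_edge_avg_le p (f : X -> X -> R) (c : R) : 0 <= c ->
  (forall s t, `|f s t| <= c) -> `|edge_avg psi h p th f| <= c.
Proof.
move=> c0 fc; rewrite /edge_avg /Ze !pair_bigA/=.
apply: (@norm_weighted_avg_le R _ (fun q : X * X => psi th q.1 q.2 * h p th th q.2 * hrev h p th q.1)
  (fun q => f q.1 q.2)) => // q.
apply: mulr_ge0; [apply: mulr_ge0; [exact: (psi_ge0 h1)|exact: h_ge0]|exact: hrev_ge0].
Qed.

Lemma tavg1_le : `|tavg1 psi psib h g th th (dxib psib th)| <= K.
Proof.
apply: norm_weighted_avg_le => [|s|s]; first exact: ltW.
  by rewrite /w1 mulr_ge0 ?(ltW (psib_gt0 h1 _ _))// prodr_ge0// => j _; exact: msg_sum_ge0.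
by case: HK => _ /(_ th thI)[_ _ _ _ []].
Qed.

Lemma tavg2_le j : g 0%N j -> `|tavg2 psi psib h g j th th (dxi psi th)| <= K.
Proof.
move=> gj; rewrite (tavg2E h_sum _ gd gj); apply: norm_edge_avg_le; first exact: ltW.
by case: HK => _ /(_ th thI)[_ _ _ _ []].
Qed.

Lemma sum_tavg2_le :
  `|\sum_(j <- nbrs g 0) tavg2 psi psib h g j th th (dxi psi th)| <= K * dom_wt (deg g 0).
Proof.
rewrite (le_trans (ler_norm_sum _ _ _))// (@le_trans _ _ ((deg g 0)%:R * K))//.
  by apply: sum_nbrs_le => j; exact: tavg2_le.
rewrite mulrC ler_wpM2l ?(ltW K0)// (le_trans _ (dom_wt_ge _))// lerDr//.
Qed.

Lemma tavg1_dom : `|tavg1 psi psib h g th th (dxib psib th)| <= K * dom_wt (deg g 0).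
Proof.
rewrite (le_trans tavg1_le)// ler_peMr ?(ltW K0)// (le_trans _ (dom_wt_ge _))//.
by rewrite lerDl.
Qed.

End AtParameter.

Section Integrability.
Variable mu : probability graphT R.
Hypothesis h2 : H2 psi mu.

Lemma integrable_dom_wt : mu.-integrable setT (fun g => (dom_wt (deg g 0))%:E).
Proof.
have [fD fE] := h2.
have posint (u : nat -> R) : (forall n, 0 <= u n) ->
    (\int[mu]_g (u (deg g 0))%:E < +oo)%E -> mu.-integrable setT (fun g => (u (deg g 0))%:E).
  move=> u0 fu; apply/integrableP; split.
    by apply/measurable_EFinP; exact: measurable_deg.
  apply: le_lt_trans fu; apply: ge0_le_integral => //.
  - by apply: measurableT_comp => //; apply/measurable_EFinP; exact: measurable_deg.
  - by apply/measurable_EFinP; exact: measurable_deg.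
  - by move=> g _; rewrite gee0_abs// lee_fin.
have md (u : nat -> R) : measurable_fun setT (fun g : graphT => (u (deg g 0))%:E).
  by apply/measurable_EFinP; exact: measurable_deg.
rewrite /dom_wt /edge_wt; case: pselect => [pos|np] /=.
  have i1 := posint (fun n => n%:R) (fun n => ler0n _ _) fD.
  have i2 : mu.-integrable setT (fun=> 1%:E) by exact: finite_measure_integrable_cst.
  have := integrableZl measurableT K (integrableD measurableT i2 i1).
  apply: eq_integrable => // g _; rewrite /= -EFinD -EFinM; congr EFin.
  by rewrite mulrC.
(* The exponent comes from [1 + n <= expR n] and [(K ^+ 2) ^+ n = expR (n * ln (K ^+ 2))]. *)
have {}fE := fE np (1 + ln (K ^+ 2)).
have i1 := posint (fun n => expR ((1 + ln (K ^+ 2)) * n%:R)) (fun n => expR_ge0 _) fE.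
apply: (le_integrable measurableT _ _ (integrableZl measurableT (#|X|%:R * K ^+ 3) i1)).
  exact: (md (fun n => (1 + n%:R) * (#|X|%:R * K ^+ 3 * (K ^+ 2) ^+ n))).
move=> g _; rewrite -EFinM !abse_EFin lee_fin.
have w0 : 0 <= #|X|%:R * K ^+ 3 by rewrite mulr_ge0// exprn_ge0// ltW.
have k0 : 0 < K ^+ 2 by rewrite exprn_gt0.
rewrite [leLHS]ger0_norm ?mulr_ge0 ?addr_ge0 ?exprn_ge0 ?(ltW k0) ?(ltW K0)//.
rewrite ger0_norm ?mulr_ge0 ?expR_ge0 ?exprn_ge0 ?(ltW K0)//.
rewrite mulrCA ler_wpM2l// [X in expR X]mulrDl mul1r expRD ler_pM ?addr_ge0 ?exprn_ge0 ?(ltW k0) ?(ltW K0)//.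
  exact: expR_ge1Dx.
by rewrite mulrC expRM_natl lnK ?posrE.
Qed.

End Integrability.

End Bounds.

(** * Almost sure properties of the messages on both directions of an edge *)

Lemma measurable_le_cst (R : realType) (f : graphT -> R) (c : R) :
  measurable_fun setT f -> measurable [set g | f g <= c].
Proof.
move=> mf; rewrite (_ : [set g | _] = f @^-1` `]-oo, c]).
  by rewrite -[X in measurable X]setTI; exact: mf.
by apply/seteqP; split=> g /=; rewrite in_itv.
Qed.

Lemma measurable_eq_fun (R : realType) (f1 f2 : graphT -> R) :
  measurable_fun setT f1 -> measurable_fun setT f2 -> measurable [set g | f1 g = f2 g].
Proof.
move=> m1 m2; rewrite (_ : [set g | _] = (f1 \- f2) @^-1` [set 0]).
  rewrite -[X in measurable X]setTI; apply: measurable_funB => //.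
apply/seteqP; split=> g /= => [->|/eqP]; first by rewrite subrr.
by rewrite subr_eq0 => /eqP.
Qed.

Lemma measurable_forall_fin (X : finType) (Q : X -> graphT -> Prop) :
  (forall s, measurable [set g | Q s g]) -> measurable [set g | forall s, Q s g].
Proof.
move=> mQ; rewrite (_ : [set g | _] = \bigcap_(s in [set: X]) [set g | Q s g]).
  by apply: fin_bigcap_measurable => //; exact: finite_finset.
by apply/seteqP; split=> [g /= h s _|g /= h s]; exact: h.
Qed.

Lemma measurable_forall_nat (Q : nat -> graphT -> Prop) :
  (forall n, measurable [set g | Q n g]) -> measurable [set g | forall n, Q n g].
Proof.
move=> mQ; rewrite (_ : [set g | _] = \bigcap_n [set g | Q n g]).
  exact: bigcapT_measurable.
by apply/seteqP; split=> [g /= h s _|g /= h s]; exact: h.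
Qed.

Lemma measurable_exists_nat (Q : nat -> graphT -> Prop) :
  (forall n, measurable [set g | Q n g]) -> measurable [set g | exists n, Q n g].
Proof.
move=> mQ; rewrite (_ : [set g | _] = \bigcup_n [set g | Q n g]).
  exact: bigcupT_measurable.
by apply/seteqP; split=> [g /= [n h]|g /= [n _ h]]; exists n.
Qed.

Lemma measurable_imply_cst (p : bool) (Q : graphT -> Prop) :
  measurable [set g | Q g] -> measurable [set g | p -> Q g].
Proof.
case: p => mQ; last first.
  by rewrite (_ : [set g | _] = setT) //; apply/seteqP; split.
by rewrite (_ : [set g | _] = [set g | Q g])//; apply/seteqP; split=> g /=; [exact|].
Qed.

(** The continuous functions [x / (x ^+ 2 + 1 / (n + 1))] converge pointwise to the inverse, also at
    [0], where they vanish as [0^-1] does by convention. *)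
Lemma measurable_inv (R : realType) : measurable_fun setT (fun x : R => x^-1).
Proof.
pose a n (x : R) := x / (x ^+ 2 + harmonic n).
have hp n : 0 < harmonic n :> R by rewrite /harmonic/= invr_gt0.
apply: (measurable_fun_cvg (h := a)) => [n|x _].
  apply: continuous_measurable_fun => x; apply: cvgM; first exact: cvg_id.
  apply: cvgV; first by rewrite gt_eqF// ltr_wpDl// sqr_ge0.
  by apply: cvgD; [exact: exprn_continuous|exact: cvg_cst].
have [->|x0] := eqVneq x 0.
  rewrite /a (_ : (fun n => _) = fun=> 0) ?invr0; first exact: cvg_cst.
  by apply/funext => n; rewrite mul0r.
have -> : x^-1 = x * (x ^+ 2 + 0)^-1 by rewrite addr0; field.
apply: cvgM; first exact: cvg_cst.
apply: cvgV; first by rewrite addr0 expf_neq0.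
by apply: cvgD; [exact: cvg_cst|exact: cvg_harmonic].
Qed.

Lemma measurable_invr (R : realType) (f : graphT -> R) : measurable_fun setT f ->
  measurable_fun setT (fun g => (f g)^-1).
Proof. by move=> mf; exact: (measurableT_comp (@measurable_inv R)). Qed.

Section AlmostSure.
Variables (R : realType) (X : finType).
Variables (psi : R -> X -> X -> R) (psib : R -> X -> R).
Variable h : msgT R X.
Hypothesis h_meas : forall b s, measurable_fun setT (fun p => h p b b s).
Hypothesis h_inv : forall b s, dr_invariant (fun p => h p b b s).
Variable mu : probability graphT R.
Hypothesis umu : unimodular mu.
Hypothesis lfmu : {ae mu, forall g, is_lf_tree g}.

Lemma measurable_msg x y b s : measurable_fun setT (fun g : graphT => msg h g x y b b s).
Proof.
exact: (measurableT_comp (measurable_slice (sw y x) (h_meas b s)) (measurable_reroot y)).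
Qed.

Lemma measurable_root_msg x b s : measurable_fun setT (fun g : graphT => h (g, x) b b s).
Proof. exact: measurable_slice (h_meas b s). Qed.

Lemma measurable_BPun x y b s :
  measurable_fun setT (fun g : graphT => BPun psi psib h g x y b b s).
Proof.
apply: measurable_funM => //; apply: (measurable_prod_nbrs x (fun v => v != y)
  (F := fun v g => \sum_(t : X) psi b s t * msg h g v x b b t)) => v.
apply: measurable_sum => t; apply: measurable_funM => //; exact: measurable_msg.
Qed.

Lemma measurable_BP x y b s :
  measurable_fun setT (fun g : graphT => BP psi psib h g x y b b s).
Proof.
apply: measurable_funM; first exact: measurable_BPun.
by apply: measurable_invr; apply: measurable_sum => t; exact: measurable_BPun.
Qed.

Lemma riso_BP g1 g2 phi x b s : riso g1 g2 phi -> edge g1 x ->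
  BP psi psib h g1 x 0 b b s = BP psi psib h g2 (phi x) 0 b b s.
Proof.
move=> iso e; have gx := edge_Vset e.
have E t : BPun psi psib h g1 x 0 b b t = BPun psi psib h g2 (phi x) 0 b b t.
  rewrite /BPun; congr (_ * _); have [p0 _ _ _] := iso.
  have := @riso_big_nbrs _ _ _ g1 g2 phi x 0%N
    (fun v => \sum_(u : X) psi b t u * msg h g2 v (phi x) b b u) iso gx (Vset_root g1).
  rewrite p0 => ->.
  rewrite [LHS]big_seq_cond [RHS]big_seq_cond; apply: eq_bigr => v.
  rewrite mem_nbrs => /andP[/andP[_ gxv] _]; apply: eq_bigr => u _; congr (_ * _).
  rewrite /msg (h_inv b u (riso_reroot iso gx) (x := sw x v)) ?swK//.
  apply: Vset_step (Vset_root _) _; by rewrite /reroot sw0 swK.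
by rewrite /BP E; congr (_ / _); apply: eq_bigr => t _; rewrite E.
Qed.

Lemma BP_reroot g x b s :
  BP psi psib h (reroot g x) x 0 b b s = BP psi psib h g 0 x b b s.
Proof.
have E t : BPun psi psib h (reroot g x) x 0 b b t = BPun psi psib h g 0 x b b t.
  rewrite /BPun; congr (_ * _); rewrite /nbrs.
  have -> : nbr (reroot g x) x = sw x @` nbr g 0.
    apply/seteqP; split=> [y|_ [y gy <-]]; rewrite /nbr/= /reroot sw_root.
      by move=> gy; exists (sw x y) => //; rewrite swK.
    by rewrite swK.
  rewrite big_fset_set_inj; last by move=> u v _ _; exact: inv_inj (swK x) u v.
  apply: eq_big => [v|v _]; first by rewrite sw_eq0.
  apply: eq_bigr => u _; congr (_ * _).
  by rewrite /msg rerootK swK reroot0 sw_id.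
by rewrite /BP E; congr (_ / _); apply: eq_bigr => t _; rewrite E.
Qed.

(** The hypothesis concerns messages towards the root. Unimodularity carries it to the rerooted
    edge, where by [BP_reroot] it becomes the equation for the outgoing message. *)
Lemma ae_good th : isFP psi psib mu h th th -> {ae mu, forall g, good psi psib h g th}.
Proof.
move=> fp.
have := @upae_reroot _ mu umu lfmu (fun g j => forall s, h (g, j) th th s = BP psi psib h g j 0 th th s).
move=> /(_ _ _ fp) H.
have fr := H _ _.
have {H fr} fr : upae mu (fun (g : graphT) x => forall s,
    h (reroot g x, x) th th s = BP psi psib h (reroot g x) x 0 th th s).
  apply: fr.
  - move=> j; apply: measurable_forall_fin => s; apply: measurable_eq_fun.
      exact: measurable_root_msg.
    exact: measurable_BP.
  - move=> g1 g2 phi x iso e; split=> Q s.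
      by rewrite -(h_inv th s iso (edge_Vset e)) Q (riso_BP _ _ iso e).
    by rewrite (h_inv th s iso (edge_Vset e)) Q (riso_BP _ _ iso e).
apply: filterS3 lfmu fp fr => g tg Hin Hout; split => // j gj.
split; first exact: Hin.
by move=> s; rewrite /hrev/= Hout// BP_reroot.
Qed.

Section Regularity.
Variables (t0 t1 : R).
Hypothesis t01 : t0 < t1.
Notation inc := (inc t0 t1).

(* Stated along the countably many partitions, so that it is a measurable event
   and unimodularity transfers it to the reversed edge. *)
Definition tame (C : R) (p : graphT * nat) := forall s,
  (forall N, \sum_(k < N.+1) `|inc (fun th => h p th th s) N k| <= C) /\
  (forall m, exists M, forall N, (M <= N)%N -> forall k, (k <= N)%N ->
     `|inc (fun th => h p th th s) N k| <= m.+1%:R^-1).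

Lemma tame_regular C p : tame C p -> regular h t0 t1 p.
Proof.
move=> tp s; have [bC sm] := tp s; split; last by exists C.
move=> e e0; have [M HM] := sm (Num.Def.archi_bound e^-1).
exists M => N /HM H k /H; move=> /le_trans; apply.
rewrite -[leRHS]invrK lef_pV2 ?posrE ?invr_gt0//.
have e1 : 0 <= e^-1 by rewrite invr_ge0 ltW.
by rewrite (le_trans (ltW (archi_boundP e1)))// ler_nat.
Qed.

Lemma ae_tame C : upae mu (fun (g : graphT) j => forall s,
    {within `[t0, t1], continuous (fun b => h (g, j) b b s)} /\
    (total_variation t0 t1 (fun b => h (g, j) b b s) <= C%:E)%E) ->
  upae mu (fun (g : graphT) j => tame C (g, j) /\ tame C (reroot g j, j)).
Proof.
move=> h3.
have tm : upae mu (fun (g : graphT) j => tame C (g, j)).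
  apply: filterS h3 => g H j /H{}H s; have [c tv] := H s; split.
    exact: sum_inc_total_variation.
  by move=> m; apply: (small_continuous t01 c); rewrite invr_gt0.
have tm' : upae mu (fun (g : graphT) j => tame C (reroot g j, j)).
  apply: (@upae_reroot _ mu umu lfmu (fun g j => tame C (g, j))) => //.
    have mi j s N k : measurable_fun setT (fun g : graphT =>
        `|inc (fun th => h (g, j) th th s) N k|).
      apply: measurableT_comp => //; apply: measurable_funB; exact: measurable_root_msg.
    move=> j; apply: measurable_forall_fin => s; apply: measurableI.
      apply: measurable_forall_nat => N; apply: measurable_le_cst.
      by apply: measurable_sum => k; exact: mi.
    apply: measurable_forall_nat => m; apply: measurable_exists_nat => M.
    apply: measurable_forall_nat => N; apply: measurable_imply_cst.
    apply: measurable_forall_nat => k; apply: measurable_imply_cst.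
    exact: measurable_le_cst.
  move=> g1 g2 phi x iso e.
  have E s : (fun th => h (g1, x) th th s) = (fun th => h (g2, phi x) th th s).
    by apply/funext => th; rewrite (h_inv th s iso (edge_Vset e)).
  by rewrite /tame; split=> H s; have := H s; rewrite E.
by apply: filterS2 tm tm' => g H1 H2 j gj; split; [exact: H1|exact: H2].
Qed.

End Regularity.

End AlmostSure.

(** * Expectation of the expansion *)

Lemma cvg_bigsum_seq (R : realType) (I : eqType) (r : seq I) (p : pred I)
    (f : I -> nat -> R) (l : I -> R) :
  (forall i, i \in r -> f i @ \oo --> l i) ->
  (fun n => \sum_(i <- r | p i) f i n) @ \oo --> \sum_(i <- r | p i) l i.
Proof.
elim: r => [_|i r IH H].
  rewrite big_nil (_ : (fun n => _) = fun=> 0); first exact: cvg_cst.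
  by apply/funext => n; rewrite big_nil.
rewrite big_cons (_ : (fun n => _) = fun n => (if p i then f i n else 0)
    + \sum_(j <- r | p j) f j n); last first.
  by apply/funext => n; rewrite big_cons; case: ifP => //; rewrite add0r.
have := IH (fun j jr => H j (mem_behead (s := i :: r) jr)).
case: ifP => _ c; first by apply: cvgD => //; exact: H (mem_head _ _).
by rewrite -[X in _ --> X]add0r; apply: cvgD => //; exact: cvg_cst.
Qed.

Lemma cvg_bigprod_seq (R : realType) (I : eqType) (r : seq I) (p : pred I)
    (f : I -> nat -> R) (l : I -> R) :
  (forall i, i \in r -> f i @ \oo --> l i) ->
  (fun n => \prod_(i <- r | p i) f i n) @ \oo --> \prod_(i <- r | p i) l i.
Proof.
elim: r => [_|i r IH H].
  rewrite big_nil (_ : (fun n => _) = fun=> 1); first exact: cvg_cst.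
  by apply/funext => n; rewrite big_nil.
rewrite big_cons (_ : (fun n => _) = fun n => (if p i then f i n else 1)
    * \prod_(j <- r | p j) f j n); last first.
  by apply/funext => n; rewrite big_cons; case: ifP => //; rewrite mul1r.
have := IH (fun j jr => H j (mem_behead (s := i :: r) jr)).
case: ifP => _ c; first by apply: cvgM => //; exact: H (mem_head _ _).
by rewrite -[X in _ --> X]mul1r; apply: cvgM => //; exact: cvg_cst.
Qed.

(** Dominated convergence for a constant sequence, used for its integrability conclusion under an
    almost sure bound. *)
Lemma ae_dominated_integrable (R : realType) (mu : probability graphT R)
    (f u : graphT -> R) : measurable_fun setT f ->
  mu.-integrable setT (EFin \o u) -> {ae mu, forall g, `|f g| <= u g} ->
  mu.-integrable setT (EFin \o f).
Proof.
move=> mf iu fu; have mf' : measurable_fun setT (EFin \o f) by exact/measurable_EFinP.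
have [||//] := @dominated_convergence _ _ _ mu setT measurableT (fun _ => EFin \o f)
  (EFin \o f) (EFin \o u) (fun _ => mf') mf' _ iu _.
- by apply: aeW => g _; exact: cvg_cst.
- by apply: filterS fu => g fg _ _; rewrite /= lee_fin.
Qed.

(** * Measurability of the Bethe functional and of its local derivatives *)

Section Measurable.
Variables (R : realType) (X : finType).
Variables (psi : R -> X -> X -> R) (psib : R -> X -> R).
Variable h : msgT R X.
Hypothesis h_meas : forall b s, measurable_fun setT (fun p => h p b b s).

Lemma measurable_w1 b s : measurable_fun setT (fun g : graphT => w1 psi psib h g b b s).
Proof.
apply: measurable_funM => //; apply: (measurable_prod_nbrs 0%N xpredT
  (F := fun v g => \sum_(t : X) psi b s t * h (g, v) b b t)) => v.
apply: measurable_sum => t; apply: measurable_funM => //; exact: measurable_root_msg.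
Qed.

Lemma measurable_w2 j b s t : measurable_fun setT (fun g : graphT => w2 psi psib h g j b b s t).
Proof.
apply: measurable_funM.
  apply: measurable_funM => //; apply: (measurable_prod_nbrs 0%N (fun v => v != j)
    (F := fun v g => \sum_(t : X) psi b s t * h (g, v) b b t)) => v.
  apply: measurable_sum => u; apply: measurable_funM => //; exact: measurable_root_msg.
apply: (measurable_prod_nbrs j (fun v => v != 0%N)
    (F := fun v g => \sum_(u : X) psi b t u * msg h g v j b b u)) => v.
apply: measurable_sum => u; apply: measurable_funM => //; exact: measurable_msg.
Qed.

Lemma measurable_tavg1 b f : measurable_fun setT (fun g : graphT => tavg1 psi psib h g b b f).
Proof.
apply: measurable_funM.
  by apply: measurable_sum => s; apply: measurable_funM => //; exact: measurable_w1.
by apply: measurable_invr; apply: measurable_sum => s; exact: measurable_w1.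
Qed.

Lemma measurable_tavg2 j b f : measurable_fun setT (fun g : graphT => tavg2 psi psib h g j b b f).
Proof.
apply: measurable_funM.
  apply: measurable_sum => s; apply: measurable_sum => t.
  by apply: measurable_funM => //; exact: measurable_w2.
apply: measurable_invr; apply: measurable_sum => s; apply: measurable_sum => t.
exact: measurable_w2.
Qed.

Lemma measurable_sum_tavg2 b f :
  measurable_fun setT (fun g : graphT => \sum_(j <- nbrs g 0) tavg2 psi psib h g j b b f).
Proof.
apply: (measurable_sum_nbrs 0%N xpredT (F := fun j g => tavg2 psi psib h g j b b f)) => j.
exact: measurable_tavg2.
Qed.

Lemma measurable_hrev j b s : measurable_fun setT (fun g : graphT => hrev h (g, j) b s).
Proof. exact: (measurable_msg h_meas 0%N j). Qed.

Lemma measurable_Ze j b : measurable_fun setT (fun g : graphT => Ze psi h (g, j) b).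
Proof.
apply: measurable_sum => s; apply: measurable_sum => t; apply: measurable_funM.
  by apply: measurable_funM => //; exact: measurable_root_msg.
exact: measurable_hrev.
Qed.

Lemma measurable_PhiT b : measurable_fun setT (fun g : graphT => PhiT psi psib h g b b).
Proof.
apply: measurable_funB.
  apply: measurableT_comp; first exact: measurable_ln.
  by apply: measurable_sum => s; exact: measurable_w1.
apply: measurable_funM => //.
apply: (measurable_sum_nbrs 0%N xpredT (F := fun j g => ln (Ze psi h (g, j) b))) => j.
by apply: measurableT_comp; [exact: measurable_ln|exact: measurable_Ze].
Qed.

Lemma measurable_Gf t0 t1 N k j :
  measurable_fun setT (fun g : graphT => Gf psi h t0 t1 N k (g, j)).
Proof.
apply: measurable_funM; last by apply: measurable_invr; exact: measurable_Ze.
apply: measurable_sum => s; apply: measurable_sum => t; apply: measurable_funM.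
  by apply: measurable_funM => //; apply: measurable_funB; exact: measurable_root_msg.
exact: measurable_hrev.
Qed.

End Measurable.

Section Expectation.
Variables (R : realType) (X : finType).
Variables (psi : R -> X -> X -> R) (psib : R -> X -> R).
Hypothesis h1 : H1 psi psib.
Variable h : msgT R X.
Hypothesis h_ge0 : forall p b s, 0 <= h p b b s.
Hypothesis h_sum : forall p b, \sum_(s : X) h p b b s = 1.
Hypothesis h_meas : forall b s, measurable_fun setT (fun p => h p b b s).
Hypothesis h_inv : forall b s, dr_invariant (fun p => h p b b s).
Variable mu : probability graphT R.
Hypothesis umu : unimodular mu.
Hypothesis lfmu : {ae mu, forall g, is_lf_tree g}.
Hypothesis h2 : H2 psi mu.
Variables (t0 t1 : R).
Hypothesis t01 : t0 < t1.
Hypothesis fp : forall b, t0 <= b <= t1 -> isFP psi psib mu h b b.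
Variable C : R.
Hypothesis C0 : 0 <= C.
Hypothesis h3 : upae mu (fun (g : graphT) j => forall s,
    {within `[t0, t1], continuous (fun b => h (g, j) b b s)} /\
    (total_variation t0 t1 (fun b => h (g, j) b b s) <= C%:E)%E).
Variable K : R.
Hypothesis HK : spec_bound psi psib t0 t1 K.
Notation pt := (pt t0 t1).
Notation mesh := (mesh t0 t1).
Notation Gf := (Gf psi h t0 t1).
Notation Aloc := (Aloc psi psib h).
Notation dom g := (dom_wt psi K (deg g 0)).

Let K1 : 1 <= K. Proof. by case: HK. Qed.
Let K0 : 0 < K. Proof. exact: lt_le_trans ltr01 K1. Qed.

Lemma integrable_cdom (c : R) : mu.-integrable setT (fun g => (c * dom g)%:E).
Proof.
by apply: eq_integrable (integrableZl measurableT c (integrable_dom_wt HK h2)).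
Qed.

Definition alpha th : R := fine (\int[mu]_g (Aloc g th)%:E).

Lemma measurable_Aloc th : measurable_fun setT (fun g : graphT => Aloc g th).
Proof.
apply: measurable_funD; first exact: measurable_tavg1.
by apply: measurable_funM => //; exact: measurable_sum_tavg2.
Qed.

Lemma integrable_tavg1 th : t0 <= th <= t1 ->
  mu.-integrable setT (fun g => (tavg1 psi psib h g th th (dxib psib th))%:E).
Proof.
move=> thI; apply: (ae_dominated_integrable (u := fun g => K * dom g)).
- exact: measurable_tavg1.
- exact: integrable_cdom.
by apply: aeW => g; exact: (tavg1_dom h1 h_ge0 HK g thI).
Qed.

Lemma integrable_sum_tavg2 th : t0 <= th <= t1 ->
  mu.-integrable setT (fun g => (\sum_(j <- nbrs g 0) tavg2 psi psib h g j th th (dxi psi th))%:E).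
Proof.
move=> thI; apply: (ae_dominated_integrable (u := fun g => K * dom g)).
- exact: measurable_sum_tavg2.
- exact: integrable_cdom.
apply: filterS (ae_good h_meas h_inv umu lfmu (fp thI)) => g gd.
exact: (sum_tavg2_le h1 h_ge0 h_sum HK thI gd).
Qed.

Lemma integrable_Aloc th : t0 <= th <= t1 -> mu.-integrable setT (fun g => (Aloc g th)%:E).
Proof.
move=> thI; have i1 := integrable_tavg1 thI.
have i2 := integrableZl measurableT 2^-1 (integrable_sum_tavg2 thI).
by apply: eq_integrable (integrableD measurableT i1 i2).
Qed.

Lemma integral_Aloc th : t0 <= th <= t1 ->
  (\int[mu]_g (Aloc g th)%:E = avx_lim psi psib mu h th th + ae_lim psi psib mu h th th)%E.
Proof.
move=> thI; have i1 := integrable_tavg1 thI; have i2 := integrable_sum_tavg2 thI.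
transitivity (\int[mu]_g ((tavg1 psi psib h g th th (dxib psib th))%:E
  + (2^-1)%:E * (\sum_(j <- nbrs g 0) tavg2 psi psib h g j th th (dxi psi th))%:E))%E.
  by apply: eq_integral.
rewrite integralD//; last exact: (integrableZl measurableT 2^-1 i2).
by rewrite integralZl.
Qed.

Lemma alphaE th : t0 <= th <= t1 ->
  ((alpha th)%:E = avx_lim psi psib mu h th th + ae_lim psi psib mu h th th)%E.
Proof.
move=> thI; rewrite -integral_Aloc// /alpha fineK//.
exact: integrable_fin_num (integrable_Aloc thI).
Qed.

Lemma integrable_PhiT th : t0 <= th <= t1 ->
  mu.-integrable setT (fun g => (PhiT psi psib h g th th)%:E).
Proof.
move=> thI; apply: (ae_dominated_integrable (u := fun g => (#|X|%:R + K + K) * dom g)).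
- exact: measurable_PhiT.
- exact: integrable_cdom.
apply: filterS (ae_good h_meas h_inv umu lfmu (fp thI)) => g gd.
exact: (PhiT_le h1 h_ge0 h_sum HK thI gd).
Qed.

(** Only nodes of uniform partitions are involved: they are countably many, so the exceptional null
    sets add up to a null set. *)
Definition regular_tree (g : graphT) := [/\ is_lf_tree g,
  forall N k, (k <= N.+1)%N -> good psi psib h g (pt N k) &
  forall j, g 0%N j -> tame h t0 t1 C (g, j) /\ tame h t0 t1 C (reroot g j, j)].

Lemma ae_regular_tree : {ae mu, forall g, regular_tree g}.
Proof.
have gd : {ae mu, forall g, forall N k, (k <= N.+1)%N -> good psi psib h g (pt N k)}.
  apply: ae_foralln => N; apply: ae_foralln => k.
  have [kN|kN] := leqP k N.+1; last by apply: aeW => g.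
  by apply: filterS (ae_good h_meas h_inv umu lfmu (fp (pt_mem t01 kN))).
by apply: filterS3 lfmu gd (ae_tame h_meas h_inv umu lfmu t01 h3).
Qed.

(** The pair [p] is kept apart from [g] so that the weight at the degree of [g] serves both
    orientations of a root edge, [Ze] being the same from either end. *)
Lemma Gf_le g N k p : (k <= N)%N -> (edge_wt psi K (deg g 0))^-1 <= Ze psi h p (pt N k) ->
  `|Gf N k p| <= K * edge_wt psi K (deg g 0) *
    \sum_(t : X) `|h p (pt N k.+1) (pt N k.+1) t - h p (pt N k) (pt N k) t|.
Proof.
move=> kN Zw; have w0 : 0 < edge_wt psi K (deg g 0).
  by rewrite (lt_le_trans ltr01)//; exact: (edge_wt_ge1 h1 HK).
have Z0 : 0 < Ze psi h p (pt N k) by rewrite (lt_le_trans _ Zw)// invr_gt0.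
have thI := pt_mem t01 (leqW kN).
rewrite normrM normfV (gtr0_norm Z0) mulrAC; apply: ler_pM => //.
- by rewrite invr_ge0 ltW.
- rewrite (le_trans (ler_norm_sum _ _ _))//.
  rewrite -[leRHS]mul1r -(hrev_sum h_sum p (pt N k)) mulr_suml; apply: ler_sum => s _.
  rewrite (le_trans (ler_norm_sum _ _ _))// mulr_sumr mulr_sumr; apply: ler_sum => t _.
  have e1 : `|hrev h p (pt N k) s| = hrev h p (pt N k) s := ger0_norm (h_ge0 _ _ _).
  rewrite !normrM e1 mulrC ler_wpM2l ?h_ge0// ler_wpM2r// ger0_norm ?(psi_ge0 h1)//.
  by case: HK => _ /(_ _ thI)[].
- by rewrite -[leRHS]invrK lef_pV2 ?posrE ?invr_gt0.
Qed.

Lemma sum_tame p N : tame h t0 t1 C p -> \sum_(k < N.+1) \sum_(t : X)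
   `|h p (pt N k.+1) (pt N k.+1) t - h p (pt N k) (pt N k) t| <= #|X|%:R * C.
Proof.
move=> tp; rewrite exchange_big/= mulrC mulr_natr -sumr_const; apply: ler_sum => t _.
by have [H _] := tp t; exact: H.
Qed.

Lemma regular_Ze g N k j : regular_tree g -> (k <= N.+1)%N -> g 0%N j ->
  (edge_wt psi K (deg g 0))^-1 <= Ze psi h (g, j) (pt N k).
Proof.
move=> [_ gd _] kN gj.
exact: (Ze_ge h1 h_ge0 h_sum HK (pt_mem t01 kN) (gd N k kN) gj).
Qed.

(** Summed over the cells, the increments of each message coordinate are at most its variation bound
    [C]; the factor 2 counts the orientations. The bound is uniform in [N]. *)
Lemma sum_Gf_le g N j : regular_tree g -> g 0%N j ->
  \sum_(k < N.+1) (`|Gf N k (g, j)| + `|Gf N k (reroot g j, j)|)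
    <= 2 * (K * edge_wt psi K (deg g 0) * (#|X|%:R * C)).
Proof.
move=> rg gj; have [_ _ /(_ j gj)[tm1 tm2]] := rg.
have w0 : 0 <= K * edge_wt psi K (deg g 0).
  by rewrite mulr_ge0 ?(ltW K0)// (le_trans ler01)//; exact: (edge_wt_ge1 h1 HK).
rewrite big_split/= mulr2n mulrDl mul1r; apply: lerD.
  apply: le_trans (ler_wpM2l w0 (sum_tame N tm1)); rewrite mulr_sumr.
  apply: ler_sum => k _; have kN : (k <= N)%N by rewrite -ltnS.
  by apply: Gf_le => //; apply: regular_Ze => //; exact: leqW.
apply: le_trans (ler_wpM2l w0 (sum_tame N tm2)); rewrite mulr_sumr.
apply: ler_sum => k _; have kN : (k <= N)%N by rewrite -ltnS.
by apply: Gf_le => //; rewrite (Ze_sym h1); apply: regular_Ze => //; exact: leqW.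
Qed.

Let cG := K * (#|X|%:R * C).

Let cG0 : 0 <= cG. Proof. by rewrite !mulr_ge0// ltW. Qed.

Lemma dom_cG g : (deg g 0)%:R * (K * edge_wt psi K (deg g 0) * (#|X|%:R * C)) <= cG * dom g.
Proof.
have := edge_wt_ge1 h1 HK (deg g 0).
rewrite /cG /dom_wt; move: (edge_wt _ _ _) => w w1.
have -> : K * (#|X|%:R * C) * ((1 + (deg g 0)%:R) * w) =
  K * (#|X|%:R * C) * w + (deg g 0)%:R * (K * w * (#|X|%:R * C)) by ring.
by rewrite lerDr mulr_ge0// (le_trans ler01).
Qed.

Lemma sum_nbrs_Gf_le g N : regular_tree g ->
  \sum_(j <- nbrs g 0) \sum_(k < N.+1) (`|Gf N k (g, j)| + `|Gf N k (reroot g j, j)|)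
    <= 2 * (cG * dom g).
Proof.
move=> rg; have [_ /(_ 0%N 0%N isT) gd _] := rg.
apply: le_trans (sum_nbrs_le gd (fun j gj => sum_Gf_le N rg gj)) _.
by rewrite mulrCA ler_wpM2l// dom_cG.
Qed.

(** The function [u] covers at once the difference of the two orientations, the absolute value of
    one, and each of them alone. *)
Lemma integrable_Gf N k : (k <= N)%N -> forall u : R -> R -> R,
  (forall x y, `|u x y| <= `|x| + `|y|) ->
  (measurable_fun setT (fun g => \sum_(j <- nbrs g 0) u (Gf N k (g, j)) (Gf N k (reroot g j, j)))) ->
  mu.-integrable setT (fun g =>
    (\sum_(j <- nbrs g 0) u (Gf N k (g, j)) (Gf N k (reroot g j, j)))%:E).
Proof.
move=> kN u uxy mu_; apply: (ae_dominated_integrable (u := fun g => (2 * cG) * dom g)) => //.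
  exact: integrable_cdom.
apply: filterS ae_regular_tree => g rg; rewrite -mulrA.
apply: le_trans (sum_nbrs_Gf_le N rg); rewrite (le_trans (ler_norm_sum _ _ _))//.
apply: ler_sum => j _; apply: le_trans (uxy _ _) _.
have kN' : (k < N.+1)%N by [].
by rewrite (bigD1 (Ordinal kN'))//= lerDl sumr_ge0// => i _; rewrite addr_ge0.
Qed.

Lemma Gf_invariant N k : edge_invariant (Gf N k).
Proof.
move=> g1 g2 phi x iso e; have gx := edge_Vset e.
have hE b s : h (g1, x) b b s = h (g2, phi x) b b s := h_inv b s iso gx.
have rE b s : hrev h (g1, x) b s = hrev h (g2, phi x) b s.
  rewrite /hrev/= (h_inv b s (riso_reroot iso gx) (x := x)).
    by rewrite sw_root; have [-> _ _ _] := iso; rewrite sw0.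
  by apply: Vset_step (Vset_root _) _; rewrite /reroot sw0 sw_root; case/andP: e.
rewrite /Gf /Ze; congr (_ / _); apply: eq_bigr => s _; apply: eq_bigr => t _.
  by rewrite !hE rE.
by rewrite !hE rE.
Qed.

Let measG N k j : measurable_fun setT (fun g : graphT => Gf N k (g, j)).
Proof. exact: measurable_Gf. Qed.

Let measGr N k j : measurable_fun setT (fun g : graphT => Gf N k (reroot g j, j)).
Proof. exact: (measurableT_comp (measG N k j) (measurable_reroot j)). Qed.

Lemma integrable_Gf_diff N k : (k <= N)%N -> mu.-integrable setT (fun g =>
  (\sum_(j <- nbrs g 0) (Gf N k (g, j) - Gf N k (reroot g j, j)))%:E).
Proof.
move=> kN; apply: (integrable_Gf kN (u := fun x y => x - y)).
  by move=> x y; exact: ler_normB.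
apply: (measurable_sum_nbrs 0%N xpredT (F := fun j g => Gf N k (g, j) - Gf N k (reroot g j, j))) => j.
exact: measurable_funB.
Qed.

Lemma integral_Gf N k : (k <= N)%N ->
  (\int[mu]_g (\sum_(j <- nbrs g 0) (Gf N k (g, j) - Gf N k (reroot g j, j)))%:E = 0)%E.
Proof.
move=> kN; apply: unimodular_sum => //.
- exact: Gf_invariant.
- apply: (integrable_Gf kN (u := fun x y => `|x|)).
    by move=> x y; rewrite normr_id lerDl.
  apply: (measurable_sum_nbrs 0%N xpredT (F := fun j g => `|Gf N k (g, j)|)) => j.
  exact: measurableT_comp.
- apply: (integrable_Gf kN (u := fun x y => x)).
    by move=> x y; rewrite lerDl.
  exact: (measurable_sum_nbrs 0%N xpredT (F := fun j g => Gf N k (g, j))).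
- apply: (integrable_Gf kN (u := fun x y => y)).
    by move=> x y; rewrite lerDr.
  exact: (measurable_sum_nbrs 0%N xpredT (F := fun j g => Gf N k (reroot g j, j))).
Qed.

Definition Dstep N k g := mesh N * Aloc g (pt N k) +
  2^-1 * \sum_(j <- nbrs g 0) (Gf N k (g, j) - Gf N k (reroot g j, j)).

Lemma integrable_Dstep N k : (k <= N)%N -> mu.-integrable setT (fun g => (Dstep N k g)%:E).
Proof.
move=> kN; have i1 := integrableZl measurableT (mesh N) (integrable_Aloc (pt_mem t01 (leqW kN))).
have i2 := integrableZl measurableT 2^-1 (integrable_Gf_diff kN).
by apply: eq_integrable (integrableD measurableT i1 i2).
Qed.

Lemma integral_Dstep N k : (k <= N)%N ->
  (\int[mu]_g (Dstep N k g)%:E = (mesh N * alpha (pt N k))%:E)%E.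
Proof.
move=> kN; have iA := integrable_Aloc (pt_mem t01 (leqW kN)).
have iG := integrable_Gf_diff kN.
transitivity (\int[mu]_g ((mesh N)%:E * (Aloc g (pt N k))%:E + (2^-1)%:E *
  (\sum_(j <- nbrs g 0) (Gf N k (g, j) - Gf N k (reroot g j, j)))%:E))%E.
  by apply: eq_integral.
rewrite integralD//; last 2 first.
- exact: (integrableZl measurableT (mesh N) iA).
- exact: (integrableZl measurableT 2^-1 iG).
rewrite !integralZl// integral_Gf// mule0 adde0 [RHS]EFinM /alpha fineK//.
exact: integrable_fin_num iA.
Qed.

Lemma sum_Dstep_le g N : regular_tree g ->
  `|\sum_(k < N.+1) Dstep N k g| <= ((t1 - t0) * (K + K) + cG) * dom g.
Proof.
move=> rg; have [_ gd _] := rg.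
rewrite /Dstep big_split/= mulrDl (le_trans (ler_normD _ _))// lerD//.
  rewrite (le_trans (ler_norm_sum _ _ _))// -(sum_mesh t0 t1 N) -mulrA mulr_suml.
  apply: ler_sum => k _; have kN : (k <= N.+1)%N by rewrite ltnW// ltnS ltnW.
  rewrite normrM ger0_norm ?mesh_ge0// ler_wpM2l ?mesh_ge0//.
  have thI := pt_mem t01 kN; rewrite /Aloc mulrDl (le_trans (ler_normD _ _))// lerD//.
    exact: (tavg1_dom h1 h_ge0 HK g thI).
  rewrite normrM ger0_norm// (le_trans _ (sum_tavg2_le h1 h_ge0 h_sum HK thI (gd N k kN)))//.
  by rewrite ler_piMl// invf_le1// ler1n.
rewrite -mulr_sumr normrM ger0_norm// exchange_big/=.
rewrite -[leRHS](mulKf (_ : 2 != 0 :> R))// ler_wpM2l//.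
apply: le_trans (sum_nbrs_Gf_le N rg); rewrite (le_trans (ler_norm_sum _ _ _))//.
apply: ler_sum => j _; rewrite (le_trans (ler_norm_sum _ _ _))//.
by apply: ler_sum => k _; exact: ler_normB.
Qed.

Lemma integrable_bigsum (I : Type) (r : seq I) (f : I -> graphT -> R) :
  (forall i, mu.-integrable setT (EFin \o f i)) ->
  mu.-integrable setT (fun g => (\sum_(i <- r) f i g)%:E) /\
  (\int[mu]_g (\sum_(i <- r) f i g)%:E = \sum_(i <- r) \int[mu]_g (f i g)%:E)%E.
Proof.
move=> fi; elim: r => [|i r [IH1 IH2]].
  split.
    apply: eq_integrable (@integrable0 _ _ _ mu setT) => // g _.
    by rewrite big_nil.
  by under eq_integral do rewrite big_nil; rewrite big_nil integral0.
split.
  apply: eq_integrable (integrableD measurableT (fi i) IH1) => // g _.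
  by rewrite big_cons EFinD.
under eq_integral do rewrite big_cons EFinD.
by rewrite [RHS]big_cons -IH2 integralD//; exact: fi.
Qed.

(** The mean of the remainder [F N] is the Bethe increment minus the Riemann sum, because each
    [Dstep] integrates to [mesh * alpha]; dominated convergence sends it to zero. *)
Lemma Phimu_riemann : (fun N => \sum_(k < N.+1) alpha (pt N k) * mesh N) @ \oo -->
  fine (Phimu psi psib mu h t1 t1) - fine (Phimu psi psib mu h t0 t0).
Proof.
have I0 : t0 <= t0 <= t1 by rewrite lexx ltW.
have I1 : t0 <= t1 <= t1 by rewrite lexx ltW.
have iP0 := integrable_PhiT I0; have iP1 := integrable_PhiT I1.
pose D N g := \sum_(k < N.+1) Dstep N k g.
pose F N g := PhiT psi psib h g t1 t1 - PhiT psi psib h g t0 t0 - D N g.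
have iD N : mu.-integrable setT (fun g => (D N g)%:E) /\
   (\int[mu]_g (D N g)%:E = (\sum_(k < N.+1) alpha (pt N k) * mesh N)%:E)%E.
  have H (k : 'I_N.+1) : mu.-integrable setT (EFin \o Dstep N k).
    by apply: integrable_Dstep; rewrite -ltnS.
  have [i1 i2] := integrable_bigsum (index_enum 'I_N.+1) H; split; first exact: i1.
  rewrite i2 -sumEFin; apply: eq_bigr => k _.
  have kN : (k <= N)%N by rewrite -ltnS.
  by rewrite (integral_Dstep kN); congr EFin; exact: mulrC.
have mF N : measurable_fun setT (EFin \o F N).
  have /integrableP[m1 _] := iP1; have /integrableP[m0 _] := iP0.
  have /integrableP[mD _] := (iD N).1.
  apply/measurable_EFinP; apply: measurable_funB; last exact/measurable_EFinP.
  by apply: measurable_funB; exact/measurable_EFinP.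
have FE N : (\int[mu]_g (F N g)%:E = (fine (Phimu psi psib mu h t1 t1)
   - fine (Phimu psi psib mu h t0 t0) - \sum_(k < N.+1) alpha (pt N k) * mesh N)%:E)%E.
  under eq_integral do rewrite /F !EFinB.
  rewrite integralB//; last 2 first.
  - exact: integrableB.
  - exact: (iD N).1.
  rewrite integralB// (iD N).2 !EFinB /Phimu !fineK//.
  - exact: (integrable_fin_num _ iP0).
  - exact: (integrable_fin_num _ iP1).
(* The first summand pays for [PhiT] at the two endpoints, the second for the sum of the [Dstep]. *)
pose M := 2 * (#|X|%:R + K + K) + ((t1 - t0) * (K + K) + cG).
have [|| _ _] := @dominated_convergence _ _ _ mu setT measurableT (fun N => EFin \o F N)
  (fun=> 0%E) (fun g => (M * dom g)%:E) mF (measurable_cst _) _ (integrable_cdom M) _.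
- apply: filterS ae_regular_tree => g rg _; have [tg gd tm] := rg.
  (* The lower bound on [Zo] and [Ze] may depend on the tree, since the expansion is used pointwise
     in [g]. *)
  pose c := Num.min (K * K ^+ deg g 0)^-1 (edge_wt psi K (deg g 0))^-1.
  have w1 := edge_wt_ge1 h1 HK (deg g 0).
  have c0 : 0 < c.
    by rewrite /c lt_min !invr_gt0 mulr_gt0 ?exprn_gt0//= (lt_le_trans ltr01).
  have lp : lin t0 t1 (fun th => PhiT psi psib h g th th) (fun N k => Dstep N k g).
    apply: (lin_PhiT h1 h_sum t01 c0 tg gd) => [N k kN|N k j gj kN|j gj].
    - rewrite /c ge_min; apply/orP; left.
      exact: (Zo_ge h1 h_ge0 h_sum HK g (pt_mem t01 kN)).
    - by rewrite /c ge_min; apply/orP; right; exact: regular_Ze.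
    - by have [tm1 tm2] := tm j gj; split; exact: tame_regular.
  apply/fine_cvgP; split; first exact: nearW.
  apply: nul_cvg; apply: nul_le lp => N.
  rewrite [leRHS]ger0_norm ?sumr_ge0// /F /D /=.
  rewrite -(sum_inc t0 t1 (fun th => PhiT psi psib h g th th) N) -sumrB.
  exact: ler_norm_sum.
- apply: filterS ae_regular_tree => g rg N _.
  rewrite /= lee_fin /F /M mulrDl (le_trans (ler_normB _ _))// lerD//.
    have [_ gd _] := rg.
    have := gd 0%N 0%N isT; rewrite pt0 => /(PhiT_le h1 h_ge0 h_sum HK I0) b0.
    have := gd 0%N 1%N isT; rewrite (pt_last t0 t1 0) => /(PhiT_le h1 h_ge0 h_sum HK I1) b1.
    rewrite (le_trans (ler_normB _ _))// mulr2n !mulrDl mul1r -!mulrDl.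
    by rewrite [leRHS]mulrDl; exact: lerD.
  exact: sum_Dstep_le.
rewrite integral0 => /fine_cvg H.
rewrite (_ : (fun N => _) = (fun N => (fine (Phimu psi psib mu h t1 t1)
   - fine (Phimu psi psib mu h t0 t0)) - fine (\int[mu]_g (F N g)%:E))); last first.
  by apply/funext => N; rewrite FE/=; ring.
rewrite -[X in _ --> X]subr0; apply: cvgB; [exact: cvg_cst|exact: H].
Qed.

(** Rewrites the edge averages with incoming messages only. Continuity in the parameter is given for
    these, whereas for the reversed edge only the behaviour along partitions was transferred. *)
Lemma Aloc_vertex g th : good psi psib h g th -> Aloc g th =
  (\sum_s dxib psib th s * w1 psi psib h g th th s) / Zo psi psib h g th
  + 2^-1 * \sum_(j <- nbrs g 0) (\sum_s cav psi psib h g j th s *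
      \sum_t dxi psi th s t * (psi th s t * h (g, j) th th t)) / Zo psi psib h g th.
Proof.
move=> gd; have [tg _] := gd; rewrite /Aloc; congr (_ + _ * _).
rewrite !big_seq; apply: eq_bigr => j jn.
have gj : g 0%N j by rewrite -(lf_tree_mem_nbrs j tg (Vset_root g)).
rewrite (cav_avg h_sum _ gd gj) (tavg2E h_sum _ gd gj) /edge_avg; congr (_ / _).
by apply: eq_bigr => s _; rewrite mulr_sumr; apply: eq_bigr => t _; ring.
Qed.

Lemma Aloc_cvg g (y : nat -> R) x : t0 <= x <= t1 -> good psi psib h g x ->
  (forall n, good psi psib h g (y n)) -> y @ \oo --> x ->
  (forall j t, g 0%N j -> (fun n => h (g, j) (y n) (y n) t) @ \oo --> h (g, j) x x t) ->
  (fun n => Aloc g (y n)) @ \oo --> Aloc g x.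
Proof.
move=> xI gx gy yx hy; rewrite Aloc_vertex//.
rewrite (_ : (fun n => Aloc g (y n)) = (fun n => (\sum_s dxib psib (y n) s * w1 psi psib h g (y n) (y n) s) / Zo psi psib h g (y n)
  + 2^-1 * \sum_(j <- nbrs g 0) (\sum_s cav psi psib h g j (y n) s *
      \sum_t dxi psi (y n) s t * (psi (y n) s t * h (g, j) (y n) (y n) t)) / Zo psi psib h g (y n))); last first.
  by apply/funext => n; rewrite Aloc_vertex.
have [tg _] := gx.
have nb j : j \in nbrs g 0 -> g 0%N j by rewrite lf_tree_mem_nbrs//; exact: Vset_root.
have cc (u : R -> R) : continuous u -> (fun n => u (y n)) @ \oo --> u x.
  by move=> cu; exact: (cvg_comp _ _ yx (cu x)).
have cm j s : j \in nbrs g 0 -> (fun n => \sum_t psi (y n) s t * h (g, j) (y n) (y n) t) @ \oo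
    --> \sum_t psi x s t * h (g, j) x x t.
  move=> /nb gj; apply: cvg_bigsum_seq => t _; apply: cvgM; last exact: hy.
  exact: (cc _ (psi_continuous h1 (s := s) (t := t))).
have cw s : (fun n => w1 psi psib h g (y n) (y n) s) @ \oo --> w1 psi psib h g x x s.
  apply: cvgM; first exact: (cc _ (psib_continuous h1 (s := s))).
  by apply: cvg_bigprod_seq => j jn; exact: cm.
have cZ : (fun n => (Zo psi psib h g (y n))^-1) @ \oo --> (Zo psi psib h g x)^-1.
  apply: cvgV; last by apply: cvg_bigsum_seq => s _; exact: cw.
  rewrite gt_eqF// (lt_le_trans _ (Zo_ge h1 h_ge0 h_sum HK g xI))//.
  by rewrite invr_gt0 mulr_gt0// exprn_gt0.
apply: cvgD.
  apply: cvgM => //; apply: cvg_bigsum_seq => s _; apply: cvgM; last exact: cw.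
  exact: (cc _ (dxib_continuous h1 (s := s))).
apply: cvgM; first exact: cvg_cst.
apply: cvg_bigsum_seq => j jn; apply: cvgM => //.
apply: cvg_bigsum_seq => s _; apply: cvgM.
  apply: cvgM; first exact: (cc _ (psib_continuous h1 (s := s))).
  by apply: cvg_bigprod_seq => v vn; exact: cm.
apply: cvg_bigsum_seq => t _; apply: cvgM.
  exact: (cc _ (dxi_continuous h1 (s := s) (t := t))).
apply: cvgM; last by apply: hy; exact: nb.
exact: (cc _ (psi_continuous h1 (s := s) (t := t))).
Qed.

(** Sequences keep the number of exceptional null sets countable; the bound by [dom_wt] is uniform
    over the segment. *)
Lemma alpha_cvg (y : nat -> R) x : t0 <= x <= t1 -> (forall n, t0 <= y n <= t1) ->
  y @ \oo --> x -> (fun n => alpha (y n)) @ \oo --> alpha x.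
Proof.
move=> xI yI yx.
have gy : {ae mu, forall g, forall n, good psi psib h g (y n)}.
  by apply: ae_foralln => n; exact: (ae_good h_meas h_inv umu lfmu (fp (yI n))).
have gx := ae_good h_meas h_inv umu lfmu (fp xI).
have [|| _ _] := @dominated_convergence _ _ _ mu setT measurableT (fun n g => (Aloc g (y n))%:E)
  (fun g => (Aloc g x)%:E) (fun g => ((K + K) * dom g)%:E)
  (fun n => (measurable_EFinP _ _).2 (measurable_Aloc (y n)))
  ((measurable_EFinP _ _).2 (measurable_Aloc x)) _ (integrable_cdom _) _.
- apply: filterS3 gy gx h3 => g gdy gdx hc _.
  apply/fine_cvgP; split; first exact: nearW.
  apply: Aloc_cvg => // j t gj; have [ct _] := hc j gj t.
  have /subspace_continuousP/(_ x) := ct; rewrite /= in_itv/= => /(_ xI) cx.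
  apply: (cvg_comp _ _ _ cx) => A /= [e e0 Ae].
  have /cvgrPdist_lt/(_ e e0) := yx; apply: filterS => n /Ae; apply.
  by rewrite /= in_itv/=; exact: yI.
- apply: filterS gy => g gdy n _; rewrite lee_fin /Aloc mulrDl.
  rewrite (le_trans (ler_normD _ _))// lerD//; first exact: (tavg1_dom h1 h_ge0 HK g (yI n)).
  rewrite normrM ger0_norm// (le_trans _ (sum_tavg2_le h1 h_ge0 h_sum HK (yI n) (gdy n)))//.
  by rewrite ler_piMl// invf_le1// ler1n.
move=> H; apply: (@fine_cvg _ _ _ _ (fun n => \int[mu]_g (Aloc g (y n))%:E)%E).
rewrite /alpha fineK//; exact: (integrable_fin_num _ (integrable_Aloc xI)).
Qed.

Lemma alpha_continuous : {within `[t0, t1], continuous alpha}.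
Proof.
apply/subspace_continuousP => x; rewrite /= in_itv/= => xI.
apply/cvgrPdist_le => e e0; apply: contrapT => nc.
(* A failure of continuity at [x] yields a sequence converging to [x] along which [alpha] stays away
   from its value there. *)
have H n : exists y, [/\ t0 <= y <= t1, `|x - y| < n.+1%:R^-1 & e < `|alpha x - alpha y| ].
  apply: contrapT => ny; apply: nc; exists n.+1%:R^-1 => /=; first by rewrite invr_gt0.
  move=> y /= xy; rewrite in_itv/= => yI; rewrite leNgt; apply/negP => ey.
  by apply: ny; exists y.
have [y Hy] := choice H.
have yx : y @ \oo --> x.
  apply/cvgrPdist_le => d d0; have d'0 : 0 <= d^-1 by rewrite invr_ge0 ltW.
  exists (Num.Def.archi_bound d^-1) => // n /= dn.
  have [_ /ltW yn _] := Hy n; rewrite (le_trans yn)//.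
  rewrite -[leRHS]invrK lef_pV2 ?posrE ?invr_gt0//.
  by rewrite (le_trans (ltW (archi_boundP d'0)))// ler_nat (leq_trans dn).
have yI n : t0 <= y n <= t1 by have [] := Hy n.
have /cvgrPdist_le/(_ e e0)[n _ /(_ n (leqnn n))] := alpha_cvg xI yI yx.
by move=> /=; have [_ _] := Hy n; rewrite ltNge => /negP.
Qed.

(** The same Riemann sums of [alpha] converge to both sides. *)
Lemma Bethe_increment : (Phimu psi psib mu h t1 t1 - Phimu psi psib mu h t0 t0
  = \int[@lebesgue_measure R]_(x in `[t0, t1]) (alpha x)%:E)%E.
Proof.
have I0 : t0 <= t0 <= t1 by rewrite lexx ltW.
have I1 : t0 <= t1 <= t1 by rewrite lexx ltW.
have f0 : Phimu psi psib mu h t0 t0 \is a fin_num.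
  exact: (integrable_fin_num measurableT (integrable_PhiT I0)).
have f1 : Phimu psi psib mu h t1 t1 \is a fin_num.
  exact: (integrable_fin_num measurableT (integrable_PhiT I1)).
have fa : (\int[@lebesgue_measure R]_(x in `[t0, t1]) (alpha x)%:E)%E \is a fin_num.
  apply: integrable_fin_num => //.
  by apply: continuous_compact_integrable alpha_continuous; exact: segment_compact.
rewrite -(fineK f0) -(fineK f1) -(fineK fa) -EFinB; congr EFin.
exact: (cvg_unique _ Phimu_riemann (riemann_sum t01 alpha_continuous)).
Qed.

End Expectation.

(** * Interpolation along one parameter *)

Section Interpolation.
Variables (R : realType) (X : finType).
Variables (psi : R -> X -> X -> R) (psib : R -> X -> R).
Variables (P : forall n, fgr n -> R) (mu : probability graphT R).
Variable h : msgT R X.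
Variables (t0 t1 : R).
Hypothesis h1 : H1 psi psib.
Hypothesis lw : lwc P mu.
Hypothesis h2 : H2 psi mu.
Hypothesis h_ge0 : forall p b s, 0 <= h p b b s.
Hypothesis h_sum : forall p b, \sum_(s : X) h p b b s = 1.
Hypothesis h_meas : forall b s, measurable_fun setT (fun p => h p b b s).
Hypothesis h_inv : forall b s, dr_invariant (fun p => h p b b s).
Hypothesis t01 : t0 < t1.
Hypothesis fp : forall b, t0 <= b <= t1 -> isFP psi psib mu h b b.
Hypothesis h3 : exists C : R, upae mu (fun (g : graphT) j => forall s,
    {within `[t0, t1], continuous (fun b => h (g, j) b b s)} /\
    (total_variation t0 t1 (fun b => h (g, j) b b s) <= C%:E)%E).

Let f n th := phin psi psib P n th th.
Let df n th := phin_deriv psi psib P n th.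
Let lim th := (avx_lim psi psib mu h th th + ae_lim psi psib mu h th th)%E.

Let Bethe : exists a : R -> R, [/\ {within `[t0, t1], continuous a},
  (forall th, t0 <= th <= t1 -> (a th)%:E = lim th) &
  (Phimu psi psib mu h t1 t1 - Phimu psi psib mu h t0 t0
   = \int[@lebesgue_measure R]_(x in `[t0, t1]) (a x)%:E)%E].
Proof.
have [_ _ [lfmu umu] _ _] := lw; have [C hC] := h3.
have [K HK] := spec_bound_exists h1 t01.
(* The domination needs a nonnegative variation bound, so [C] is enlarged. *)
have C0 : 0 <= Num.max C 0 by rewrite le_max lexx orbT.
have hC' : upae mu (fun (g : graphT) j => forall s,
    {within `[t0, t1], continuous (fun b => h (g, j) b b s)} /\
    (total_variation t0 t1 (fun b => h (g, j) b b s) <= (Num.max C 0)%:E)%E).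
  apply: filterS hC => g H j gj s; have [c tv] := H j gj s; split => //.
  by rewrite (le_trans tv)// lee_fin le_max lexx.
exists (alpha psi psib h mu); split.
- exact: (alpha_continuous h1 h_ge0 h_sum h_meas h_inv umu lfmu h2 fp hC' HK).
- by move=> th thI; exact: (alphaE h1 h_ge0 h_sum h_meas h_inv umu lfmu h2 fp HK thI).
- exact: (Bethe_increment h1 h_ge0 h_sum h_meas h_inv umu lfmu h2 t01 fp C0 hC' HK).
Qed.

Let df_bounded : exists C : R, exists n0, forall n th, (n0 <= n)%N -> t0 <= th <= t1 ->
  `|df n th| <= C.
Proof.
have [K [K1 HK]] := spec_bound_exists h1 t01; have [C [n0 HC]] := mean_degree_bounded lw.
have [[P0 P1] _ _ _ _] := lw.
have K0 : 0 <= K := le_trans ler01 K1.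
exists (K * (1 + C)), n0 => n th nn0 /HK[_ _ _ _ [dK dbK]].
have := phin_deriv_le h1 K0 (P0 n) (P1 n) dK dbK; move=> /le_trans; apply.
by rewrite ler_wpM2l// lerD2l; exact: HC.
Qed.

Let f_derive n (th : R) : is_derive th 1 (f n) (df n th).
Proof. exact: (is_derive_phin h1). Qed.

Let df_continuous n : {within `[t0, t1], continuous (df n)}.
Proof. by apply: continuous_subspaceT; exact: (phin_deriv_continuous h1). Qed.

Lemma interpolation_limsup :
  (forall th, t0 <= th <= t1 -> (limn_esup (fun n => (df n th)%:E) <= lim th)%E) ->
  (limn_esup (fun n => (f n t1 - f n t0)%:E)
    <= Phimu psi psib mu h t1 t1 - Phimu psi psib mu h t0 t0)%E.
Proof.
move=> H; have [a [ca aE ->]] := Bethe; have [C [n0 HC]] := df_bounded.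
apply: (limn_esup_increment t01 (df := df) (n0 := n0) (C := C)) => //.
by move=> th thI; rewrite aE//; exact: H.
Qed.

(** The upper-limit statement for the negated functions; the identity for the Bethe increment is
    insensitive to the sign. *)
Lemma interpolation_liminf :
  (forall th, t0 <= th <= t1 -> (lim th <= limn_einf (fun n => (df n th)%:E))%E) ->
  (Phimu psi psib mu h t1 t1 - Phimu psi psib mu h t0 t0
    <= limn_einf (fun n => (f n t1 - f n t0)%:E))%E.
Proof.
move=> H; have [a [ca aE ->]] := Bethe; have [C [n0 HC]] := df_bounded.
have := @limn_esup_increment _ _ _ t01 (fun n th => - f n th) (fun n th => - df n th)
  (fun th => - a th) C n0.
have -> : (fun n => (- f n t1 - - f n t0)%:E) = (-%E \o (fun n => (f n t1 - f n t0)%:E)).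
  by apply/funext => n /=; rewrite -?EFinN; congr EFin; ring.
rewrite limn_esupN.
have -> : (\int[@lebesgue_measure R]_(x in `[t0, t1]) (- a x)%:E
    = - \int[@lebesgue_measure R]_(x in `[t0, t1]) (a x)%:E)%E.
  have ia : (@lebesgue_measure R).-integrable `[t0, t1] (EFin \o a).
    by apply: continuous_compact_integrable ca; exact: segment_compact.
  transitivity (\int[@lebesgue_measure R]_(x in `[t0, t1]) ((- 1)%:E * (a x)%:E))%E.
    by apply: eq_integral => x _; rewrite -EFinM mulN1r.
  by rewrite integralZl// EFinN mulN1e.
rewrite leeN2; apply.
- by move=> n th _; exact: is_deriveN.
- by move=> n x; apply: cvgN; exact: df_continuous.
- by move=> n th nn0 thI; rewrite normrN; exact: HC.
- by move=> x; apply: cvgN; exact: ca.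
- move=> th thI; rewrite EFinN aE// -[X in (limn_esup X <= _)%E]/(-%E \o (fun n => (df n th)%:E)).
  by rewrite limn_esupN leeN2; exact: H.
Qed.

End Interpolation.

(** * Freezing one of the two parameters *)

Section Constant.
Variables (R : realType) (X : finType).

Lemma dxi_cst (psi : R -> X -> X -> R) b b' s t : dxi (fun=> psi b) b' s t = 0.
Proof.
rewrite /dxi; case: pselect => z //=; rewrite derive1E.
exact: derive_cst.
Qed.

Lemma dxib_cst (psib : R -> X -> R) b b' s : dxib (fun=> psib b) b' s = 0.
Proof. by rewrite /dxib derive1E; exact: derive_cst. Qed.

Lemma continuous_derive1_cst (c : R) : continuous (derive1 (fun _ : R => c)).
Proof.
rewrite (_ : derive1 _ = cst 0); first by move=> x; exact: cvg_cst.
by apply/funext => x; rewrite derive1E; exact: derive_cst.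
Qed.

Variables (psi : R -> X -> X -> R) (psib : R -> X -> R).
Variables (P : forall n, fgr n -> R) (mu : probability graphT R).

Lemma phin_deriv_fix_field B n th :
  phin_deriv psi (fun=> psib B) P n th = aen psi psib P n th B.
Proof.
rewrite /phin_deriv (_ : avxn _ _ _ _ _ _ = 0) ?addr0//.
rewrite /avxn /En big1// => E _; rewrite big1 ?mulr0// => i _.
by rewrite /gavg big1 ?mul0r// => s _; rewrite dxib_cst mul0r.
Qed.

Lemma phin_deriv_fix_coupling b n th :
  phin_deriv (fun=> psi b) psib P n th = avxn psi psib P n b th.
Proof.
rewrite /phin_deriv (_ : aen _ _ _ _ _ _ = 0) ?add0r//.
rewrite /aen /En big1 ?mulr0// => E _; rewrite big1 ?mulr0// => i _.
rewrite big1// => j _.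
by rewrite /gavg big1 ?mul0r// => s _; rewrite dxi_cst mul0r.
Qed.

Lemma lim_fix_field B th (h : msgT R X) :
  (avx_lim psi (fun=> psib B) mu (fun p b _ => h p b B) th th
     + ae_lim psi (fun=> psib B) mu (fun p b _ => h p b B) th th
   = ae_lim psi psib mu h th B)%E.
Proof.
rewrite (_ : avx_lim _ _ _ _ _ _ = 0%E) ?add0e//.
rewrite /avx_lim -[RHS](integral0 mu setT); apply: eq_integral => g _.
by congr EFin; rewrite /tavg1 big1 ?mul0r// => s _; rewrite dxib_cst mul0r.
Qed.

Lemma lim_fix_coupling b th (h : msgT R X) :
  (avx_lim (fun=> psi b) psib mu (fun p _ B => h p b B) th th
     + ae_lim (fun=> psi b) psib mu (fun p _ B => h p b B) th th
   = avx_lim psi psib mu h b th)%E.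
Proof.
rewrite (_ : ae_lim _ _ _ _ _ _ = 0%E) ?adde0//.
rewrite /ae_lim [X in (_ * X)%E](_ : _ = 0%E) ?mule0//.
rewrite -[RHS](integral0 mu setT); apply: eq_integral => g _.
congr EFin; apply: big1 => j _; rewrite /tavg2 big1 ?mul0r// => s _.
by rewrite big1// => t _; rewrite dxi_cst mul0r.
Qed.

Lemma H2_fix_coupling b : H2 psi mu -> H2 (fun=> psi b) mu.
Proof.
move=> [h2a h2e]; split => // np; apply: h2e => p; apply: np => _ s t.
exact: p.
Qed.

Hypothesis h1 : H1 psi psib.

Lemma H1_fix_field B : H1 psi (fun=> psib B).
Proof.
have [a b c d e] := h1; split => //.
by move=> s; split; [move=> B'; exact: derivable_cst|exact: continuous_derive1_cst].
Qed.

Lemma H1_fix_coupling b : H1 (fun=> psi b) psib.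
Proof.
have [a b' [sp c] d e] := h1; split => //; first by exists sp.
move=> s t; have [z|p] := psi_dichotomy h1 s t; first by left.
right; split => //; split; last exact: continuous_derive1_cst.
by move=> x; exact: derivable_cst.
Qed.

End Constant.

Section Slices.
Variables (R : realType) (X : finType) (h : msgT R X).
Hypothesis mh : is_msg h.

Lemma measurable_msg_slice b B s : measurable_fun setT (fun p => h p b B s).
Proof.
have [_ _ + _] := mh => /(_ s) m.
apply: (measurableT_comp m (g := fun p => (p, (b, B)))).
exact: measurable_fun_pair.
Qed.

End Slices.

Theorem mainTheorem5 (R : realType) (X : finType)
    (psi : R -> X -> X -> R) (psib : R -> X -> R)
    (P : forall n : nat, fgr n -> R) (mu : probability graphT R) :
  H1 psi psib -> lwc P mu -> H2 psi mu ->
  (* (a) *)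
  (forall (B b0 b1 : R) (h : msgT R X), b0 < b1 -> is_msg h ->
     (forall b, b0 <= b <= b1 -> isFP psi psib mu h b B) ->
     H3b mu h B b0 b1 ->
     (forall b, b0 <= b <= b1 ->
        (limn_esup (fun n => (aen psi psib P n b B)%:E)
          <= ae_lim psi psib mu h b B)%E) ->
     (limn_esup (fun n => (phin psi psib P n b1 B - phin psi psib P n b0 B)%:E)
        <= Phimu psi psib mu h b1 B - Phimu psi psib mu h b0 B)%E) /\
  (* (b) *)
  (forall (b B0 B1 : R) (h : msgT R X), B0 < B1 -> is_msg h ->
     (forall B, B0 <= B <= B1 -> isFP psi psib mu h b B) ->
     H3B mu h b B0 B1 ->
     (forall B, B0 <= B <= B1 ->
        (limn_esup (fun n => (avxn psi psib P n b B)%:E)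
          <= avx_lim psi psib mu h b B)%E) ->
     (limn_esup (fun n => (phin psi psib P n b B1 - phin psi psib P n b B0)%:E)
        <= Phimu psi psib mu h b B1 - Phimu psi psib mu h b B0)%E) /\
  (* (a), reversed *)
  (forall (B b0 b1 : R) (h : msgT R X), b0 < b1 -> is_msg h ->
     (forall b, b0 <= b <= b1 -> isFP psi psib mu h b B) ->
     H3b mu h B b0 b1 ->
     (forall b, b0 <= b <= b1 ->
        (ae_lim psi psib mu h b B
          <= limn_einf (fun n => (aen psi psib P n b B)%:E))%E) ->
     (Phimu psi psib mu h b1 B - Phimu psi psib mu h b0 B
        <= limn_einf (fun n => (phin psi psib P n b1 B - phin psi psib P n b0 B)%:E))%E) /\
  (* (b), reversed *)
  (forall (b B0 B1 : R) (h : msgT R X), B0 < B1 -> is_msg h ->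
     (forall B, B0 <= B <= B1 -> isFP psi psib mu h b B) ->
     H3B mu h b B0 B1 ->
     (forall B, B0 <= B <= B1 ->
        (avx_lim psi psib mu h b B
          <= limn_einf (fun n => (avxn psi psib P n b B)%:E))%E) ->
     (Phimu psi psib mu h b B1 - Phimu psi psib mu h b B0
        <= limn_einf (fun n => (phin psi psib P n b B1 - phin psi psib P n b B0)%:E))%E).
Proof.
move=> h1 lw h2.
do !split.
- move=> B b0 b1 h b01 mh fp h3 H; have [m0 m1 mm mi] := mh.
  (* With [psib] frozen at [B] and the message restricted to that slice, diagonal quantities at [th]
     are by conversion the original ones at [(th, B)], and the vertex derivative is zero. The other
     three cases are alike. *)
  apply: (@interpolation_limsup R X psi (fun=> psib B) P mu (fun p b _ => h p b B) b0 b1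
    (H1_fix_field h1 B) lw h2) => //.
  + by move=> b s; exact: measurable_msg_slice.
  + move=> th thI; rewrite lim_fix_field.
    under eq_fun do rewrite phin_deriv_fix_field.
    exact: H.
- move=> b B0 B1 h B01 mh fp h3 H; have [m0 m1 mm mi] := mh.
  apply: (@interpolation_limsup R X (fun=> psi b) psib P mu (fun p _ B => h p b B) B0 B1
    (H1_fix_coupling h1 b) lw (H2_fix_coupling b h2)) => //.
  + by move=> B s; exact: measurable_msg_slice.
  + move=> th thI; rewrite lim_fix_coupling.
    under eq_fun do rewrite phin_deriv_fix_coupling.
    exact: H.
- move=> B b0 b1 h b01 mh fp h3 H; have [m0 m1 mm mi] := mh.
  apply: (@interpolation_liminf R X psi (fun=> psib B) P mu (fun p b _ => h p b B) b0 b1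
    (H1_fix_field h1 B) lw h2) => //.
  + by move=> b s; exact: measurable_msg_slice.
  + move=> th thI; rewrite lim_fix_field.
    under eq_fun do rewrite phin_deriv_fix_field.
    exact: H.
- move=> b B0 B1 h B01 mh fp h3 H; have [m0 m1 mm mi] := mh.
  apply: (@interpolation_liminf R X (fun=> psi b) psib P mu (fun p _ B => h p b B) B0 B1
    (H1_fix_coupling h1 b) lw (H2_fix_coupling b h2)) => //.
  + by move=> B s; exact: measurable_msg_slice.
  + move=> th thI; rewrite lim_fix_coupling.
    under eq_fun do rewrite phin_deriv_fix_coupling.
    exact: H.
Qed.
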